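(* Given $M>0$ there exist constants $\bar T\le1$ and $K$ depending only on $M$ such that for any initial data $X_0,\tilde X_0\in\mathcal G\cap B_M$, the solutions $X(t),\tilde X(t)$ of the dissipative system with these initial data satisfy $$\sup_{t\in[0,\bar T]}d_{\mathbb R}(X(t),\tilde X(t))\le K\,d_{\mathbb R}(X_0,\tilde X_0).$$
   Context: Fix a smooth function $\chi:\mathbb R\to\mathbb R$ with $\chi'\ge0$, $\chi(x)=0$ for $x\le0$, $\chi(x)=1$ for $x\ge1$. Let $E=L^2(\mathbb R)\cap L^\infty(\mathbb R)$ with $\|f\|_E=\|f\|_{L^2}+\|f\|_{L^\infty}$. A state is $X=(\zeta,\bar U,c,q,w,h,\bar r,k)$ ($\zeta,\bar U,q,w,h,\bar r$ functions of $\xi$; $c,k\in\mathbb R$); $y=\xi+\zeta$, $U=\bar U+c\,\chi\circ y$, $v=q-1$, $r=\bar r+kq$. $\bar V$: states with $\zeta\in L^\infty$, $\bar U,v,w,h,\bar r\in E$, norm $\|X\|_{\bar V}=\|\zeta\|_{L^\infty}+\|\bar U\|_E+|c|+\|v\|_E+\|w\|_E+\|h\|_E+\|\bar r\|_E+|k|$; $B_M=\{X\in\bar V:\|X\|_{\bar V}+\|1/(q+h)\|_{L^\infty}\le M\}$. Also $\|X\|_V=\|\zeta\|_{L^\infty}+\|\bar U\|_{L^2}+|c|+\|v\|_{L^2}+\|w\|_{L^2}+\|h\|_{L^2}+\|\bar r\|_{L^2}+|k|$. On $\mathbb R^8$: $g_1(x)=|x_5|+2|x_7x_8|+2x_4$,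 $g_2(x)=x_4+x_6$, $\Omega_1=\{g_1\le g_2,x_5\le0,x_7+x_8x_4=0\}$, $g=g_1$ on $\Omega_1$, $g=g_2$ elsewhere; $g(X)(\xi)=g(y,\bar U,c,q,w,h,\bar r,k)(\xi)$. The metric is $d_{\mathbb R}(X,\tilde X)=\|X-\tilde X\|_V+\|g(X)-g(\tilde X)\|_{L^2}+\kappa(X,\tilde X)$, where $\kappa(X,\tilde X)=1$ if the set of $\xi$ where exactly one of $r(\xi),\tilde r(\xi)$ vanishes has positive measure, and $0$ otherwise. $\mathcal G$: states with $q=y_\xi$, $w=U_\xi$, $X\in\bar V$, $g(X)-1\in E$, $y_\xi\ge0$, $h\ge0$ a.e., $\lim_{\xi\to-\infty}\zeta=0$, $1/(y_\xi+h)\in L^\infty$, $y_\xi h=U_\xi^2+\bar r^2$ a.e. Dissipative system: $\tau(\xi)=0$ if $q(0,\xi)=0$, else $\tau(\xi)=\sup\{t\ge0:q(t',\xi)>0\ \forall\,0\le t'<t\}$; $y_t=U$, $U_t=-Q(X)$, $q_t=\mathbf 1_{\{\tau>t\}}w$, $w_t=\mathbf 1_{\{\tau>t\}}(\tfrac12h+(U^2+\tfrac12k^2-P(X))q+k\bar r)$, $h_t=\mathbf 1_{\{\tau>t\}}2(U^2+\tfrac12k^2-P(X))w$, $\bar r_t=-\mathbf 1_{\{\tau>t\}}kw$, $c_t=k_t=0$, with $F=2c\,\chi\circ y\,\bar Uq+\bar U^2q+\tfrac12h+k\bar r$, $G=2c^2(\chi'^2+\chi\chi'')(y)q$, $P(X)-U^2-\tfrac12k^2=-2c\chi(y)\bar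 U-\bar U^2+\tfrac12\int_{\{\tau(\eta)>t\}}e^{-|y(\xi)-y(\eta)|}F(\eta)d\eta+\tfrac12\int_{\mathbb R}e^{-|y(\xi)-y(\eta)|}G(\eta)d\eta$, $Q(X)=2c^2\chi(y)\chi'(y)-\tfrac12\int_{\{\tau(\eta)>t\}}\operatorname{sgn}(\xi-\eta)e^{-|y(\xi)-y(\eta)|}F(\eta)d\eta-\tfrac12\int_{\mathbb R}\operatorname{sgn}(\xi-\eta)e^{-|y(\xi)-y(\eta)|}G(\eta)d\eta$ (all at time $t$). Solutions with data in $\mathcal G$ exist globally and are unique. *)

(* Defs.v *)
From mathcomp Require Import all_boot all_order all_algebra all_classical all_reals all_analysis.
Import Order.TTheory GRing.Theory Num.Theory.
Import numFieldNormedType.Exports.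

Set Implicit Arguments.
Unset Strict Implicit.
Unset Printing Implicit Defensive.

Local Open Scope classical_set_scope.
Local Open Scope ring_scope.

Section Defs.
Variable R : realType.

Local Notation mu := (@lebesgue_measure R).

Definition L2norm (f : R -> R) : \bar R := Lnorm mu 2%:E (EFin \o f).
Definition Linfnorm (f : R -> R) : \bar R := Lnorm mu +oo%E (EFin \o f).

Definition inL2 (f : R -> R) : Prop :=
  measurable_fun setT f /\ (L2norm f < +oo)%E.
Definition inLinf (f : R -> R) : Prop :=
  measurable_fun setT f /\ (Linfnorm f < +oo)%E.

Definition inE (f : R -> R) : Prop := inL2 f /\ inLinf f.
Definition Enorm (f : R -> R) : \bar R := (L2norm f + Linfnorm f)%E.

Definition inv_inLinf (f : R -> R) : Prop :=
  (\forall x \ae mu, f x != 0) /\ inLinf (fun x => (f x)^-1).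

(* weak derivative: f is locally absolutely continuous with f' = g, i.e.
   f b - f a = int_a^b g for all a <= b (g locally integrable). *)
Definition weak_deriv (f g : R -> R) : Prop :=
  forall a b : R, a <= b ->
    mu.-integrable `[a, b] (EFin \o g) /\
    f b - f a = (\int[mu]_(x in `[a, b]) g x)%R.

Record state := State {
  zeta : R -> R; Ubar : R -> R; cc : R; qq : R -> R;
  ww : R -> R; hh : R -> R; rbar : R -> R; kk : R }.

Variable chi : R -> R.
Local Notation chi1 := (derive1n 1 chi).
Local Notation chi2 := (derive1n 2 chi).

Definition yy (X : state) (xi : R) : R := xi + zeta X xi.
Definition UU (X : state) (xi : R) : R := Ubar X xi + cc X * chi (yy X xi).
Definition vv (X : state) (xi : R) : R := qq X xi - 1.
Definition rr (X : state) (xi : R) : R := rbar X xi + kk X * qq X xi.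

Definition inVbar (X : state) : Prop :=
  inLinf (zeta X) /\ inE (Ubar X) /\ inE (vv X) /\ inE (ww X) /\
  inE (hh X) /\ inE (rbar X).

Definition Vbarnorm (X : state) : \bar R :=
  (Linfnorm (zeta X) + Enorm (Ubar X) + `|cc X|%:E + Enorm (vv X)
   + Enorm (ww X) + Enorm (hh X) + Enorm (rbar X) + `|kk X|%:E)%E.

Definition inB (M : R) (X : state) : Prop :=
  inVbar X /\ inv_inLinf (fun xi => qq X xi + hh X xi) /\
  (Vbarnorm X + Linfnorm (fun xi => (qq X xi + hh X xi)^-1)%R <= M%:E)%E.

Definition Vnorm_diff (X Xt : state) : \bar R :=
  (Linfnorm (fun xi => (zeta X xi - zeta Xt xi)%R)
   + L2norm (fun xi => (Ubar X xi - Ubar Xt xi)%R)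
   + `|(cc X - cc Xt)%R|%:E
   + L2norm (fun xi => (vv X xi - vv Xt xi)%R)
   + L2norm (fun xi => (ww X xi - ww Xt xi)%R)
   + L2norm (fun xi => (hh X xi - hh Xt xi)%R)
   + L2norm (fun xi => (rbar X xi - rbar Xt xi)%R)
   + `|(kk X - kk Xt)%R|%:E)%E.

Definition g1 (x1 x2 x3 x4 x5 x6 x7 x8 : R) : R :=
  `|x5| + 2 * `|x7 * x8| + 2 * x4.
Definition g2 (x1 x2 x3 x4 x5 x6 x7 x8 : R) : R := x4 + x6.
Definition inOmega1 (x1 x2 x3 x4 x5 x6 x7 x8 : R) : bool :=
  [&& g1 x1 x2 x3 x4 x5 x6 x7 x8 <= g2 x1 x2 x3 x4 x5 x6 x7 x8,
      x5 <= 0 & x7 + x8 * x4 == 0].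
Definition g8 (x1 x2 x3 x4 x5 x6 x7 x8 : R) : R :=
  if inOmega1 x1 x2 x3 x4 x5 x6 x7 x8 then g1 x1 x2 x3 x4 x5 x6 x7 x8
  else g2 x1 x2 x3 x4 x5 x6 x7 x8.

Definition gX (X : state) (xi : R) : R :=
  g8 (yy X xi) (Ubar X xi) (cc X) (qq X xi) (ww X xi) (hh X xi)
     (rbar X xi) (kk X).

Definition kappa (X Xt : state) : R :=
  if (0 < mu [set xi | (rr X xi == 0%R) != (rr Xt xi == 0%R)])%E then 1 else 0.

Definition dR (X Xt : state) : \bar R :=
  (Vnorm_diff X Xt + L2norm (fun xi => (gX X xi - gX Xt xi)%R)
   + (kappa X Xt)%:E)%E.

Definition inG (X : state) : Prop :=
  weak_deriv (yy X) (qq X) /\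
  weak_deriv (UU X) (ww X) /\
  inVbar X /\
  inE (fun xi => gX X xi - 1) /\
  (\forall xi \ae mu, 0 <= qq X xi) /\
  (\forall xi \ae mu, 0 <= hh X xi) /\
  zeta X x @[x --> -oo] --> 0 /\
  inv_inLinf (fun xi => qq X xi + hh X xi) /\
  (\forall xi \ae mu, qq X xi * hh X xi = ww X xi ^+ 2 + rbar X xi ^+ 2).

Definition tau (X : R -> state) (xi : R) : \bar R :=
  if qq (X 0) xi == 0 then 0%E
  else ereal_sup [set t%:E | t in
         [set t : R | 0 <= t /\ forall t', 0 <= t' < t -> 0 < qq (X t') xi]].

Definition Ffun (X : state) (eta : R) : R :=
  2 * cc X * chi (yy X eta) * Ubar X eta * qq X eta
  + Ubar X eta ^+ 2 * qq X eta + hh X eta / 2 + kk X * rbar X eta.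

Definition Gfun (X : state) (eta : R) : R :=
  2 * cc X ^+ 2 * (chi1 (yy X eta) ^+ 2 + chi (yy X eta) * chi2 (yy X eta))
  * qq X eta.

(* PmU = P(X) - U^2 - k^2/2 at time t (ta = tau of the trajectory) *)
Definition PmU (ta : R -> \bar R) (t : R) (X : state) (xi : R) : R :=
  - 2 * cc X * chi (yy X xi) * Ubar X xi - Ubar X xi ^+ 2
  + (\int[mu]_(eta in [set eta | (t%:E < ta eta)%E])
       (expR (- `|yy X xi - yy X eta|) * Ffun X eta)) / 2
  + (\int[mu]_(eta in [set: R])
       (expR (- `|yy X xi - yy X eta|) * Gfun X eta)) / 2.

Definition Qfun (ta : R -> \bar R) (t : R) (X : state) (xi : R) : R :=
  2 * cc X ^+ 2 * chi (yy X xi) * chi1 (yy X xi)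
  - (\int[mu]_(eta in [set eta | (t%:E < ta eta)%E])
       (Num.sg (xi - eta) * expR (- `|yy X xi - yy X eta|) * Ffun X eta)) / 2
  - (\int[mu]_(eta in [set: R])
       (Num.sg (xi - eta) * expR (- `|yy X xi - yy X eta|) * Gfun X eta)) / 2.

Definition integ_eq (rhs : R -> R) (t : R) (delta : R) : Prop :=
  mu.-integrable `[0, t] (EFin \o rhs) /\
  delta = (\int[mu]_(s in `[0, t]) rhs s)%R.

Definition ind (ta : R -> \bar R) (xi s : R) : R :=
  if (s%:E < ta xi)%E then 1 else 0.

Definition is_solution (X0 : state) (X : R -> state) : Prop :=
  let ta := tau X in
  X 0 = X0 /\
  (forall t, 0 <= t -> inVbar (X t)) /\
  (forall T, exists C : R, forall t, 0 <= t <= T -> (Vbarnorm (X t) <= C%:E)%E) /\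
  (forall t, 0 <= t -> cc (X t) = cc X0 /\ kk (X t) = kk X0) /\
  (forall t xi, 0 <= t ->
     integ_eq (fun s => UU (X s) xi) t (yy (X t) xi - yy X0 xi) /\
     integ_eq (fun s => - Qfun ta s (X s) xi) t (UU (X t) xi - UU X0 xi) /\
     integ_eq (fun s => ind ta xi s * ww (X s) xi) t (qq (X t) xi - qq X0 xi) /\
     integ_eq (fun s => ind ta xi s *
                 (hh (X s) xi / 2 - PmU ta s (X s) xi * qq (X s) xi
                  + kk (X s) * rbar (X s) xi))
              t (ww (X t) xi - ww X0 xi) /\
     integ_eq (fun s => ind ta xi s * (2 * (- PmU ta s (X s) xi) * ww (X s) xi))
              t (hh (X t) xi - hh X0 xi) /\
     integ_eq (fun s => - (ind ta xi s * kk (X s) * ww (X s) xi))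
              t (rbar (X t) xi - rbar X0 xi)).

End Defs.

Definition admissible_chi (R : realType) (chi : R -> R) : Prop :=
  (forall (n : nat) (x : R), derivable (derive1n n chi) x 1) /\
  (forall x, 0 <= derive1n 1 chi x) /\
  (forall x, x <= 0 -> chi x = 0) /\
  (forall x, 1 <= x -> chi x = 1).

(* Main.v *)
(** For almost every label xi the unknowns (q, w, h, rbar) solve a linear ordinary
    differential equation in time, frozen once q vanishes, coupled to the other labels
    only through P and Q, which are convolutions of bounded densities with the kernel
    exp(-|x|).  Two such trajectories differ by their data, by the difference of the
    two P, and by the gap between their stopping times.  A trajectory that stops has
    r = 0, and near its stopping time q and w are small, h is bounded below, hence
    w_t >= m / 8: so a gap between stopping times costs a proportional difference of
    the data.  The function g, which separates w <= 0 from w > 0 in this regime, and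
    kappa, which separates r = 0 from r <> 0, exclude that only one of two close
    trajectories is about to stop.

    Integrated over time, the difference of the two P contains the convolution of the
    gap, which is therefore not small with the time span.  It is, however, controlled
    by the same quantities convolved once more: a common majorant Phi of all
    differences is mapped to a better one of the form K (data + S (Phi + conv Phi)),
    whose L^2 norm contracts for a short time S, since the convolution is bounded on
    L^2.  The L^infinity difference of zeta and U is carried along as a constant, by a
    Sobolev inequality for the data and by conv f <= 2 |f|_2 afterwards. *)
Require Import Defs.
From mathcomp Require Import all_boot all_order all_algebra all_classical all_reals all_analysis.
From mathcomp Require Import measurable_realfun ess_sup_inf ring lra.
Import Order.TTheory GRing.Theory Num.Theory.
Import numFieldNormedType.Exports.

Set Implicit Arguments.
Unset Strict Implicit.
Unset Printing Implicit Defensive.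

Local Open Scope classical_set_scope.
Local Open Scope ring_scope.

(** * Primitives of integrable functions on a time interval *)

Section Primitives.
Variable R : realType.
Local Notation mu := (@lebesgue_measure R).
Implicit Types f g : R -> R.

(** Stopping is a pointwise event in the label, whereas the metric is of L^2 type and the coupling
    is nonlocal. So no norm is estimated directly: one function of the label bounds a difference for
    all times at once, pointwise arguments act on it, and its L^2 norm is taken only at the end. The
    contraction rests on one cancellation. [P] enters [w_t] only through [P q], and before a stop
    within [0, S] one has [q <= B S], because [q] is Lipschitz and vanishes at the stop. Hence the
    gap between stopping times carries a factor S in front of everything but the data, although the
    nonlocal terms themselves do not. Each step therefore improves the bound of the gap before
    anything else, and only the improved bound is convolved in the estimates of the other unknowns.
    Two iterations occur: one turns the constant bound of a single solution into a square integrable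
    one, the other contracts the distance of two solutions. In both the starting bound drops out.
    Data at distance at least 1 need only a bound of the later distance; below 1, [kappa] is 0. *)

Definition prim_on (a b : R) f g : Prop :=
  forall s t, a <= s -> s <= t -> t <= b ->
    mu.-integrable `[s, t] (EFin \o g) /\
    f t - f s = \int[mu]_(x in `[s, t]) g x.

Lemma prim_on_sub a b a' b' f g : a <= a' -> b' <= b ->
  prim_on a b f g -> prim_on a' b' f g.
Proof.
move=> aa bb H s t s1 st t1.
by apply: H => //; [exact: le_trans s1|exact: le_trans bb].
Qed.

(** The equations start at time 0; as increments on every subinterval they can be restarted at a
    stopping time, where the right-hand side changes. *)
Lemma integ_eq_prim_on T f g :
  (forall t, 0 <= t <= T -> integ_eq g t (f t - f 0)) -> prim_on 0 T f g.
Proof.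
move=> H s t s0 st tT.
have [it et] := H t (introT andP (conj (le_trans s0 st) tT)).
have [is_ es] := H s (introT andP (conj s0 (le_trans st tT))).
split.
  by apply: integrableS it => //; apply: subset_itvr; rewrite bnd_simp.
have -> : f t - f s = (f t - f 0) - (f s - f 0) by ring.
rewrite et es (@Rintegral_itvB _ g (BLeft 0) (BRight t) s) //=.
rewrite Rintegral_itv_obnd_cbnd//.
apply: integrableS it => //; apply: subset_itvr; rewrite bnd_simp//.
Qed.

Lemma prim_on_comb a b (x y : R) f1 g1 f2 g2 :
  prim_on a b f1 g1 -> prim_on a b f2 g2 ->
  prim_on a b (fun t => x * f1 t + y * f2 t) (fun t => x * g1 t + y * g2 t).
Proof.
move=> H1 H2 s t s0 st tT.
have [i1 e1] := H1 s t s0 st tT; have [i2 e2] := H2 s t s0 st tT.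
have j1 : mu.-integrable `[s, t] (EFin \o (fun t => x * g1 t)).
  by apply: eq_integrable (integrableZl _ x i1).
have j2 : mu.-integrable `[s, t] (EFin \o (fun t => y * g2 t)).
  by apply: eq_integrable (integrableZl _ y i2).
split; first by apply: eq_integrable (integrableD _ j1 j2).
rewrite RintegralD// !RintegralZl// -e1 -e2; ring.
Qed.

Lemma eq_prim_on a b f1 g1 f2 g2 : f1 =1 f2 -> g1 =1 g2 ->
  prim_on a b f1 g1 -> prim_on a b f2 g2.
Proof. by move=> /funext -> /funext ->. Qed.

Lemma prim_onD a b f1 g1 f2 g2 : prim_on a b f1 g1 -> prim_on a b f2 g2 ->
  prim_on a b (fun t => f1 t + f2 t) (fun t => g1 t + g2 t).
Proof.
by move=> H1 H2; apply: eq_prim_on (prim_on_comb 1 1 H1 H2) => t; rewrite !mul1r.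
Qed.

Lemma prim_onZ a b x f g : prim_on a b f g ->
  prim_on a b (fun t => x * f t) (fun t => x * g t).
Proof.
by move=> H; apply: eq_prim_on (prim_on_comb x 0 H H) => t; rewrite !mul0r addr0.
Qed.

Lemma prim_onB a b f1 g1 f2 g2 : prim_on a b f1 g1 -> prim_on a b f2 g2 ->
  prim_on a b (fun t => f1 t - f2 t) (fun t => g1 t - g2 t).
Proof.
by move=> H1 H2; apply: eq_prim_on (prim_on_comb 1 (-1) H1 H2) => t; rewrite mul1r mulN1r.
Qed.

Lemma integrable_itv_cst (x s t : R) :
  mu.-integrable `[s, t] (EFin \o (fun=> x)).
Proof.
apply: measurable_bounded_integrable => //.
  exact: compact_finite_measure (@segment_compact _ s t).
exists `|x|; split; first exact: num_real.
by move=> y xy z _; exact: ltW.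
Qed.

Lemma prim_on_cst a b (x : R) : prim_on a b (fun t => x * t) (fun=> x).
Proof.
move=> s t _ st _; split; first exact: integrable_itv_cst.
have muE : mu `[s, t] = (t - s)%:E.
  rewrite lebesgue_measure_itv/= lte_fin; move: st; rewrite le_eqVlt.
  by move=> /predU1P[->|->]; rewrite ?ltxx ?subrr.
rewrite Rintegral_cst// -mulrBr; congr (_ * _).
by rewrite -[LHS]/(fine (t - s)%:E) -muE.
Qed.

(** The comparison is asked on the open interval only, endpoints being null. Stopping times can thus
    be endpoints, whatever the value of the indicator there. *)
Lemma prim_on_le a b f1 g1 f2 g2 : a <= b ->
  prim_on a b f1 g1 -> prim_on a b f2 g2 ->
  (forall x, a < x < b -> g1 x <= g2 x) -> f1 b - f1 a <= f2 b - f2 a.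
Proof.
move=> ab H1 H2 gg.
have [i1 ->] := H1 a b (lexx _) ab (lexx _).
have [i2 ->] := H2 a b (lexx _) ab (lexx _).
have sub : `]a, b[ `<=` `[a, b] by apply: subset_itv; rewrite bnd_simp.
have sub' : `[a, b[ `<=` `[a, b] by apply: subset_itv; rewrite bnd_simp.
have E g : mu.-integrable `[a, b] (EFin \o g) ->
    \int[mu]_(x in `[a, b]) g x = \int[mu]_(x in `]a, b[) g x.
  move=> ig.
  rewrite -Rintegral_itv_bndo_bndc; last exact: integrableS ig.
  by rewrite -Rintegral_itv_obnd_cbnd//; exact: integrableS ig.
rewrite !E//; apply: le_Rintegral => //.
- exact: integrableS i1.
- exact: integrableS i2.
Qed.

Lemma prim_on_abs_le a b f1 g1 f2 g2 : a <= b ->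
  prim_on a b f1 g1 -> prim_on a b f2 g2 ->
  (forall x, a < x < b -> `|g1 x| <= g2 x) -> `|f1 b - f1 a| <= f2 b - f2 a.
Proof.
move=> ab H1 H2 gg; rewrite ler_norml; apply/andP; split.
  have := prim_on_le ab (prim_onZ (-1) H2) H1.
  rewrite !mulN1r => H; apply: le_trans (H _); first by lra.
  by move=> x /gg; rewrite ler_norml mulN1r => /andP[].
by apply: prim_on_le H1 H2 _ => // x /gg; rewrite ler_norml => /andP[].
Qed.

Lemma prim_on_lip a b f g C : a <= b -> prim_on a b f g ->
  (forall x, a < x < b -> `|g x| <= C) -> `|f b - f a| <= C * (b - a).
Proof.
by move=> ab H /(prim_on_abs_le ab H (@prim_on_cst a b C)); rewrite mulrBr.
Qed.

Lemma prim_on_ge a b f g C : a <= b -> prim_on a b f g ->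
  (forall x, a < x < b -> C <= g x) -> C * (b - a) <= f b - f a.
Proof.
by move=> ab H /(prim_on_le ab (@prim_on_cst a b C) H); rewrite mulrBr.
Qed.

Lemma prim_on_continuous a b f g : a <= b -> prim_on a b f g ->
  {within `[a, b], continuous f}.
Proof.
move=> ab H; have [ig _] := H a b (lexx _) ab (lexx _).
have cg := parameterized_integral_continuous ab ig.
apply: (@subspace_eq_continuous _ _ _ (fun x => f a + parameterized_integral mu a x g)).
  move=> x; rewrite inE/= in_itv/= => /andP[ax xb].
  have [_ e] := H a x (lexx _) ax xb.
  by rewrite /from_subspace/parameterized_integral -e; ring.
by move=> x; apply: cvgD; [exact: cvg_cst|exact: cg].
Qed.

(** Cutting the interval into [n.+1] equal pieces leaves a total increment of order [1 / n.+1]. This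
    replaces a product rule for primitives that are merely Lipschitz. *)
Lemma quadratic_increments_const a b f C : a <= b ->
  (forall s t, a <= s -> s <= t -> t <= b -> `|f t - f s| <= C * (t - s) ^+ 2) ->
  f b = f a.
Proof.
move=> ab H.
have C0 : 0 <= C * (b - a) ^+ 2 by exact: le_trans (H a b _ _ _).
have key n : `|f b - f a| <= (C * (b - a) ^+ 2) / n.+1%:R.
  pose d := (b - a) / n.+1%:R.
  have n0 : 0 < n.+1%:R :> R by rewrite ltr0n.
  have d0 : 0 <= d by rewrite divr_ge0 ?subr_ge0// ltW.
  have step k : (k <= n.+1)%N -> `|f (a + k%:R * d) - f a| <= k%:R * (C * d ^+ 2).
    elim: k => [|k IH] kn; first by rewrite !mul0r addr0 subrr normr0.
    have kd : (a + k.+1%:R * d) - (a + k%:R * d) = d by rewrite -natr1; ring.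
    have -> : f (a + k.+1%:R * d) - f a = (f (a + k.+1%:R * d) - f (a + k%:R * d))
        + (f (a + k%:R * d) - f a) by ring.
    have -> : k.+1%:R * (C * d ^+ 2) = C * d ^+ 2 + k%:R * (C * d ^+ 2) by rewrite -natr1; ring.
    apply: le_trans (ler_normD _ _) (lerD _ (IH (ltnW kn))).
    rewrite -[X in _ <= C * X ^+ 2]kd; apply: H.
    - by rewrite lerDl mulr_ge0.
    - by rewrite lerD2l ler_wpM2r// ler_nat.
    - have -> : b = a + n.+1%:R * d by rewrite /d mulrC divfK ?gt_eqF//; ring.
      by rewrite lerD2l ler_wpM2r// ler_nat.
  have := step n.+1 (leqnn _).
  have -> : a + n.+1%:R * d = b by rewrite /d mulrC divfK ?gt_eqF//; ring.
  by move/le_trans; apply; rewrite le_eqVlt; apply/orP; left; apply/eqP;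
    rewrite /d; field; rewrite gt_eqF.
apply/eqP; rewrite -subr_eq0 -normr_le0; apply/ler_addgt0Pr => e e0; rewrite add0r.
have [n hn] := ltr_add_invr (y := 0) (x := e / (1 + C * (b - a) ^+ 2)) (divr_gt0 e0 (ltr_wpDr C0 ltr01)).
apply: le_trans (key n) _.
rewrite add0r in hn; have n0 : 0 < n.+1%:R^-1 :> R by rewrite invr_gt0 ltr0n.
move: hn; rewrite ltr_pdivlMr ?ltr_wpDr// => hn.
by apply: ltW; apply: le_lt_trans hn; rewrite mulrDr mulr1 mulrC lerDr ltW.
Qed.

End Primitives.

(** * Elementary inequalities for absolute values *)

Section RealInequalities.
Variable R : realFieldType.
Implicit Types x y a b c : R.

Lemma normrM_le x y a b : `|x| <= a -> `|y| <= b -> `|x * y| <= a * b.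
Proof. by move=> xa yb; rewrite normrM; apply: ler_pM. Qed.

Lemma normrD_le x y a b : `|x| <= a -> `|y| <= b -> `|x + y| <= a + b.
Proof. by move=> xa yb; apply: le_trans (ler_normD _ _) (lerD xa yb). Qed.

Lemma normrB_le x y a b : `|x| <= a -> `|y| <= b -> `|x - y| <= a + b.
Proof. by move=> xa yb; apply: le_trans (ler_normB _ _) (lerD xa yb). Qed.

Lemma normr_mulB x y x' y' a b dx dy :
  `|x| <= a -> `|y'| <= b -> `|x - x'| <= dx -> `|y - y'| <= dy ->
  `|x * y - x' * y'| <= a * dy + dx * b.
Proof.
move=> xa yb dxx dyy.
have -> : x * y - x' * y' = x * (y - y') + (x - x') * y' by ring.
by apply: normrD_le; apply: normrM_le.
Qed.

Lemma le_sum6 (x1 x2 x3 x4 x5 x6 : R) : 0 <= x1 -> 0 <= x2 -> 0 <= x3 -> 0 <= x4 ->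
  0 <= x5 -> 0 <= x6 -> let s := ((x1 + x2) + (x3 + x4)) + (x5 + x6) in
  [/\ x1 <= s, x2 <= s, x3 <= s & [/\ x4 <= s, x5 <= s & x6 <= s]].
Proof. by move=> ? ? ? ? ? ? s; rewrite /s; split; [lra|lra|lra|split; lra]. Qed.

End RealInequalities.

(** * One label: rates, conservation law and the regime before a stop *)

Section Trajectories.
Variable R : realType.
Implicit Types (T a k B m s t x : R) (q w h r P : R -> R).

Definition until a (s : R) : R := if s < a then 1 else 0.

Lemma until_abs_le1 a s x b : 0 <= b -> `|x| <= b -> `|until a s * x| <= b.
Proof. by move=> b0 xb; rewrite /until; case: ifP; rewrite ?mul1r// mul0r normr0. Qed.

(** [P] is an arbitrary given coefficient, which decouples the labels. The time [a] may exceed [T]: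
    the stop is then not seen on [0, T], hence the condition in [traj_stop]. *)
Record trajectory T a k q w h r P : Prop := Trajectory {
  traj_ge0 : 0 <= a;
  traj_q : prim_on 0 T q (fun s => until a s * w s);
  traj_w : prim_on 0 T w (fun s => until a s * (h s / 2 - P s * q s + k * r s));
  traj_h : prim_on 0 T h (fun s => until a s * (2 * (- P s) * w s));
  traj_r : prim_on 0 T r (fun s => - (until a s * k * w s));
  traj_pos : forall s, 0 <= s <= T -> s < a -> 0 < q s;
  traj_stop : a <= T -> q a = 0 }.

(** [tame_sum] and [tame_cons] concern time 0 only; their propagation in time is proved below. *)
Record tame T B m k q w h r P : Prop := Tame {
  tame_B : 1 <= B;
  tame_T : 0 <= T;
  tame_k : `|k| <= B;
  tame_q : forall s, 0 <= s <= T -> `|q s| <= B;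
  tame_w : forall s, 0 <= s <= T -> `|w s| <= B;
  tame_h : forall s, 0 <= s <= T -> `|h s| <= B;
  tame_r : forall s, 0 <= s <= T -> `|r s| <= B;
  tame_P : forall s, 0 <= s <= T -> `|P s| <= B;
  tame_sum : m <= q 0 + h 0;
  tame_cons : q 0 * h 0 = w 0 ^+ 2 + r 0 ^+ 2 }.

Section OneTrajectory.
Variables (T a k B m : R) (q w h r P : R -> R).
Hypotheses (tr : trajectory T a k q w h r P) (bd : tame T B m k q w h r P).

Let B1 : 1 <= B := tame_B bd.
Let B0 : 0 <= B := le_trans ler01 B1.
Let BB : B <= B ^+ 2.
Proof. by rewrite expr2 ler_peMl. Qed.

Lemma traj_w_rate s : 0 <= s <= T -> `|h s / 2 - P s * q s + k * r s| <= 3 * B ^+ 2.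
Proof.
move=> sT.
have H1 := tame_h bd sT.
have H2 := normrM_le (tame_P bd sT) (tame_q bd sT).
have H3 := normrM_le (tame_k bd) (tame_r bd sT).
have H4 : `|h s / 2| <= B by rewrite normrM (ger0_norm (x := 2^-1)) ?invr_ge0//; have := normr_ge0 (h s); lra.
have := normrD_le (normrB_le H4 H2) H3; have := BB; rewrite expr2; lra.
Qed.

Lemma traj_h_rate s : 0 <= s <= T -> `|2 * (- P s) * w s| <= 2 * B ^+ 2.
Proof.
move=> sT; rewrite -mulrA mulNr mulrN normrN normrM ger0_norm// ler_wpM2l// expr2.
exact: normrM_le (tame_P bd sT) (tame_w bd sT).
Qed.

Let B20 : 0 <= B ^+ 2.
Proof. exact: exprn_ge0. Qed.

Lemma traj_lip s t : 0 <= s -> s <= t -> t <= T ->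
  [/\ `|q t - q s| <= B * (t - s), `|w t - w s| <= 3 * B ^+ 2 * (t - s),
      `|h t - h s| <= 2 * B ^+ 2 * (t - s) & `|r t - r s| <= B ^+ 2 * (t - s)].
Proof.
move=> s0 st tT.
have I x : s < x < t -> 0 <= x <= T.
  by move=> /andP[sx xt]; rewrite (le_trans s0 (ltW sx)) (le_trans (ltW xt) tT).
split.
- apply: prim_on_lip (prim_on_sub s0 tT (traj_q tr)) _ => // x /I xT.
  by apply: until_abs_le1 => //; exact: (tame_w bd xT).
- apply: prim_on_lip (prim_on_sub s0 tT (traj_w tr)) _ => // x /I xT.
  by apply: until_abs_le1; [rewrite mulr_ge0|exact: traj_w_rate].
- apply: prim_on_lip (prim_on_sub s0 tT (traj_h tr)) _ => // x /I xT.
  by apply: until_abs_le1; [rewrite mulr_ge0|exact: traj_h_rate].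
- apply: prim_on_lip (prim_on_sub s0 tT (traj_r tr)) _ => // x /I xT.
  rewrite normrN -mulrA; apply: until_abs_le1 => //; rewrite expr2.
  by apply: normrM_le; [exact: (tame_k bd)|exact: (tame_w bd xT)].
Qed.

Lemma traj_frozen s t : a <= s -> s <= t -> t <= T ->
  [/\ q t = q s, w t = w s, h t = h s & r t = r s].
Proof.
move=> as_ st tT; have s0 : 0 <= s by apply: le_trans as_; exact: traj_ge0 tr.
have E f g : prim_on 0 T f g -> (forall x, s < x < t -> g x = 0) -> f t = f s.
  move=> H g0; apply/eqP; rewrite -subr_eq0 -normr_le0 -[leRHS](mul0r (t - s)).
  by apply: prim_on_lip (prim_on_sub s0 tT H) _ => // x /g0 ->; rewrite normr0.
have U x : s < x < t -> until a x = 0.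
  by move=> /andP[sx _]; rewrite /until ltNge (le_trans as_ (ltW sx)).
split.
- by apply: E (traj_q tr) _ => x /U ->; rewrite mul0r.
- by apply: E (traj_w tr) _ => x /U ->; rewrite mul0r.
- by apply: E (traj_h tr) _ => x /U ->; rewrite mul0r.
- by apply: E (traj_r tr) _ => x /U ->; rewrite !mul0r oppr0.
Qed.

(** The two summands have opposite rates. Whether this quantity vanishes is therefore decided by the
    data, which is why [kappa] does not change along the flow. *)
Lemma traj_rk_const t : 0 <= t <= T -> r t + k * q t = r 0 + k * q 0.
Proof.
move=> /andP[t0 tT].
have H := prim_onD (traj_r tr) (prim_onZ k (traj_q tr)).
have := prim_on_lip t0 (prim_on_sub (lexx 0) tT H).
move=> /(_ 0) E; apply/eqP; rewrite -subr_eq0 -normr_le0 -[leRHS](mul0r (t - 0)).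
by apply: E => x _; rewrite (_ : _ + _ = 0) ?normr0//; ring.
Qed.

Lemma traj_q_ge0 t : 0 <= t <= T -> 0 <= q t.
Proof.
move=> /andP[t0 tT]; have [ta|at_] := ltP t a.
  by apply/ltW/(traj_pos tr) => //; rewrite t0.
have [-> _ _ _] := traj_frozen (lexx a) at_ tT.
by rewrite (traj_stop tr (le_trans at_ tT)).
Qed.

(* The first-order terms of an increment of [q h - w^2 - r^2] cancel along the
   flow, so its increments are quadratic in time. *)
Lemma traj_conservation t : 0 <= t <= T -> q t * h t = w t ^+ 2 + r t ^+ 2.
Proof.
pose f s := q s * h s - w s ^+ 2 - r s ^+ 2.
suff H u : 0 <= u -> u <= a -> u <= T -> f u = 0.
  move=> /andP[t0 tT]; have [ta|at_] := leP t a.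
    by have := H t t0 ta tT; rewrite /f => /eqP; rewrite -addrA -opprD subr_eq0 => /eqP.
  have [-> -> -> ->] := traj_frozen (lexx a) (ltW at_) tT.
  have := H a (traj_ge0 tr) (lexx _) (le_trans (ltW at_) tT).
  by rewrite /f => /eqP; rewrite -addrA -opprD subr_eq0 => /eqP.
move=> u0 ua uT.
have f0 : f 0 = 0 by rewrite /f (tame_cons bd); ring.
rewrite -[RHS]f0; apply: (@quadratic_increments_const _ _ _ _ (33 * B ^+ 4)) => // s {}t s0 st tu.
have tT := le_trans tu uT; have d0 : 0 <= t - s by rewrite subr_ge0.
pose d := t - s.
have I x : s < x < t -> 0 <= x <= T.
  by move=> /andP[sx xt]; rewrite (le_trans s0 (ltW sx)) (le_trans (ltW xt) tT).
have sT : 0 <= s <= T by rewrite s0 (le_trans st tT).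
(* [G] is the differential of the quadratic form at time [s]. The rest of the increment of [f]
   consists of products of two increments, already quadratic in [t - s]. *)
pose G x := (h s * q x + q s * h x) + (- (2 * w s) * w x + - (2 * r s) * r x).
have GP := prim_onD (prim_on_comb (h s) (q s) (traj_q tr) (traj_h tr))
   (prim_on_comb (- (2 * w s)) (- (2 * r s)) (traj_w tr) (traj_r tr)).
have [Lq Lw Lh Lr] := traj_lip s0 st tT.
have GL : `|G t - G s| <= 21 * B ^+ 4 * d * d.
  apply: prim_on_lip (prim_on_sub s0 tT GP) _ => // x sxt.
  have xT := I x sxt; case/andP: (sxt) => sx xt.
  have -> : until a x = 1 by rewrite /until (lt_le_trans xt (le_trans tu ua)).
  have [lq lw lh lr] := traj_lip s0 (ltW sx) (proj2 (andP xT)).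
  have dx : x - s <= d by rewrite lerD2r ltW.
  have dx0 : 0 <= x - s by rewrite subr_ge0 ltW.
  have {}lq : `|q s - q x| <= B * d by rewrite distrC (le_trans lq) ?ler_wpM2l.
  have {}lh : `|h s - h x| <= 2 * B ^+ 2 * d.
    by rewrite distrC (le_trans lh) ?ler_wpM2l// mulr_ge0.
  have {}lr : `|r s - r x| <= B ^+ 2 * d by rewrite distrC (le_trans lr) ?ler_wpM2l.
  have {}lw : `|w x - w s| <= 3 * B ^+ 2 * d.
    by rewrite (le_trans lw) ?ler_wpM2l// mulr_ge0.
  set e := (X in `|X|).
  have -> : e = ((h s - h x) * w x + h x * (w x - w s))
     - (2 * P x) * ((q s - q x) * w x + q x * (w x - w s))
     + (2 * k) * ((r s - r x) * w x + r x * (w x - w s)) by rewrite /e; field.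
  have P2 : `|2 * P x| <= 2 * B by apply: normrM_le; [rewrite ger0_norm|exact: (tame_P bd xT)].
  have k2 : `|2 * k| <= 2 * B by apply: normrM_le; [rewrite ger0_norm|exact: (tame_k bd)].
  have wx := tame_w bd xT; have hx := tame_h bd xT; have qx := tame_q bd xT; have rx := tame_r bd xT.
  apply: le_trans (normrD_le (normrB_le (normrD_le (normrM_le lh wx) (normrM_le hx lw))
    (normrM_le P2 (normrD_le (normrM_le lq wx) (normrM_le qx lw))))
    (normrM_le k2 (normrD_le (normrM_le lr wx) (normrM_le rx lw)))) _.
  have d0' : 0 <= d by [].
  have E3 : 0 <= B ^+ 3 * d by rewrite mulr_ge0// exprn_ge0.
  have E4 : B ^+ 3 * d <= B ^+ 4 * d by rewrite ler_wpM2r// (exprS _ 3) ler_peMl ?exprn_ge0.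
  rewrite [leLHS](_ : _ = 7 * (B ^+ 3 * d) + 14 * (B ^+ 4 * d)); last by ring.
  rewrite -mulrA; lra.
have -> : f t - f s = (G t - G s) + (q t - q s) * (h t - h s)
    - (w t - w s) * (w t - w s) - (r t - r s) * (r t - r s) by rewrite /f /G; ring.
apply: le_trans (normrB_le (normrB_le (normrD_le GL (normrM_le Lq Lh)) (normrM_le Lw Lw)) (normrM_le Lr Lr)) _.
have d2 : 0 <= d ^+ 2 by exact: sqr_ge0.
have E3 : B ^+ 3 * d ^+ 2 <= B ^+ 4 * d ^+ 2 by rewrite ler_wpM2r// (exprS _ 3) ler_peMl ?exprn_ge0.
rewrite -/d [leLHS](_ : _ = 2 * (B ^+ 3 * d ^+ 2) + 31 * (B ^+ 4 * d ^+ 2)); last by ring.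
rewrite -mulrA; lra.
Qed.

Lemma traj_sum_lb t : 0 <= t <= T -> m - 3 * B ^+ 2 * T <= q t + h t.
Proof.
move=> /andP[t0 tT]; have [Lq _ Lh _] := traj_lip (lexx 0) t0 tT.
move: Lq Lh; rewrite subr0 !ler_norml => /andP[Lq _] /andP[Lh _].
have m0 := tame_sum bd.
have T0 : B * t <= B ^+ 2 * t by rewrite ler_wpM2r.
have T1 : B ^+ 2 * t <= B ^+ 2 * T by rewrite ler_wpM2l.
by move: Lh; rewrite -!mulrA => Lh; lra.
Qed.

(** The law [q h = w ^ 2 + r ^ 2] makes both squares vanish with [q]. Hence only a label whose
    [r + k q] is zero from the start can stop. *)
Lemma traj_rk0_of_q0 t : 0 <= t <= T -> q t = 0 -> w t = 0 /\ r 0 + k * q 0 = 0.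
Proof.
move=> tT q0; have := traj_conservation tT; rewrite q0 mul0r => /esym E.
have w0 : w t ^+ 2 = 0 by have := sqr_ge0 (w t); have := sqr_ge0 (r t); lra.
have r0 : r t ^+ 2 = 0 by have := sqr_ge0 (w t); have := sqr_ge0 (r t); lra.
move: w0 r0 => /eqP; rewrite sqrf_eq0 => /eqP w0 /eqP; rewrite sqrf_eq0 => /eqP r0.
by split => //; rewrite -(traj_rk_const tT) r0 q0 mulr0 addr0.
Qed.

Variable eta : R.
Hypotheses (eta0 : 0 < eta) (etam : 100 * B ^+ 2 * eta <= m) (Teta : 3 * B ^+ 2 * T <= eta).

Let T0 : 0 <= T := tame_T bd.
Let Beta : eta <= B ^+ 2 * eta.
Proof. by rewrite ler_peMl// ?(le_trans _ BB)// ltW. Qed.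

Lemma traj_small_lip s t : 0 <= s <= T -> 0 <= t <= T ->
  `|q t - q s| <= eta /\ `|w t - w s| <= eta.
Proof.
wlog st : s t / s <= t => [H sT tT|/andP[s0 sT] /andP[t0 tT]].
  have [st|/ltW ts] := leP s t; first exact: H.
  by rewrite distrC (distrC (w t)); exact: H.
have [Lq Lw _ _] := traj_lip s0 st tT.
have H1 : B ^+ 2 * (t - s) <= B ^+ 2 * T by rewrite ler_wpM2l//; lra.
have H2 : B * (t - s) <= B ^+ 2 * (t - s) by rewrite ler_wpM2r// subr_ge0.
have H3 : 0 <= B ^+ 2 * T by rewrite mulr_ge0.
move: Teta => HT; split; first by lra.
by apply: le_trans Lw _; rewrite -mulrA; lra.
Qed.

(** The label may be about to stop. The scale [eta] is small against [m / B ^ 2], so that a small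
    [q] leaves [h >= m / 2], and [T] is so short that [q] and [w] move by at most [eta]: a bound
    [2 * eta] at one time gives [3 * eta] at all times. *)
Definition small_regime : Prop :=
  r 0 + k * q 0 = 0 /\ forall s, 0 <= s <= T -> q s <= 3 * eta /\ `|w s| <= 3 * eta.

Lemma small_regimeI t : 0 <= t <= T -> r 0 + k * q 0 = 0 ->
  q t <= 2 * eta -> `|w t| <= 2 * eta -> small_regime.
Proof.
move=> tT r0 qt wt; split => // s sT.
have [] := traj_small_lip tT sT; rewrite ler_norml => /andP[_ Lq] Lw.
move: Teta => HT; move: eta0 => e0; split; first by lra.
have -> : w s = w t + (w s - w t) by ring.
by apply: le_trans (normrD_le wt Lw) _; lra.
Qed.

(** With [r = - k q], the condition [g1 <= g2] yields [2 k ^ 2 q <= h], so [r ^ 2] is at most half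
    of [q h] in [q h = w ^ 2 + r ^ 2]. Thus [q h <= 2 eta ^ 2] while [h >= m / 4], and [q] is of
    order [eta ^ 2 / m], far below [eta]. *)
Lemma small_regime_of_g t : 0 <= t <= T -> `|w t| <= eta -> r t + k * q t = 0 ->
  g1 0 0 0 (q t) (w t) (h t) (r t) k <= g2 0 0 0 (q t) (w t) (h t) (r t) k ->
  small_regime.
Proof.
move=> tT we rk g12.
apply: (small_regimeI tT); first by rewrite -(traj_rk_const tT).
  have q0 := traj_q_ge0 tT; have S := traj_sum_lb tT.
  have rE : r t = - (k * q t) by apply/eqP; rewrite -addr_eq0 rk.
  have C := traj_conservation tT.
  have rkE : `|r t * k| = k * k * q t.
    rewrite rE mulNr normrN (_ : k * q t * k = k * k * q t); last by ring.
    by rewrite ger0_norm// mulr_ge0// -expr2 sqr_ge0.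
  move: g12; rewrite /g1 /g2 rkE => g12; have w0 := normr_ge0 (w t).
  have X1 : q t * (k * k * q t) <= q t * (h t / 2) by rewrite ler_wpM2l//; lra.
  have X2 : w t ^+ 2 <= eta * eta by rewrite -real_normK ?num_real// expr2 ler_pM.
  have kk0 : 0 <= k * k * q t by rewrite mulr_ge0// -expr2 sqr_ge0.
  have X3 : q t * (m / 4) <= q t * h t.
    by rewrite ler_wpM2l//; move: Beta etam Teta eta0 => Y1 Y2 Y3 Y4; lra.
  have X4 : eta * eta <= eta * (m / 100).
    by rewrite ler_wpM2l ?(ltW eta0)//; move: Beta etam => Y1 Y2; lra.
  have m0 : 0 < m by move: Beta etam eta0 => Y1 Y2 Y3; lra.
  rewrite -(ler_pM2r m0).
  have e0 : 0 <= eta * m by rewrite ltW// mulr_gt0.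
  have C2 : r t ^+ 2 = q t * (k * k * q t) by rewrite rE; ring.
  by rewrite C2 in C; lra.
by apply: le_trans we _; move: eta0 => Y; lra.
Qed.

Hypothesis sr : small_regime.

Lemma small_h s : 0 <= s <= T -> m / 2 <= h s.
Proof.
move=> sT; have := traj_sum_lb sT; have [q3 _] := sr.2 s sT.
by move: Beta etam Teta eta0 => X1 X2 X3 X4; lra.
Qed.

(** The term [h / 2 >= m / 4] dominates: [P q] and [k r = - k ^ 2 q] are each at most [3 B ^ 2 eta],
    that is [3 m / 100]. *)
Lemma small_w_rate s : 0 <= s <= T -> m / 8 <= h s / 2 - P s * q s + k * r s.
Proof.
move=> sT; have hs := small_h sT; have [qs _] := sr.2 s sT.
have qs0 := traj_q_ge0 sT.
have -> : r s = - (k * q s).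
  by apply/eqP; rewrite -addr_eq0; apply/eqP; rewrite (traj_rk_const sT) sr.1.
have nq : `|q s| <= 3 * eta by rewrite ger0_norm.
have := normrM_le (tame_P bd sT) nq.
have := normrM_le (normrM_le (tame_k bd) (tame_k bd)) nq.
rewrite !ler_norml => /andP[_ K] /andP[_ K'].
have : B * (3 * eta) <= B ^+ 2 * (3 * eta) by rewrite ler_wpM2r// mulr_ge0// ltW.
by move: K Beta etam Teta eta0 => K X1 X2 X3 X4; lra.
Qed.

Lemma small_w_increase s t : 0 <= s -> s <= t -> t <= T -> t <= a ->
  m / 8 * (t - s) <= w t - w s.
Proof.
move=> s0 st tT ta; apply: prim_on_ge (prim_on_sub s0 tT (traj_w tr)) _ => // x /andP[sx xt].
rewrite /until (lt_le_trans xt ta) mul1r; apply: small_w_rate.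
by rewrite (le_trans s0 (ltW sx)) (le_trans (ltW xt) tT).
Qed.

Let m0 : 0 < m.
Proof. by apply: lt_le_trans etam; rewrite mulr_gt0// mulr_gt0// exprn_gt0// (lt_le_trans ltr01). Qed.

(** With [w = 0] and [r = - k q] the conservation law factors as [q (h - k ^ 2 q) = 0], and the
    second factor is positive since [h >= m / 2]. *)
Lemma small_w0_q0 s : 0 <= s <= T -> w s = 0 -> q s = 0.
Proof.
move=> sT w0; have := traj_conservation sT; rewrite w0.
have -> : r s = - (k * q s).
  by apply/eqP; rewrite -addr_eq0; apply/eqP; rewrite (traj_rk_const sT) sr.1.
move=> E; have {E} : q s * (h s - k * k * q s) = 0 by rewrite mulrBr E; ring.
move/eqP; rewrite mulf_eq0 => /orP[/eqP //|/eqP E].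
have hs := small_h sT; have [qs _] := sr.2 s sT; have qs0 := traj_q_ge0 sT.
have nq : `|q s| <= 3 * eta by rewrite ger0_norm.
have := normrM_le (normrM_le (tame_k bd) (tame_k bd)) nq.
rewrite -expr2 ler_norml => /andP[_ K]; by move: Beta etam Teta eta0 => X1 X2 X3 X4; lra.
Qed.

(** [w] increases up to the stop, whereas stopping requires [w = 0]. *)
Lemma small_w_pos : 0 < w 0 -> T < a /\ forall t, 0 <= t <= T -> 0 < w t.
Proof.
move=> w0.
have H t : 0 <= t -> t <= T -> t <= a -> 0 < w t.
  move=> t0 tT ta; have := small_w_increase (lexx 0) t0 tT ta.
  have : 0 <= m / 8 * (t - 0) by rewrite subr0 mulr_ge0// divr_ge0// ltW.
  by lra.
have Ta : T < a.
  rewrite ltNge; apply/negP => aT.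
  have aI : 0 <= a <= T by rewrite aT (traj_ge0 tr).
  have := H a (traj_ge0 tr) aT (lexx _).
  by have [-> _] := traj_rk0_of_q0 aI (traj_stop tr aT); rewrite ltxx.
split => // t /andP[t0 tT]; apply: H => //; exact: le_trans tT (ltW Ta).
Qed.

(** A change of sign would pass through [w = 0], hence [q = 0], strictly before the time [a], where
    [q] is still positive. *)
Lemma small_w_neg : w 0 <= 0 -> forall t, 0 <= t <= T -> w t <= 0.
Proof.
move=> w0.
have H t : 0 <= t -> t <= T -> t <= a -> w t <= 0.
  move=> t0 tT ta; rewrite leNgt; apply/negP => wt.
  have cw := prim_on_continuous t0 (prim_on_sub (lexx 0) tT (traj_w tr)).
  have [] := IVT t0 cw (v := 0).
    by rewrite ge_min w0/= le_max (ltW wt) orbT.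
  move=> s; rewrite in_itv/= => /andP[s0 st] ws.
  have sT : 0 <= s <= T by rewrite s0 (le_trans st tT).
  have := small_w0_q0 sT ws.
  have sa : s < a.
    apply: lt_le_trans ta; rewrite lt_neqAle st andbT; apply/eqP => E.
    by rewrite -E ws ltxx in wt.
  by have := traj_pos tr sT sa => /[swap] ->; rewrite ltxx.
move=> t /andP[t0 tT]; have [ta|at_] := leP t a; first exact: H.
have [_ -> _ _] := traj_frozen (lexx a) (ltW at_) tT.
by apply: H; [exact: traj_ge0 tr|exact: le_trans (ltW at_) tT|].
Qed.

(** Together with [small_g0_pos] this shows that [g] jumps by at least [3 m / 4] across [w = 0], so
    that closeness of [g] detects the sign of [w], on which stopping depends. *)
Lemma small_g0_neg y U c : w 0 <= 0 -> g8 y U c (q 0) (w 0) (h 0) (r 0) k <= m / 4.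
Proof.
move=> w0; have I0 : 0 <= 0 :> R /\ 0 <= T by split.
move/andP : I0 => I0.
have hs := small_h I0; have [qs ws] := sr.2 0 I0; have qs0 := traj_q_ge0 I0.
have nq : `|q 0| <= 3 * eta by rewrite ger0_norm.
have r0 : r 0 = - (k * q 0) by apply/eqP; rewrite -addr_eq0 sr.1.
have K := normrM_le (normrM_le (tame_k bd) nq) (tame_k bd).
have K' : `|r 0 * k| <= 3 * (B ^+ 2 * eta).
  rewrite r0 mulNr normrN; apply: le_trans K _.
  by rewrite le_eqVlt; apply/orP; left; apply/eqP; ring.
have g1le : g1 y U c (q 0) (w 0) (h 0) (r 0) k <= m / 4.
  rewrite /g1; by move: Beta etam Teta eta0 => X1 X2 X3 X4; lra.
have g12 : g1 y U c (q 0) (w 0) (h 0) (r 0) k <= g2 y U c (q 0) (w 0) (h 0) (r 0) k.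
  by apply: le_trans g1le _; rewrite /g2; move: m0 => X; lra.
by rewrite /g8 /inOmega1 g12 w0 sr.1 eqxx.
Qed.

Lemma small_g0_pos y U c : 0 < w 0 -> m <= g8 y U c (q 0) (w 0) (h 0) (r 0) k.
Proof.
move=> w0; rewrite /g8 /inOmega1 (leNgt (w 0)) w0 /= andbF /g2; exact: tame_sum bd.
Qed.

End OneTrajectory.
End Trajectories.

(** * Two trajectories with the same label *)

Section TrajectoryPairs.
Variable R : realType.
Implicit Types s t x qb : R.

(** The phases are: both labels moving, one moving, both frozen. In the middle one the rates are not
    close but only bounded, at the cost [e * (be - al)]. The bound up to [al] is free of that cost
    and is the one that can estimate the gap itself. *)
Lemma prim_on_three_phases (T al be c b e : R) (f g Pi p : R -> R) :
  0 <= al -> al <= be -> be <= T -> 0 <= c -> 0 <= b -> 0 <= e ->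
  prim_on 0 T f g -> prim_on 0 T Pi p -> (forall s, 0 <= s <= T -> 0 <= p s) ->
  (forall s, 0 < s < al -> `|g s| <= c + b * p s) ->
  (forall s, al < s < be -> `|g s| <= e) ->
  (forall s, be < s < T -> g s = 0) ->
  (forall t, 0 <= t -> t <= al -> `|f t - f 0| <= c * T + b * (Pi T - Pi 0)) /\
  forall t, 0 <= t <= T ->
    `|f t - f 0| <= c * T + b * (Pi T - Pi 0) + e * (be - al).
Proof.
move=> al0 albe beT c0 b0 e0 F PP p0 g1 g2 g3.
have alT := le_trans albe beT; have be0 := le_trans al0 albe.
have mono s t : 0 <= s -> s <= t -> t <= T -> Pi s <= Pi t.
  move=> s0 st tT; rewrite -subr_ge0 -[leLHS](mul0r (t - s)).
  apply: prim_on_ge (prim_on_sub s0 tT PP) _ => // x /andP[sx xt].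
  by apply: p0; rewrite (le_trans s0 (ltW sx)) (le_trans (ltW xt) tT).
have A1 t : 0 <= t -> t <= al -> `|f t - f 0| <= c * T + b * (Pi T - Pi 0).
  move=> t0 ta; have tT := le_trans ta alT.
  have := prim_on_abs_le t0 (prim_on_sub (lexx 0) tT F)
    (prim_onD (@prim_on_cst _ 0 t c) (prim_onZ b (prim_on_sub (lexx 0) tT PP))).
  move=> /(_ _)/le_trans; apply.
    by move=> x /andP[x0 xt]; apply: g1; rewrite x0 (lt_le_trans xt).
  have H1 : c * t <= c * T by rewrite ler_wpM2l.
  have H2 : b * Pi t <= b * Pi T by rewrite ler_wpM2l// mono.
  lra.
split=> // t /andP[t0 tT].
have A2 u : al <= u -> u <= be -> `|f u - f al| <= e * (u - al).
  move=> au ub; apply: prim_on_lip (prim_on_sub al0 (le_trans ub beT) F) _ => // x /andP[ax xu].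
  by apply: g2; rewrite ax (lt_le_trans xu).
have A3 u : be <= u -> u <= T -> f u = f be.
  move=> bu uT; apply/eqP; rewrite -subr_eq0 -normr_le0 -[leRHS](mul0r (u - be)).
  apply: prim_on_lip (prim_on_sub be0 uT F) _ => // x /andP[bx xu].
  by rewrite g3 ?normr0// bx (lt_le_trans xu).
have eb : 0 <= e * (be - al) by rewrite mulr_ge0// subr_ge0.
have [ta|/ltW at_] := leP t al.
  by apply: le_trans (A1 t t0 ta) _; rewrite lerDl.
have Aal := A1 al al0 (lexx al).
have [tb|/ltW bt] := leP t be.
  have -> : f t - f 0 = (f al - f 0) + (f t - f al) by ring.
  apply: normrD_le => //; apply: le_trans (A2 t at_ tb) _.
  by rewrite ler_wpM2l// lerD2r.
have -> : f t - f 0 = (f al - f 0) + (f be - f al) by rewrite (A3 t)//; ring.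
by apply: normrD_le => //; exact: A2.
Qed.

Variables (T B m eta : R).
Hypotheses (T1 : T <= 1) (eta0 : 0 < eta) (eta1 : eta <= 1)
  (etam : 100 * B ^+ 2 * eta <= m) (Teta : 3 * B ^+ 2 * T <= eta).

Section Pair.
Variables (a k : R) (q w h r P : R -> R).
Variables (a' k' : R) (q' w' h' r' P' : R -> R).
Hypotheses (tr : trajectory T a k q w h r P) (bd : tame T B m k q w h r P).
Hypotheses (tr' : trajectory T a' k' q' w' h' r' P') (bd' : tame T B m k' q' w' h' r' P').

Variables (del Phi N dk : R) (p Pi : R -> R).
Hypotheses (PP : prim_on 0 T Pi p) (pge : forall s, 0 <= s <= T -> 0 <= p s)
  (dP : forall s, 0 <= s < T -> `|P s - P' s| <= p s)
  (dq : forall s, 0 <= s <= T -> `|q s - q' s| <= Phi)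
  (dw : forall s, 0 <= s <= T -> `|w s - w' s| <= Phi)
  (dh : forall s, 0 <= s <= T -> `|h s - h' s| <= Phi)
  (dr : forall s, 0 <= s <= T -> `|r s - r' s| <= Phi)
  (dkk : `|k - k'| <= dk)
  (Nw : forall s, 0 <= s <= T -> `|w' s| <= N)
  (Nr : forall s, 0 <= s <= T -> `|r' s| <= N).
Hypotheses (q0 : `|q 0 - q' 0| <= del) (w0 : `|w 0 - w' 0| <= del)
  (h0 : `|h 0 - h' 0| <= del) (r0 : `|r 0 - r' 0| <= del).

Let B1 : 1 <= B := tame_B bd.
Let B0 : 0 <= B := le_trans ler01 B1.
Let T0 : 0 <= T := tame_T bd.
Let I0 : (0 : R) <= 0 <= T.
Proof. by rewrite lexx T0. Qed.
Let Phi0 : 0 <= Phi := le_trans (normr_ge0 _) (dq I0).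
Let del0 : 0 <= del := le_trans (normr_ge0 _) q0.
Let dk0 : 0 <= dk := le_trans (normr_ge0 _) dkk.
Let N0 : 0 <= N := le_trans (normr_ge0 _) (Nw I0).
Let ltW_in s : 0 <= s < T -> 0 <= s <= T.
Proof. by case/andP=> -> /ltW. Qed.
Let BPhi : Phi <= B * Phi.
Proof. by rewrite ler_peMl. Qed.
Let dkN : 0 <= dk * N.
Proof. exact: mulr_ge0. Qed.

Let al := Order.min a T.
Let be := Order.min a' T.
Let c := 3 * (B * Phi) + dk * N.

Let c0 : 0 <= c.
Proof. by rewrite addr_ge0// !mulr_ge0. Qed.

(** The bound [qb] is kept apart from [B] because the difference of the two [P] is multiplied by
    [q]: before a stop [q] is of order [T], and this factor is gained. *)
Lemma pair_w_rate s qb : 0 <= s < T -> `|q s| <= qb ->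
  `|(h s / 2 - P s * q s + k * r s) - (h' s / 2 - P' s * q' s + k' * r' s)|
   <= c + qb * p s.
Proof.
move=> sT' qs; have sT := ltW_in sT'.
set x := (X in `|X|); have -> : x = (h s - h' s) / 2 - (q s * P s - q' s * P' s)
   + (k * r s - k' * r' s) by rewrite /x; field.
have H1 : `|(h s - h' s) / 2| <= Phi.
  rewrite normrM (ger0_norm (x := 2^-1)) ?invr_ge0//.
  by have := dh sT; have := normr_ge0 (h s - h' s); lra.
have H2 := normr_mulB qs (tame_P bd' sT) (dq sT) (dP sT').
have H3 := normr_mulB (tame_k bd) (Nr sT) dkk (dr sT).
apply: le_trans (normrD_le (normrB_le H1 H2) H3) _; rewrite /c; move: BPhi => X; lra.
Qed.

Hypothesis aa : a <= a'.

Let al0 : 0 <= al. Proof. by rewrite le_min (traj_ge0 tr) T0. Qed.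
Let albe : al <= be.
Proof. by rewrite le_min; apply/andP; split; rewrite ge_min ?aa ?lexx ?orbT. Qed.
Let beT : be <= T. Proof. by rewrite ge_min lexx orbT. Qed.

Let until1 s : s < al -> until a s = 1 /\ until a' s = 1.
Proof.
rewrite lt_min => /andP[sa _]; by rewrite /until sa (lt_le_trans sa aa).
Qed.
Let until2 s : al < s -> s < be -> until a s = 0.
Proof.
rewrite gt_min lt_min /until => /orP[|] H /andP[_ sT]; first by rewrite ltNge ltW.
by have := lt_trans sT H; rewrite ltxx.
Qed.
Let until3 s : be < s -> s < T -> until a s = 0 /\ until a' s = 0.
Proof.
rewrite gt_min /until => /orP[|] H sT; last by have := lt_trans sT H; rewrite ltxx.
by rewrite !ltNge (ltW H) (le_trans aa (ltW H)).
Qed.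

Let dPi : 0 <= Pi T - Pi 0.
Proof.
rewrite -[leLHS](mul0r (T - 0)).
apply: prim_on_ge PP _ => // x /andP[x0 xT]; apply: pge.
by rewrite (ltW x0) (ltW xT).
Qed.

Let BB : B <= B ^+ 2.
Proof. by rewrite expr2 ler_peMl. Qed.
Let inI s : 0 < s -> s < T -> 0 <= s <= T.
Proof. by move=> s0 sT; rewrite !ltW. Qed.
Let alT : al <= T := le_trans albe beT.

Let phase (f f' g g' : R -> R) :
  prim_on 0 T f (fun s => until a s * g s) ->
  prim_on 0 T f' (fun s => until a' s * g' s) ->
  (forall s, 0 <= s < T -> `|g s - g' s| <= c + 2 * B * p s) ->
  (forall s, 0 <= s <= T -> `|g' s| <= 3 * B ^+ 2) ->
  `|f 0 - f' 0| <= del ->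
  forall t, 0 <= t <= T -> `|f t - f' t| <= del + (c * T + 2 * B * (Pi T - Pi 0)
     + 3 * B ^+ 2 * (be - al)).
Proof.
move=> F F' gg g'e f0 t tT.
have -> : f t - f' t = (f 0 - f' 0) + ((f t - f' t) - (f 0 - f' 0)) by ring.
apply: normrD_le => //.
apply: (proj2 (prim_on_three_phases al0 albe beT c0 _ _ (prim_onB F F') PP pge _ _ _)) => //.
- exact: mulr_ge0.
- by rewrite mulr_ge0// exprn_ge0.
- move=> s /andP[s0 sa]; have [-> ->] := until1 sa; rewrite !mul1r; apply: gg.
  by rewrite (ltW s0) (lt_le_trans sa alT).
- move=> s /andP[s0 sa]; rewrite (until2 s0 sa) mul0r add0r normrN.
  apply: until_abs_le1; first by rewrite mulr_ge0// exprn_ge0.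
  by apply: g'e; apply: inI; [exact: le_lt_trans s0|exact: lt_le_trans beT].
- by move=> s /andP[s0 sa]; have [-> ->] := until3 s0 sa; rewrite !mul0r subr0.
Qed.

Lemma pair_close t : 0 <= t <= T ->
  let D := del + (c * T + 2 * B * (Pi T - Pi 0) + 3 * B ^+ 2 * (be - al)) in
  [/\ `|q t - q' t| <= D, `|w t - w' t| <= D, `|h t - h' t| <= D & `|r t - r' t| <= D].
Proof.
move=> tT D.
have B20 : 0 <= B ^+ 2 := sqr_ge0 B.
have Bp s : 0 <= s <= T -> 0 <= B * p s by move=> sT; rewrite mulr_ge0// pge.
split.
- apply: phase (traj_q tr) (traj_q tr') _ _ q0 _ tT => s sT.
    move/ltW_in in sT; apply: le_trans (dw sT) _; rewrite /c; have := Bp s sT; move: BPhi dkN Phi0 => X Y Z; lra.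
  apply: le_trans (tame_w bd' sT) _; move: BB B20; lra.
- apply: phase (traj_w tr) (traj_w tr') _ _ w0 _ tT => s sT.
    apply: le_trans (pair_w_rate sT (tame_q bd (ltW_in sT))) _; have := Bp s (ltW_in sT); lra.
  exact: (traj_w_rate bd' sT).
- apply: phase (traj_h tr) (traj_h tr') _ _ h0 _ tT => s sT.
    have sT' := ltW_in sT; have -> : 2 * - P s * w s - 2 * - P' s * w' s = - (2 * (w s * P s - w' s * P' s)) by ring.
    have := Bp s sT'; have := normr_mulB (tame_w bd sT') (tame_P bd' sT') (dw sT') (dP sT).
    rewrite normrN normrM ger0_norm// /c; move: BPhi dkN Phi0 => X Y Z; lra.
  apply: le_trans (traj_h_rate bd' sT) _; move: B20; lra.
- have U b l (f g : R -> R) : prim_on 0 T f (fun s => - (until b s * l * g s)) ->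
    prim_on 0 T f (fun s => until b s * (- (l * g s))).
    by apply: eq_prim_on => // x; ring.
  apply: phase (U _ _ _ _ (traj_r tr)) (U _ _ _ _ (traj_r tr')) _ _ r0 _ tT => s sT.
    move/ltW_in in sT; have := normr_mulB (tame_k bd) (Nw sT) dkk (dw sT).
    rewrite -opprD normrN /c; have := Bp s sT; move: BPhi dkN Phi0 => X Y Z; lra.
  rewrite normrN; apply: le_trans (normrM_le (tame_k bd') (tame_w bd' sT)) _.
  by rewrite -expr2; move: B20; lra.
Qed.

(** At the stop [w a = 0]. From there on [w'] grows at rate [m / 8] and still ends nonpositive, so
    [m / 8 * (be - al) <= - w' al], which is a difference of the two [w] at the time [al]. *)
Lemma pair_gap_small : a <= T ->
  small_regime T k q w r eta -> small_regime T k' q' w' r' eta ->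
  w 0 <= 0 -> w' 0 <= 0 ->
  be - al <= 8 / m * (del + (c * T + B * T * (Pi T - Pi 0))).
Proof.
move=> aT sr sr' w00 w00'.
have alE : al = a by rewrite /al min_l.
have I : 0 <= a <= T by rewrite (traj_ge0 tr).
have [wa _] := traj_rk0_of_q0 tr bd I (traj_stop tr aT).
have m0 : 0 < m.
  by apply: lt_le_trans etam; rewrite mulr_gt0// mulr_gt0// exprn_gt0// (lt_le_trans ltr01).
have PiT : Pi al <= Pi T.
  rewrite -subr_ge0 -[leLHS](mul0r (T - al)).
  apply: prim_on_ge (prim_on_sub al0 (lexx T) PP) _ => // x /andP[x0 xT]; apply: pge.
  by apply: inI => //; exact: le_lt_trans x0.
have W : `|(w al - w' al) - (w 0 - w' 0)| <= c * al + B * T * (Pi al - Pi 0).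
  have K (g f : R -> R) : prim_on 0 T f g -> prim_on 0 al f g by apply: prim_on_sub.
  apply: (proj1 (prim_on_three_phases (be := al) (e := 0) al0 _ _ c0 _ _
    (K _ _ (prim_onB (traj_w tr) (traj_w tr'))) (K _ _ PP) _ _ _ _)) => //.
  - exact: mulr_ge0.
  - by move=> s /andP[s0 sa]; apply: pge; rewrite s0 (le_trans sa).
  - move=> s /andP[s0 sa]; have [-> ->] := until1 sa; rewrite !mul1r.
    have sT : 0 <= s < T by rewrite (ltW s0) (lt_le_trans sa alT).
    apply: pair_w_rate => //.
    (* [q] vanishes at [al], so its Lipschitz bound gives [q <= B * T] before: the factor [T] in
       front of the nonlocal term. *)
    have [+ _ _ _] := traj_lip tr bd (ltW s0) (ltW sa) alT.
    have qal : q al = 0 by rewrite alE (traj_stop tr aT).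
    rewrite qal sub0r normrN => /le_trans; apply.
    by rewrite ler_wpM2l//; move: (ltW s0) alT => X Y; lra.
  - by move=> s /andP[s1 s2]; have := lt_trans s1 s2; rewrite ltxx.
  - by move=> s /andP[s1 s2]; have := lt_trans s1 s2; rewrite ltxx.
have R1 : m / 8 * (be - al) <= w' be - w' al.
  by apply: (small_w_increase tr' bd' eta0 etam Teta sr'); rewrite // ge_min lexx.
have R2 : w' be <= 0.
  by apply: (small_w_neg tr' bd' eta0 etam Teta sr') => //; rewrite beT (le_trans al0).
have R3 : c * al <= c * T by rewrite ler_wpM2l.
have R4 : B * T * (Pi al - Pi 0) <= B * T * (Pi T - Pi 0).
  by rewrite ler_wpM2l ?mulr_ge0// lerD2r.
rewrite -ler_pdivrMl; last by rewrite divr_gt0.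
rewrite invf_div; apply: le_trans R1 _.
move: W (w0); rewrite {1}alE wa !ler_norml => /andP[W1 W2] /andP[W3 W4]; lra.
Qed.

End Pair.
(** [del] bounds the differences of the data, [Phi] those on the whole of [0, T], and [N] the size
    of the factors that multiply [k]. [cp_P] leaves out [s = T], since stopping times capped at [T]
    do not tell which labels have stopped at [T]. *)
Record close_pair (del Phi N dk : R) (p Pi : R -> R)
    (a k : R) (q w h r P : R -> R) (a' k' : R) (q' w' h' r' P' : R -> R) : Prop :=
  ClosePair {
  cp_tr : trajectory T a k q w h r P;
  cp_bd : tame T B m k q w h r P;
  cp_tr' : trajectory T a' k' q' w' h' r' P';
  cp_bd' : tame T B m k' q' w' h' r' P';
  cp_prim : prim_on 0 T Pi p;
  cp_p0 : forall s, 0 <= s <= T -> 0 <= p s;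
  cp_P : forall s, 0 <= s < T -> `|P s - P' s| <= p s;
  cp_q : forall s, 0 <= s <= T -> `|q s - q' s| <= Phi;
  cp_w : forall s, 0 <= s <= T -> `|w s - w' s| <= Phi;
  cp_h : forall s, 0 <= s <= T -> `|h s - h' s| <= Phi;
  cp_r : forall s, 0 <= s <= T -> `|r s - r' s| <= Phi;
  cp_k : `|k - k'| <= dk;
  cp_Nw : forall s, 0 <= s <= T -> `|w s| <= N;
  cp_Nr : forall s, 0 <= s <= T -> `|r s| <= N;
  cp_Nw' : forall s, 0 <= s <= T -> `|w' s| <= N;
  cp_Nr' : forall s, 0 <= s <= T -> `|r' s| <= N;
  cp_q0 : `|q 0 - q' 0| <= del;
  cp_w0 : `|w 0 - w' 0| <= del;
  cp_h0 : `|h 0 - h' 0| <= del;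
  cp_r0 : `|r 0 - r' 0| <= del;
  cp_g0 : `|g8 0 0 0 (q 0) (w 0) (h 0) (r 0) k
           - g8 0 0 0 (q' 0) (w' 0) (h' 0) (r' 0) k'| <= del;
  cp_kappa : (r 0 + k * q 0 == 0) = (r' 0 + k' * q' 0 == 0) }.

Section ClosePairs.
Variables (del Phi N dk : R) (p Pi : R -> R).
Local Notation CP := (close_pair del Phi N dk p Pi).

Lemma close_pair_sym a k q w h r P a' k' q' w' h' r' P' :
  CP a k q w h r P a' k' q' w' h' r' P' ->
  CP a' k' q' w' h' r' P' a k q w h r P.
Proof.
by case=> *; split => // *; rewrite distrC; auto.
Qed.

Variables (a k : R) (q w h r P : R -> R) (a' k' : R) (q' w' h' r' P' : R -> R).
Hypothesis cp : CP a k q w h r P a' k' q' w' h' r' P'.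

Let B1 : 1 <= B := tame_B (cp_bd cp).
Let B0 : 0 <= B := le_trans ler01 B1.
Let T0 : 0 <= T := tame_T (cp_bd cp).
Let I0 : (0 : R) <= 0 <= T.
Proof. by rewrite lexx T0. Qed.
Let Phi0 : 0 <= Phi := le_trans (normr_ge0 _) (cp_q cp I0).
Let del0 : 0 <= del := le_trans (normr_ge0 _) (cp_q0 cp).
Let dk0 : 0 <= dk := le_trans (normr_ge0 _) (cp_k cp).
Let N0 : 0 <= N := le_trans (normr_ge0 _) (cp_Nw cp I0).
Let m0 : 0 < m.
Proof.
by apply: lt_le_trans etam; rewrite mulr_gt0// mulr_gt0// exprn_gt0// (lt_le_trans ltr01).
Qed.
Let BB : B <= B ^+ 2.
Proof. by rewrite expr2 ler_peMl. Qed.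
Let Beta : eta <= B ^+ 2 * eta.
Proof. by rewrite ler_peMl// ?(le_trans _ BB)// ltW. Qed.
Let c := 3 * (B * Phi) + dk * N.
Let c0 : 0 <= c.
Proof. by rewrite addr_ge0// !mulr_ge0. Qed.
Let dPi : 0 <= Pi T - Pi 0.
Proof.
rewrite -[leLHS](mul0r (T - 0)).
apply: prim_on_ge (cp_prim cp) _ => // x /andP[x0 xT]; apply: (cp_p0 cp).
by rewrite (ltW x0) (ltW xT).
Qed.

(** For [del >= eta] the gap, at most 1, is below [del / eta]. Otherwise the label that stops is in
    the small regime, closeness of the data and [cp_kappa] carry this over to the other label, and
    [pair_gap_small] gives the summand [8 / m]. *)
Lemma close_pair_gap_le : a <= a' ->
  Order.min a' T - Order.min a T <=
    (eta^-1 + 8 / m) * (del + (c * T + B * T * (Pi T - Pi 0))).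
Proof.
move=> aa; set D := del + _.
have D0 : 0 <= c * T + B * T * (Pi T - Pi 0) by rewrite addr_ge0// !mulr_ge0.
have m8 : 0 <= 8 / m by rewrite divr_ge0// ltW.
have e1 : 0 <= eta^-1 by rewrite invr_ge0 ltW.
have [aT|Ta] := leP a T; last first.
  rewrite (min_r (le_trans (ltW Ta) aa)) subrr.
  by rewrite mulr_ge0// addr_ge0.
have I : 0 <= a <= T by rewrite (traj_ge0 (cp_tr cp)).
have [wa ra] := traj_rk0_of_q0 (cp_tr cp) (cp_bd cp) I (traj_stop (cp_tr cp) aT).
have ra' : r' 0 + k' * q' 0 = 0 by apply/eqP; rewrite -(cp_kappa cp) ra.
have sr : small_regime T k q w r eta.
  apply: (small_regimeI (cp_tr cp) (cp_bd cp) eta0 Teta I ra).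
    by rewrite (traj_stop (cp_tr cp) aT) mulr_ge0// ltW.
  by rewrite wa normr0 mulr_ge0// ltW.
have [] := traj_small_lip (cp_tr cp) (cp_bd cp) Teta I I0.
rewrite (traj_stop (cp_tr cp) aT) wa !subr0 => qe we.
have w00 : w 0 <= 0.
  rewrite leNgt; apply/negP => /(small_w_pos (cp_tr cp) (cp_bd cp) eta0 etam Teta sr)[+ _].
  by rewrite ltNge aT.
have [ed|de] := leP eta del.
  apply: (@le_trans _ _ (eta^-1 * del)).
    apply: (@le_trans _ _ 1); last by rewrite -ler_pdivrMl ?invr_gt0// invrK mulr1.
    apply: (@le_trans _ _ T) => //.
    have : 0 <= Order.min a T by rewrite le_min (traj_ge0 (cp_tr cp)) T0.
    have : Order.min a' T <= T by rewrite ge_min lexx orbT.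
    by move=> X Y; lra.
  apply: ler_pM => //; first by rewrite lerDl.
  by rewrite lerDl.
have sr' : small_regime T k' q' w' r' eta.
  have := cp_q0 cp; have := cp_w0 cp => Hw Hq.
  apply: (small_regimeI (cp_tr' cp) (cp_bd' cp) eta0 Teta I0 ra').
    by move: Hq qe de; rewrite !ler_norml => /andP[X1 X2] /andP[X3 X4] X5; lra.
  have -> : w' 0 = w 0 - (w 0 - w' 0) by ring.
  by apply: le_trans (normrB_le we Hw) _; move: de; lra.
(* Otherwise [g] of the data would differ by [3 m / 4], more than [del < eta]. *)
have w00' : w' 0 <= 0.
  rewrite leNgt; apply/negP => w0'.
  have := small_g0_pos (cp_bd' cp) (k := k') 0 0 0 w0'.
  have := small_g0_neg (cp_tr cp) (cp_bd cp) eta0 etam Teta sr 0 0 0 w00.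
  have := cp_g0 cp; rewrite ler_norml => /andP[X1 X2] X3 X4.
  by move: Beta etam m0 de => Y1 Y2 Y3 Y4; lra.
have := pair_gap_small (cp_tr cp) (cp_bd cp) (cp_tr' cp) (cp_bd' cp) (cp_prim cp)
  (cp_p0 cp) (cp_P cp) (cp_q cp) (cp_h cp) (cp_r cp) (cp_k cp) (cp_Nw' cp) (cp_Nr' cp)
  (cp_w0 cp) aa aT sr sr' w00 w00'.
rewrite (min_l aT).
move=> /le_trans; apply; apply: ler_wpM2r; first by rewrite addr_ge0.
by rewrite lerDr.
Qed.

Lemma close_pair_close_le t : a <= a' -> 0 <= t <= T ->
  let D := del + (c * T + 2 * B * (Pi T - Pi 0)
    + 3 * B ^+ 2 * (Order.min a' T - Order.min a T)) in
  [/\ `|q t - q' t| <= D, `|w t - w' t| <= D, `|h t - h' t| <= D & `|r t - r' t| <= D].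
Proof.
move=> aa tT.
exact: (pair_close (cp_tr cp) (cp_bd cp) (cp_tr' cp) (cp_bd' cp) (cp_prim cp)
  (cp_p0 cp) (cp_P cp) (cp_q cp) (cp_w cp) (cp_h cp) (cp_r cp) (cp_k cp)
  (cp_Nw' cp) (cp_Nr' cp) (cp_q0 cp) (cp_w0 cp) (cp_h0 cp) (cp_r0 cp) aa tT).
Qed.

Let Ceta := 3 * B + 10 * B ^+ 2 / eta + 20 * B ^+ 2 / m.

Lemma tame_g8 (k0 : R) (q0 w0 h0 r0 P0 : R -> R) t : tame T B m k0 q0 w0 h0 r0 P0 -> 0 <= t <= T ->
  `|g1 0 0 0 (q0 t) (w0 t) (h0 t) (r0 t) k0| <= 5 * B ^+ 2 /\
  `|g2 0 0 0 (q0 t) (w0 t) (h0 t) (r0 t) k0| <= 5 * B ^+ 2.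
Proof.
move=> bd tT; have Hq := tame_q bd tT; have Hw := tame_w bd tT; have Hh := tame_h bd tT.
have Hr := normrM_le (tame_r bd tT) (tame_k bd); rewrite -expr2 in Hr.
rewrite /g1 /g2; move: BB => X; split; last first.
  by apply: le_trans (normrD_le Hq Hh) _; have := sqr_ge0 B; lra.
have H2 : `| (`|w0 t|) + 2 * (`|r0 t * k0|) | <= B + 2 * B ^+ 2.
  by rewrite ger0_norm ?addr_ge0// ?mulr_ge0//; lra.
have H3 : `|2 * q0 t| <= 2 * B by rewrite normrM ger0_norm// ler_wpM2l.
by apply: le_trans (normrD_le H2 H3) _; lra.
Qed.

Let g1t t := g1 0 0 0 (q t) (w t) (h t) (r t) k.
Let g2t t := g2 0 0 0 (q t) (w t) (h t) (r t) k.
Let g1t' t := g1 0 0 0 (q' t) (w' t) (h' t) (r' t) k'.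
Let g2t' t := g2 0 0 0 (q' t) (w' t) (h' t) (r' t) k'.
Let D t := `|q t - q' t| + `|w t - w' t| + `|h t - h' t| + `|r t - r' t|.

Let dg1 t : 0 <= t <= T -> `|g1t t - g1t' t| <= 2 * B * D t + 2 * (dk * N).
Proof.
move=> tT; rewrite /g1t /g1t' /g1.
have -> : `|w t| + 2 * `|r t * k| + 2 * q t - (`|w' t| + 2 * `|r' t * k'| + 2 * q' t)
  = (`|w t| - `|w' t|) + 2 * (`|r t * k| - `|r' t * k'|) + 2 * (q t - q' t) by ring.
have H1 := ler_dist_dist (w t) (w' t).
have H2 := ler_dist_dist (r t * k) (r' t * k').
have H2' : `|r t * k - r' t * k'| <= B * `|r t - r' t| + dk * N.
  have := normr_mulB (tame_k (cp_bd cp)) (cp_Nr' cp tT) (cp_k cp) (lexx `|r t - r' t|).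
  by rewrite (mulrC k) (mulrC k').
have H3 : `|2 * (`|r t * k| - `|r' t * k'|)| <= 2 * (B * `|r t - r' t| + dk * N).
  by rewrite normrM ger0_norm// ler_wpM2l// (le_trans H2).
have H4 : `|2 * (q t - q' t)| <= 2 * `|q t - q' t| by rewrite normrM ger0_norm.
apply: le_trans (normrD_le (normrD_le H1 H3) H4) _; rewrite /D.
have X (x : R) : 0 <= x -> x <= B * x by move=> x0; rewrite ler_peMl.
have := X _ (normr_ge0 (q t - q' t)); have := X _ (normr_ge0 (w t - w' t)).
have := X _ (normr_ge0 (h t - h' t)); have := normr_ge0 (q t - q' t).
have := normr_ge0 (w t - w' t); have := normr_ge0 (h t - h' t); lra.
Qed.

Let dg2 t : `|g2t t - g2t' t| <= B * D t.
Proof.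
rewrite /g2t /g2t' /g2.
have -> : q t + h t - (q' t + h' t) = (q t - q' t) + (h t - h' t) by ring.
apply: le_trans (ler_normD _ _) _.
have X : D t <= B * D t by rewrite ler_peMl// !addr_ge0.
by apply: le_trans X; rewrite /D; have := normr_ge0 (w t - w' t); have := normr_ge0 (r t - r' t); lra.
Qed.

Let D0 t : 0 <= D t.
Proof. by rewrite !addr_ge0. Qed.

Let be0 : 0 <= B ^+ 2 / eta.
Proof. by rewrite divr_ge0// ?sqr_ge0// ltW. Qed.
Let bm0 : 0 <= B ^+ 2 / m.
Proof. by rewrite divr_ge0// ?sqr_ge0// ltW. Qed.

Let Ceta_ge x t : x <= 3 * B * (dk * N + D t) \/ x <= 10 * B ^+ 2 / eta * D t \/ x <= 20 * B ^+ 2 / m * del ->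
  x <= Ceta * (del + dk * N + D t).
Proof.
have dkN : 0 <= dk * N by exact: mulr_ge0.
have P1 : 0 <= B * (del + dk * N + D t) by rewrite mulr_ge0// !addr_ge0.
have P2 : 0 <= B ^+ 2 / eta * (del + dk * N + D t) by rewrite mulr_ge0// !addr_ge0.
have P3 : 0 <= B ^+ 2 / m * (del + dk * N + D t) by rewrite mulr_ge0// !addr_ge0.
have Q1 : 0 <= B * del by exact: mulr_ge0.
have Q2 : 0 <= B ^+ 2 / eta * (del + dk * N) by rewrite mulr_ge0// addr_ge0.
have Q3 : 0 <= B ^+ 2 / m * (D t + dk * N) by rewrite mulr_ge0// addr_ge0.
rewrite /Ceta -!(mulrA _ (B ^+ 2)).
by move=> [H|[H|H]]; lra.
Qed.

(** Either [g1' > g2'], and Lipschitz bounds suffice, or the labels are separated by the sign of [w]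
    alone. In that case the crude bound [10 * B ^+ 2] is proportional to [D t] when [w] and [w']
    differ by [eta], and to [del] when they do not, because the data then lay on both sides of the
    jump of [g]. These are the three summands of [Ceta]. *)
Lemma close_pair_g8_mixed t : 0 <= t <= T ->
  inOmega1 0 0 0 (q t) (w t) (h t) (r t) k ->
  ~~ inOmega1 0 0 0 (q' t) (w' t) (h' t) (r' t) k' ->
  `|g1t t - g2t' t| <= Ceta * (del + dk * N + D t).
Proof.
move=> tT /and3P[g12 wt /eqP rt] nO.
have r0 : r 0 + k * q 0 = 0 by rewrite -(traj_rk_const (cp_tr cp) tT).
have r0' : r' 0 + k' * q' 0 = 0 by apply/eqP; rewrite -(cp_kappa cp) r0.
have rt' : r' t + k' * q' t = 0 by rewrite (traj_rk_const (cp_tr' cp) tT).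
have [H1 _] := tame_g8 (cp_bd cp) tT; have [_ H2] := tame_g8 (cp_bd' cp) tT.
have H12 := normrB_le H1 H2; rewrite -/(g1t t) -/(g2t' t) in H12.
have [g21'|g12'] := ltP (g2t' t) (g1t' t).
  (* [g1 <= g2] and [g2' < g1'] squeeze [g1 - g2'] between [g1 - g1'] and [g2 - g2']. *)
  apply: Ceta_ge; left; have := dg1 tT; have := @dg2 t; rewrite !ler_norml.
  have := mulr_ge0 dk0 N0; have : 0 <= B * D t by rewrite mulr_ge0.
  have : dk * N <= B * (dk * N) by rewrite ler_peMl// mulr_ge0.
  move: g12 g21'; rewrite -/(g1t t) -/(g2t t) => X1 X2 X3 X4 X5 /andP[X6 X7] /andP[X8 X9].
  by apply/andP; split; lra.
have wt' : 0 < w' t.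
  by rewrite ltNge; apply: contra nO => X; rewrite /inOmega1 X rt' eqxx g12'.
have dwt : `|w t - w' t| <= D t.
  rewrite /D; have := normr_ge0 (q t - q' t); have := normr_ge0 (h t - h' t).
  by have := normr_ge0 (r t - r' t); lra.
have [edw|/ltW dwe] := leP eta `|w t - w' t|.
  apply: Ceta_ge; right; left; apply: le_trans H12 _.
  rewrite (_ : _ + _ = 10 * B ^+ 2); last by ring.
  rewrite -mulrA ler_peMr ?mulr_ge0 ?sqr_ge0// mulrC -ler_pdivrMr ?invr_gt0// div1r invrK.
  exact: le_trans dwt.
have we : `|w t| <= eta.
  by move: dwe wt wt'; rewrite !ler_norml => /andP[X1 X2] X3 X4; apply/andP; split; move: eta0; lra.
have we' : `|w' t| <= eta.
  by move: dwe wt wt'; rewrite !ler_norml => /andP[X1 X2] X3 X4; apply/andP; split; move: eta0; lra.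
have sr := small_regime_of_g (cp_tr cp) (cp_bd cp) eta0 etam Teta tT we rt g12.
have sr' := small_regime_of_g (cp_tr' cp) (cp_bd' cp) eta0 etam Teta tT we' rt' g12'.
(* In the small regime the sign of [w] at time [t] is its sign at time 0. *)
have w0 : w 0 <= 0.
  rewrite leNgt; apply/negP => w0.
  have [_ /(_ t tT)] := small_w_pos (cp_tr cp) (cp_bd cp) eta0 etam Teta sr w0.
  by rewrite ltNge wt.
have w0' : 0 < w' 0.
  rewrite ltNge; apply/negP => w0'.
  have := small_w_neg (cp_tr' cp) (cp_bd' cp) eta0 etam Teta sr' w0' tT.
  by rewrite leNgt wt'.
have G1 := small_g0_pos (cp_bd' cp) (k := k') 0 0 0 w0'.
have G2 := small_g0_neg (cp_tr cp) (cp_bd cp) eta0 etam Teta sr 0 0 0 w0.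
have G3 := cp_g0 cp.
have dm : m / 2 <= del.
  by move: G3 G1 G2 m0; rewrite ler_norml => /andP[X1 X2] X3 X4 X5; lra.
apply: Ceta_ge; right; right; apply: le_trans H12 _.
have : 20 * B ^+ 2 / m * (m / 2) <= 20 * B ^+ 2 / m * del.
  by rewrite ler_wpM2l// -mulrA mulr_ge0.
apply: le_trans; rewrite le_eqVlt; apply/orP; left; apply/eqP; field.
by rewrite gt_eqF.
Qed.

Lemma close_pair_g8_half t : 0 <= t <= T ->
  (inOmega1 0 0 0 (q' t) (w' t) (h' t) (r' t) k' -> inOmega1 0 0 0 (q t) (w t) (h t) (r t) k) ->
  `|g8 0 0 0 (q t) (w t) (h t) (r t) k - g8 0 0 0 (q' t) (w' t) (h' t) (r' t) k'|
   <= Ceta * (del + dk * N + D t).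
Proof.
move=> tT; rewrite /g8; case: ifPn => O1; case: ifPn => O2 H.
- apply: Ceta_ge; left; apply: le_trans (dg1 tT) _.
  have : 0 <= B * D t by rewrite mulr_ge0.
  have := mulr_ge0 dk0 N0.
  have : dk * N <= B * (dk * N) by rewrite ler_peMl// mulr_ge0.
  by lra.
- exact: close_pair_g8_mixed.
- by have := H isT.
- apply: Ceta_ge; left; apply: le_trans (@dg2 t) _.
  have : 0 <= B * D t by rewrite mulr_ge0.
  have := mulr_ge0 B0 (mulr_ge0 dk0 N0).
  by lra.
Qed.

End ClosePairs.

(** * Close pairs, without an order of the stopping times *)

Section ClosePairsSymmetric.
Variables (del Phi N dk : R) (p Pi : R -> R).
Variables (a k : R) (q w h r P : R -> R) (a' k' : R) (q' w' h' r' P' : R -> R).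
Hypothesis cp : close_pair del Phi N dk p Pi a k q w h r P a' k' q' w' h' r' P'.

Lemma close_pair_gap : `|Order.min a T - Order.min a' T| <=
  (eta^-1 + 8 / m) *
  (del + ((3 * (B * Phi) + dk * N) * T + B * T * (Pi T - Pi 0))).
Proof.
have mono (b b' : R) : b <= b' -> Order.min b T <= Order.min b' T.
  by move=> bb; rewrite le_min !ge_min bb lexx !orbT.
have [aa|/ltW aa] := leP a a'.
  by rewrite distrC ger0_norm ?subr_ge0 ?mono//; exact: close_pair_gap_le cp aa.
rewrite ger0_norm ?subr_ge0 ?mono//.
exact: close_pair_gap_le (close_pair_sym cp) aa.
Qed.

Lemma close_pair_close t : 0 <= t <= T ->
  let D := del + ((3 * (B * Phi) + dk * N) * T + 2 * B * (Pi T - Pi 0)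
    + 3 * B ^+ 2 * `|Order.min a T - Order.min a' T|) in
  [/\ `|q t - q' t| <= D, `|w t - w' t| <= D, `|h t - h' t| <= D & `|r t - r' t| <= D].
Proof.
move=> tT.
have mono (b b' : R) : b <= b' -> Order.min b T <= Order.min b' T.
  by move=> bb; rewrite le_min !ge_min bb lexx !orbT.
have [aa|/ltW aa] := leP a a'.
  rewrite (distrC (Order.min a T)) (ger0_norm (x := Order.min a' T - _)) ?subr_ge0 ?mono//.
  exact: (close_pair_close_le cp aa tT).
rewrite (ger0_norm (x := Order.min a T - _)) ?subr_ge0 ?mono//.
have := close_pair_close_le (close_pair_sym cp) aa tT.
by rewrite /= (distrC (q t)) (distrC (w t)) (distrC (h t)) (distrC (r t)).
Qed.

Lemma close_pair_g8 t : 0 <= t <= T ->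
  `|g8 0 0 0 (q t) (w t) (h t) (r t) k - g8 0 0 0 (q' t) (w' t) (h' t) (r' t) k'|
   <= (3 * B + 10 * B ^+ 2 / eta + 20 * B ^+ 2 / m) *
      (del + dk * N + (`|q t - q' t| + `|w t - w' t| + `|h t - h' t| + `|r t - r' t|)).
Proof.
move=> tT.
have [Om|nOm] := boolP (inOmega1 0 0 0 (q t) (w t) (h t) (r t) k).
  exact: (close_pair_g8_half cp tT).
have := close_pair_g8_half (close_pair_sym cp) tT.
rewrite distrC (distrC (q t)) (distrC (w t)) (distrC (h t)) (distrC (r t)); apply.
by move=> Om; rewrite Om in nOm.
Qed.

End ClosePairsSymmetric.
End TrajectoryPairs.

(** * Convolution with the kernel exp(-|x|), pointwise and in L^2 *)

Section ExponentialConvolution.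
Variable R : realType.
Local Notation mu := (@lebesgue_measure R).
Local Notation RM := (measurableTypeR R).
Implicit Types (f g u : R -> R) (x y c C : R).

Lemma aeS (P Q : R -> Prop) : (\forall x \ae mu, P x) -> (forall x, P x -> Q x) ->
  \forall x \ae mu, Q x.
Proof.
move=> [N [mN N0 PN]] PQ; exists N; split => // x nQ; apply: PN => Px.
exact: nQ (PQ x Px).
Qed.

Lemma aeI (P Q : R -> Prop) : (\forall x \ae mu, P x) -> (\forall x \ae mu, Q x) ->
  \forall x \ae mu, P x /\ Q x.
Proof.
move=> HP HQ; have := negligibleU HP HQ; apply: negligibleS => x /= nPQ.
by have [Px|] := pselect (P x); [right => Qx; exact: nPQ|left].
Qed.

Definition ek x y : R := expR (- `|x - y|).

Lemma ek_ge0 x y : 0 <= ek x y. Proof. exact: expR_ge0. Qed.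

Lemma ek_sym x y : ek x y = ek y x. Proof. by rewrite /ek distrC. Qed.

Lemma continuous_expR_sub c : continuous (fun y : R => expR (c - y)).
Proof.
move=> y; apply: continuous_comp; last exact: continuous_expR.
by apply: continuousB; [exact: cst_continuous|exact: cvg_id].
Qed.

Lemma integral_expR_tail c :
  (\int[mu]_(y in `[c, +oo[) (expR (c - y))%:E = 1)%E.
Proof.
have dF x : is_derive x 1 (fun y : R => - expR (c - y)) (expR (c - x)).
  apply: is_derive_eq; rewrite /GRing.scale /=; ring.
rewrite (@ge0_continuous_FTC2y _ _ (fun y => - expR (c - y)) c 0).
- by rewrite subrr expR0 EFinN oppeK add0e.
- by move=> x _; exact: expR_ge0.
- by apply: continuous_subspaceT => x; exact: continuous_expR_sub.
- rewrite -oppr0; apply: cvgN.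
  have -> : (fun y : R => expR (c - y)) = (fun y : R => expR c * expR (- y)).
    by apply/funext => y; rewrite expRD.
  rewrite -(mulr0 (expR c)); apply: cvgMr.
  exact: (cvgr_expR (R := R)).
- by move=> x _; have [] := dF x.
- apply: cvg_at_right_filter; apply: cvgN; exact: continuous_expR_sub.
- by move=> x _; rewrite derive1E; have [_ ->] := dF x.
Qed.

Lemma continuous_ek x : continuous (ek x).
Proof.
move=> y; apply: continuous_comp; last exact: continuous_expR.
apply: continuousN; apply: continuous_comp; last exact: norm_continuous.
by apply: continuousB; [exact: cst_continuous|exact: cvg_id].
Qed.

Lemma measurable_ek x : measurable_fun setT (ek x).
Proof. by apply: continuous_measurable_fun; exact: continuous_ek. Qed.

Lemma integral_ek x : (\int[mu]_y (ek x y)%:E = 2%:E)%E.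
Proof.
have mE := measurable_ek x.
rewrite (_ : [set: R] = `]-oo, x] `|` `]x, +oo[); last first.
  by rewrite -itv_bndbnd_setU ?bnd_simp// set_itvE.
rewrite ge0_integral_setU//=; last 3 first.
- by apply: measurable_funS (measurableT) _ _ => //; apply/measurable_EFinP.
- by move=> y _; rewrite lee_fin ek_ge0.
- apply/disj_setPS => y [/=]; rewrite !in_itv/= andbT => yx xy.
  by have := le_lt_trans yx xy; rewrite ltxx.
have -> : (\int[mu]_(y in `]x, +oo[) (ek x y)%:E = 1)%E.
  rewrite integral_itv_obnd_cbnd; last by apply: measurable_funTS; apply/measurable_EFinP.
  rewrite -(integral_expR_tail x); apply: eq_integral => y.
  rewrite inE/= in_itv/= andbT => xy; rewrite /ek ler0_norm ?subr_le0//.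
  by rewrite opprK.
have -> : (\int[mu]_(y in `]-oo, x]) (ek x y)%:E = 1)%E.
  rewrite -{1}(opprK x) ge0_integration_by_substitutionNy; first last.
  - by move=> y _; exact: ek_ge0.
  - by apply: continuous_subspaceT => y; exact: continuous_ek.
  rewrite -(integral_expR_tail (- x)); apply: eq_integral => y.
  rewrite inE/= in_itv/= andbT => xy; rewrite /ek opprK ger0_norm; last by lra.
  by congr (expR _)%:E; ring.
by rewrite -EFinD.
Qed.

(** The bound [C] makes every convolution finite; it enters none of the final constants, which
    involve L^2 bounds only. *)
Definition dominator C f : Prop :=
  measurable_fun setT f /\ forall x, 0 <= f x <= C.

Definition conv f x : R := \int[mu]_y (ek x y * f y).

Lemma dominator_measurable C f : dominator C f -> measurable_fun setT f.
Proof. by case. Qed.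
Lemma dominator_ge0 C f x : dominator C f -> 0 <= f x.
Proof. by case=> _ /(_ x)/andP[]. Qed.
Lemma dominator_le C f x : dominator C f -> f x <= C.
Proof. by case=> _ /(_ x)/andP[]. Qed.

Lemma dominatorD C C' f g : dominator C f -> dominator C' g ->
  dominator (C + C') (fun x => f x + g x).
Proof.
move=> [mf f0] [mg g0]; split; first exact: measurable_funD.
by move=> x; have /andP[a b] := f0 x; have /andP[c d] := g0 x; rewrite addr_ge0// lerD.
Qed.

Lemma dominatorZ C c f : 0 <= c -> dominator C f -> dominator (c * C) (fun x => c * f x).
Proof.
move=> c0 [mf f0]; split; first exact: measurable_funM.
by move=> x; have /andP[a b] := f0 x; rewrite mulr_ge0// ler_wpM2l.
Qed.

Lemma integrable_ek x : mu.-integrable setT (EFin \o ek x).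
Proof.
apply/integrableP; split; first by apply/measurable_EFinP; exact: measurable_ek.
under eq_integral do rewrite /= ger0_norm ?ek_ge0//.
by rewrite integral_ek ltry.
Qed.

Lemma integrable_ek_dominator C f x : dominator C f ->
  mu.-integrable setT (EFin \o (fun y => ek x y * f y)).
Proof.
move=> [mf f0].
apply: (le_integrable measurableT _ _ (integrableZl measurableT C (integrable_ek x))).
  by apply/measurable_EFinP; apply: measurable_funM => //; exact: measurable_ek.
move=> y _; have /andP[fy0 fyC] := f0 y; rewrite /= lee_fin.
rewrite !ger0_norm ?mulr_ge0 ?ek_ge0//; last exact: le_trans fyC.
by rewrite mulrC ler_wpM2r ?ek_ge0.
Qed.

Lemma conv_ge0 C f x : dominator C f -> 0 <= conv f x.
Proof.
by move=> [_ f0]; apply: Rintegral_ge0 => y _; rewrite mulr_ge0 ?ek_ge0//; case/andP: (f0 y).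
Qed.

Lemma convE C f x : dominator C f ->
  (\int[mu]_y (ek x y * f y)%:E = (conv f x)%:E)%E.
Proof.
move=> H; rewrite /conv /Rintegral fineK//.
exact: integrable_fin_num (integrable_ek_dominator x H).
Qed.

Lemma conv_mono C C' f g x : dominator C f -> dominator C' g ->
  (forall y, f y <= g y) -> conv f x <= conv g x.
Proof.
move=> F G fg; apply: le_Rintegral => //.
- exact: integrable_ek_dominator F.
- exact: integrable_ek_dominator G.
- by move=> y _; rewrite ler_wpM2l ?ek_ge0.
Qed.

Lemma convD C C' f g x : dominator C f -> dominator C' g ->
  conv (fun y => f y + g y) x = conv f x + conv g x.
Proof.
move=> F G; rewrite /conv -RintegralD//.
- by apply: eq_Rintegral => y _; rewrite mulrDr.
- exact: integrable_ek_dominator F.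
- exact: integrable_ek_dominator G.
Qed.

Lemma convZ C c f x : dominator C f -> conv (fun y => c * f y) x = c * conv f x.
Proof.
move=> F; rewrite /conv -RintegralZl//.
- by apply: eq_Rintegral => y _; rewrite mulrCA.
- exact: integrable_ek_dominator F.
Qed.

Lemma conv_cst c x : conv (fun=> c) x = 2 * c.
Proof.
have -> : conv (fun=> c) x = c * \int[mu]_y ek x y.
  rewrite /conv -RintegralZl//; last exact: integrable_ek.
  by apply: eq_Rintegral => y _; rewrite mulrC.
by rewrite /Rintegral integral_ek/= mulrC.
Qed.

Lemma conv_le C f x : dominator C f -> conv f x <= 2 * C.
Proof.
move=> F; have [mf f0] := F; have C0 : 0 <= C by have /andP[a b] := f0 0; exact: le_trans b.
rewrite -(conv_cst C x); apply: (conv_mono x F (C' := C)).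
  by split; [exact: measurable_cst|move=> y; rewrite C0 lexx].
by move=> y; have /andP[] := f0 y.
Qed.

Lemma measurable_ek2 : measurable_fun [set: RM * RM] (fun z : RM * RM => ek z.1 z.2).
Proof.
apply: measurableT_comp; first exact: measurable_expR.
apply: measurableT_comp; first exact: oppr_measurable.
apply: measurableT_comp; first exact: normr_measurable.
by apply: measurable_funB; [exact: measurable_fst|exact: measurable_snd].
Qed.

Lemma measurable_ek_mul f : measurable_fun setT f ->
  measurable_fun [set: RM * RM] (fun z : RM * RM => (ek z.1 z.2 * f z.2)%:E).
Proof.
move=> mf; apply/measurable_EFinP; apply: measurable_funM; first exact: measurable_ek2.
by apply: measurableT_comp => //; exact: measurable_snd.
Qed.

Lemma dominator_conv C f : dominator C f -> dominator (2 * C) (conv f).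
Proof.
move=> F; split; last by move=> x; rewrite (conv_ge0 _ F) (conv_le _ F).
apply/measurable_EFinP.
have -> : EFin \o conv f = fubini_F mu (fun z : RM * RM => (ek z.1 z.2 * f z.2)%:E).
  by apply/funext => x; rewrite /= -(convE x F).
have G0 (z : RM * RM) : (0 <= (ek z.1 z.2 * f z.2)%:E)%E.
  by rewrite lee_fin mulr_ge0 ?ek_ge0 ?(dominator_ge0 _ F).
have mG := measurable_ek_mul (dominator_measurable F).
exact: (@measurable_fun_fubini_tonelli_F _ _ RM RM R mu _ mG G0).
Qed.

Lemma norm_Rintegral_le_conv C (c : R) f u x : 0 <= c -> dominator C f -> measurable_fun setT u ->
  (\forall y \ae mu, `|u y| <= c * (ek x y * f y)) ->
  mu.-integrable setT (EFin \o u) /\ `|\int[mu]_y u y| <= c * conv f x.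
Proof.
move=> c0 F mu_ uf; have cF := dominatorZ c0 F.
have I : mu.-integrable setT (EFin \o u).
  apply/integrableP; split; first exact/measurable_EFinP.
  apply: (@le_lt_trans _ _ (\int[mu]_y (ek x y * (c * f y))%:E)%E); last first.
    by rewrite (convE _ cF) ltry.
  apply: ae_ge0_le_integral => //.
  - by apply: measurableT_comp => //; exact/measurable_EFinP.
  - by move=> y _; rewrite lee_fin mulr_ge0 ?ek_ge0// (dominator_ge0 _ cF).
  - by case/integrableP : (integrable_ek_dominator x cF).
  - by apply: (aeS uf) => y + _; rewrite /= lee_fin mulrCA.
split => //.
apply: le_trans (le_normr_Rintegral _ I) _ => //.
rewrite -(convZ _ _ F) -lee_fin -(convE _ cF) /Rintegral fineK; last first.
  by apply: integrable_fin_num => //; exact: (integrable_norm I).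
apply: ae_ge0_le_integral => //.
- by apply: measurableT_comp => //; apply: measurableT_comp.
- by move=> y _; rewrite lee_fin mulr_ge0 ?ek_ge0// (dominator_ge0 _ cF).
- by case/integrableP : (integrable_ek_dominator x cF).
- by apply: (aeS uf) => y + _; rewrite /= lee_fin mulrCA.
Qed.

Lemma conv_ae_le C C' f g x : dominator C f -> dominator C' g ->
  (\forall y \ae mu, f y <= g y) -> conv f x <= conv g x.
Proof.
move=> F G fg; rewrite -[leRHS]mul1r; apply: le_trans (ler_norm _) _.
apply: (proj2 (norm_Rintegral_le_conv ler01 G _ _)).
  by apply: measurable_funM; [exact: measurable_ek|exact: F.1].
apply: aeS fg _ => y fgy; rewrite mul1r ger0_norm ?mulr_ge0 ?ek_ge0 ?(dominator_ge0 _ F)//.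
by rewrite ler_wpM2l ?ek_ge0.
Qed.

(** The L^2 norm is kept squared and extended, so that sums, convolutions and monotone limits need
    no root. *)
Definition sqint f : \bar R := (\int[mu]_x (f x ^+ 2)%:E)%E.

Lemma measurable_sq f : measurable_fun setT f -> measurable_fun setT (fun x => (f x ^+ 2)%:E).
Proof. by move=> mf; apply/measurable_EFinP; exact: measurable_funX. Qed.

Lemma sqint_ge0 f : (0 <= sqint f)%E.
Proof. by apply: integral_ge0 => x _; rewrite lee_fin sqr_ge0. Qed.

Lemma sqint_le f g : measurable_fun setT f -> measurable_fun setT g ->
  (\forall x \ae mu, `|f x| <= g x) -> (sqint f <= sqint g)%E.
Proof.
move=> mf mg fg; apply: ae_ge0_le_integral => //.
- by move=> x _; rewrite lee_fin sqr_ge0.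
- exact: measurable_sq.
- by move=> x _; rewrite lee_fin sqr_ge0.
- exact: measurable_sq.
- apply: (aeS fg) => x H _; rewrite lee_fin -(real_normK (num_real (f x))).
  by rewrite lerXn2r ?nnegrE ?normr_ge0//; exact: le_trans H.
Qed.

Lemma sqintZ c f : measurable_fun setT f -> sqint (fun x => c * f x) = ((c ^+ 2)%:E * sqint f)%E.
Proof.
move=> mf; rewrite /sqint -ge0_integralZl_EFin ?sqr_ge0//.
- by apply: eq_integral => x _; rewrite exprMn EFinM.
- by move=> x _; rewrite lee_fin sqr_ge0.
- exact: measurable_sq.
Qed.

Lemma sqintD f g : measurable_fun setT f -> measurable_fun setT g ->
  (sqint (fun x => (f x + g x)%R) <= 2%:E * sqint f + 2%:E * sqint g)%E.
Proof.
move=> mf mg; rewrite /sqint -!ge0_integralZl_EFin//; last 4 first.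
- by move=> x _; rewrite lee_fin sqr_ge0.
- exact: measurable_sq.
- by move=> x _; rewrite lee_fin sqr_ge0.
- exact: measurable_sq.
have m2 (h : R -> R) : measurable_fun setT h -> measurable_fun setT (fun x => (2%:E * (h x ^+ 2)%:E)%E).
  by move=> mh; apply: measurable_funeM; exact: measurable_sq.
rewrite -ge0_integralD//; first last.
- exact: m2.
- by move=> x _; rewrite mule_ge0// lee_fin sqr_ge0.
- exact: m2.
- by move=> x _; rewrite mule_ge0// lee_fin sqr_ge0.
apply: ge0_le_integral => //.
- by move=> x _; rewrite lee_fin sqr_ge0.
- by apply: measurable_sq; exact: measurable_funD.
- by apply: emeasurable_funD; exact: m2.
- by move=> x _; rewrite -!EFinM -EFinD lee_fin; have := sqr_ge0 (f x - g x); lra.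
Qed.

(* Integrating [f^2 >= 2 A f - A^2] against the kernel of mass 2, with
   [A = conv f x / 2], gives the Cauchy-Schwarz inequality. *)
Lemma conv_sqr_le C f x : dominator C f -> conv f x ^+ 2 <= 2 * conv (fun y => f y ^+ 2) x.
Proof.
move=> F; have F2 : dominator (C ^+ 2) (fun y => f y ^+ 2).
  split; first by apply: measurable_funX; exact: F.1.
  by move=> y; rewrite sqr_ge0 lerXn2r ?nnegrE ?(dominator_ge0 _ F) ?(dominator_le _ F)//
    (le_trans _ (dominator_le y F)) ?(dominator_ge0 _ F).
pose A := conv f x / 2; have A0 : 0 <= A by rewrite divr_ge0// (conv_ge0 _ F).
have FA := dominatorZ (mulr_ge0 (ler0n R 2) A0) F.
have FC : dominator (A ^+ 2) (fun=> A ^+ 2).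
  by split; [exact: measurable_cst|move=> y; rewrite sqr_ge0 lexx].
have := conv_mono x FA (dominatorD F2 FC).
rewrite (convZ _ _ F) (convD _ F2 FC) conv_cst => H.
have {}H : 2 * A * conv f x <= conv (fun y => f y ^+ 2) x + 2 * A ^+ 2.
  by apply: H => y; have := sqr_ge0 (f y - A); lra.
have E : conv f x = 2 * A by rewrite /A; field.
by rewrite E in H *; lra.
Qed.

Lemma integral_ek_swap C f : dominator C f ->
  (\int[mu]_x \int[mu]_y (ek x y * f y)%:E = \int[mu]_y \int[mu]_x (ek x y * f y)%:E)%E.
Proof.
move=> F; have G0 (z : RM * RM) : (0 <= (ek z.1 z.2 * f z.2)%:E)%E.
  by rewrite lee_fin mulr_ge0 ?ek_ge0 ?(dominator_ge0 _ F).
have mG := measurable_ek_mul (dominator_measurable F).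
exact: (@fubini_tonelli _ _ RM RM R mu mu _ mG G0).
Qed.

(** Young's inequality: the mass 2 of the kernel appears once through [conv_sqr_le] and once more
    after Tonelli. *)
Lemma sqint_conv C f : dominator C f -> (sqint (conv f) <= 4%:E * sqint f)%E.
Proof.
move=> F; have F2 : dominator (C ^+ 2) (fun y => f y ^+ 2).
  split; first by apply: measurable_funX; exact: F.1.
  by move=> y; rewrite sqr_ge0 lerXn2r ?nnegrE ?(dominator_ge0 _ F) ?(dominator_le _ F)//
    (le_trans _ (dominator_le y F)) ?(dominator_ge0 _ F).
apply: (@le_trans _ _ (\int[mu]_x (2%:E * (conv (fun y => f y ^+ 2) x)%:E))%E).
  apply: ge0_le_integral => //.
  - by move=> x _; rewrite lee_fin sqr_ge0.
  - by apply: measurable_sq; exact: (dominator_conv F).1.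
  - by apply: measurable_funeM; apply/measurable_EFinP; exact: (dominator_conv F2).1.
  - by move=> x _; rewrite -EFinM lee_fin; exact: conv_sqr_le F.
rewrite ge0_integralZl_EFin//; last 2 first.
- by move=> x _; rewrite lee_fin (conv_ge0 _ F2).
- by apply/measurable_EFinP; exact: (dominator_conv F2).1.
under eq_integral do rewrite -(convE _ F2).
rewrite (integral_ek_swap F2).
rewrite [X in (_ * X)%E](_ : _ = 2%:E * sqint f)%E.
  by rewrite muleA -EFinM -natrM.
rewrite /sqint -ge0_integralZl_EFin//; last 2 first.
- by move=> x _; rewrite lee_fin sqr_ge0.
- by apply: measurable_sq; exact: F.1.
apply: eq_integral => y _.
under eq_integral do rewrite ek_sym mulrC EFinM.
rewrite ge0_integralZl_EFin ?sqr_ge0//.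
- by rewrite integral_ek muleC.
- by move=> x _; rewrite lee_fin ek_ge0.
- by apply/measurable_EFinP; exact: measurable_ek.
Qed.

(** [conv_sqr_le] and the bound 1 of the kernel. This is how an L^2 bound returns to the sup norm
    needed for [zeta]. *)
Lemma conv_sup C f x : dominator C f -> ((conv f x ^+ 2)%:E <= 2%:E * sqint f)%E.
Proof.
move=> F; have F2 : dominator (C ^+ 2) (fun y => f y ^+ 2).
  split; first by apply: measurable_funX; exact: F.1.
  by move=> y; rewrite sqr_ge0 lerXn2r ?nnegrE ?(dominator_ge0 _ F) ?(dominator_le _ F)//
    (le_trans _ (dominator_le y F)) ?(dominator_ge0 _ F).
apply: (@le_trans _ _ (2%:E * (conv (fun y => (f y ^+ 2)%R) x)%:E)%E).
  by rewrite -EFinM lee_fin; exact: conv_sqr_le F.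
rewrite -(convE _ F2) lee_pmul2l ?ltry// ?lte_fin//.
apply: ge0_le_integral => //.
- by move=> y _; rewrite lee_fin mulr_ge0 ?ek_ge0 ?sqr_ge0.
- by case/integrableP : (integrable_ek_dominator x F2).
- by apply: measurable_sq; exact: F.1.
- move=> y _; rewrite lee_fin ler_piMl ?sqr_ge0// /ek.
  by rewrite -[leRHS]expR0 ler_expR oppr_le0.
Qed.

Lemma sqintZ_le c f (S : R) : measurable_fun setT f -> (sqint f <= S%:E)%E ->
  (sqint (fun x => (c * f x)%R) <= (c ^+ 2 * S)%:E)%E.
Proof.
by move=> mf fS; rewrite sqintZ// (EFinM (c ^+ 2)); apply: lee_wpmul2l => //; rewrite lee_fin sqr_ge0.
Qed.

Lemma sqintD_le f g (S S' : R) : measurable_fun setT f -> measurable_fun setT g ->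
  (sqint f <= S%:E)%E -> (sqint g <= S'%:E)%E ->
  (sqint (fun x => (f x + g x)%R) <= (2 * S + 2 * S')%:E)%E.
Proof.
move=> mf mg fS gS; apply: le_trans (sqintD mf mg) _; rewrite (EFinD (2 * S)) (EFinM 2 S) (EFinM 2 S').
by apply: leeD; apply: lee_wpmul2l => //; rewrite lee_fin.
Qed.

Lemma sqint_conv_le C f (S : R) : dominator C f -> (sqint f <= S%:E)%E ->
  (sqint (conv f) <= (4 * S)%:E)%E.
Proof.
move=> F fS; apply: le_trans (sqint_conv F) _; rewrite (EFinM 4).
by apply: lee_wpmul2l => //; rewrite lee_fin.
Qed.

Lemma conv_sup_le C f x (S : R) : dominator C f -> (sqint f <= S%:E)%E ->
  conv f x ^+ 2 <= 2 * S.
Proof.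
move=> F fS; rewrite -lee_fin; apply: le_trans (conv_sup x F) _; rewrite (EFinM 2).
by apply: lee_wpmul2l => //; rewrite lee_fin.
Qed.

End ExponentialConvolution.

(** * Fixed-point iteration for square integrable majorants *)

Section DominatorIteration.
Variable R : realType.
Local Notation mu := (@lebesgue_measure R).
Implicit Types (x C e : R).

Variables (Dom : (R -> R) -> Prop) (psi : R -> R) (C b0 th : R).
Hypothesis Dom_mono : forall f g : R -> R, (forall x, f x <= g x) -> Dom f -> Dom g.
Hypothesis Dom_inf : forall f : R -> R, (forall e, 0 < e -> Dom (fun x => f x + e)) -> Dom f.
Hypothesis Dom_start : Dom (fun=> b0).
Hypothesis Dom_step : forall (C' : R) (f : R -> R), dominator C' f -> Dom f ->
  Dom (fun x => psi x + th * (f x + conv f x)).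
Variable S : R.
Hypothesis psiS : (sqint psi <= S%:E)%E.
Hypotheses (psiC : dominator C psi) (th0 : 0 <= th) (th1 : th <= 10^-1) (b0ge : 0 <= b0).

(** Picard iterates, from 0, of [f = psi + th * (f + conv f)]. They need not be majorants: the n-th
    is one up to the error [(3 * th) ^+ n * b0], where 3 is 1 plus the mass of the kernel. *)
Fixpoint iter_dom (n : nat) : R -> R :=
  if n is n'.+1 then fun x => psi x + th * (iter_dom n' x + conv (iter_dom n') x)
  else fun=> 0.

Let C0 : 0 <= C := le_trans (dominator_ge0 0 psiC) (dominator_le 0 psiC).

Lemma iter_dom_dominator n : dominator (2 * C) (iter_dom n).
Proof.
elim: n => [|n IH] /=.
  by split; [exact: measurable_cst|move=> x; rewrite lexx mulr_ge0].
have H := dominatorD psiC (dominatorZ th0 (dominatorD IH (dominator_conv IH))).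
split; first exact: H.1.
move=> x; rewrite (dominator_ge0 x H); apply: le_trans (dominator_le x H) _.
have : th * (2 * C + 2 * (2 * C)) <= 10^-1 * (2 * C + 2 * (2 * C)).
  by rewrite ler_wpM2r// addr_ge0// !mulr_ge0.
by move: C0 => X; lra.
Qed.

Lemma iter_dom_nd n x : iter_dom n x <= iter_dom n.+1 x.
Proof.
elim: n x => [|n IH] x; first exact: (dominator_ge0 x (iter_dom_dominator 1)).
rewrite [leLHS]/= [leRHS]/= lerD2l ler_wpM2l// lerD//.
exact: conv_mono (iter_dom_dominator n) (iter_dom_dominator n.+1) IH.
Qed.

Lemma sqint_iter_dom n : (sqint (iter_dom n) <= (4 * S)%:E)%E.
Proof.
have S0 : 0 <= S by rewrite -lee_fin (le_trans (sqint_ge0 psi)).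
elim: n => [|n IH].
  rewrite /sqint; under eq_integral do rewrite /= expr0n/=.
  by rewrite integral0 lee_fin mulr_ge0.
have D := iter_dom_dominator n; have D' := dominator_conv D.
have H := sqintD_le psiC.1 (dominatorZ th0 (dominatorD D D')).1 psiS
  (sqintZ_le th (dominatorD D D').1 (sqintD_le D.1 D'.1 IH (sqint_conv_le D IH))).
apply: le_trans H _; rewrite lee_fin.
(* The bound reached so far is [2 S + 80 th ^ 2 S]. *)
have th2 : th ^+ 2 <= 100^-1.
  by have : th * th <= 10^-1 * 10^-1 by [exact: ler_pM]; rewrite expr2; lra.
have : th ^+ 2 * S <= 100^-1 * S by rewrite ler_wpM2r.
by lra.
Qed.

Let err n : R := (3 * th) ^+ n * b0.

Lemma Dom_iter_dom n : Dom (fun x => iter_dom n x + err n).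
Proof.
have err0 k : 0 <= err k by rewrite mulr_ge0// exprn_ge0// mulr_ge0.
have errC k : dominator (err k) (fun=> err k).
  by split; [exact: measurable_cst|move=> x; rewrite err0 lexx].
elim: n => [|n IH].
  by apply: Dom_mono Dom_start => x; rewrite /err expr0 mul1r add0r.
have D := iter_dom_dominator n.
apply: Dom_mono (Dom_step (dominatorD D (errC n)) IH) => x /=.
rewrite (convD _ D (errC n)) conv_cst.
by rewrite le_eqVlt; apply/orP; left; apply/eqP; rewrite /err exprS; ring.
Qed.

(** The known majorant [b0] is constant and so not square integrable on the line; the iteration
    trades it for one that is. The iterates increase, hence their limit inherits the L^2 bound by
    monotone convergence, and [Dom_inf] removes the vanishing errors. *)
Lemma dominator_iteration : exists a : R -> R,
  [/\ dominator (2 * C) a, Dom a & (sqint a <= (4 * S)%:E)%E].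
Proof.
have nd x : nondecreasing_seq (iter_dom ^~ x).
  by apply/nondecreasing_seqP => n; exact: iter_dom_nd.
have ub x n : iter_dom n x <= 2 * C by exact: dominator_le (iter_dom_dominator n).
have cv x : cvgn (iter_dom ^~ x).
  apply: nondecreasing_is_cvgn => //; exists (2 * C) => _ [n _ <-]; exact: ub.
pose a x := limn (iter_dom ^~ x).
have ma : measurable_fun setT a.
  apply: (measurable_fun_cvg (h := iter_dom)).
    by move=> n; exact: (iter_dom_dominator n).1.
  by move=> x _; exact: cv.
have le_a n x : iter_dom n x <= a x by exact: nondecreasing_cvgn_le (nd x) (cv x) n.
exists a; split.
- split => // x; rewrite (le_trans _ (le_a 0%N x))//=.
  by apply: limr_le; [exact: cv|apply: nearW => n; exact: ub].
- apply: Dom_inf => e e0.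
  have [n ne] : exists n, err n <= e.
    have h1 : `|3 * th| < 1.
      by rewrite ger0_norm ?mulr_ge0//; move: th1 => X; lra.
    have /cvgrPdist_le/(_ e e0) : err n @[n --> \oo] --> 0.
      by rewrite -(mul0r b0); apply: cvgMl; exact: cvg_expr.
    move=> [n _ /(_ n (leqnn n))]; rewrite sub0r normrN => H; exists n.
    by apply: le_trans H; exact: ler_norm.
  by apply: Dom_mono (Dom_iter_dom n) => x; rewrite lerD.
- have E : sqint a = limn (fun n => sqint (iter_dom n)).
    rewrite /sqint -monotone_convergence//.
    + apply: eq_integral => x _; apply/esym/cvg_lim => //.
      apply: cvg_EFin; first exact: nearW.
      rewrite (_ : _ \o _ = (fun n => iter_dom n x * iter_dom n x)); last by [].
      by rewrite expr2; apply: cvgM; exact: cv.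
    + by move=> n; apply: measurable_sq; exact: (iter_dom_dominator n).1.
    + by move=> n x _; rewrite lee_fin sqr_ge0.
    + move=> x _ n m nm; rewrite lee_fin lerXn2r ?nnegrE ?(dominator_ge0 _ (iter_dom_dominator _))//.
      exact: nd.
  rewrite E; apply: lime_le; last by apply: nearW => n; exact: sqint_iter_dom.
  apply: ereal_nondecreasing_is_cvgn => n m nm.
  apply: sqint_le; [exact: (iter_dom_dominator n).1|exact: (iter_dom_dominator m).1|].
  apply: aeW => x; rewrite ger0_norm ?(dominator_ge0 _ (iter_dom_dominator _))//.
  exact: nd.
Qed.

End DominatorIteration.

(** * Time integral of the convolution over labels of which one has stopped *)

Section ConvolutionInTime.
Variable R : realType.
Local Notation mu := (@lebesgue_measure R).
Local Notation RM := (measurableTypeR R).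
Implicit Types (x s t T : R).
Variables (T : R) (a a' : R -> R).
Hypotheses (T0 : 0 <= T) (ma : measurable_fun setT a) (ma' : measurable_fun setT a')
  (aT : forall x, 0 <= a x <= T) (aT' : forall x, 0 <= a' x <= T).

Definition one_stopped s x : R := `|until (a x) s - until (a' x) s|.

Lemma one_stopped01 s x : 0 <= one_stopped s x <= 1.
Proof.
rewrite /one_stopped normr_ge0 /until; case: ifP; case: ifP => _ _;
  rewrite ?subrr ?sub0r ?subr0 ?normrN ?normr0 ?normr1 ?lexx ?ler01//.
Qed.

Lemma one_stoppedE s x : one_stopped s x =
  \1_`[Order.min (a x) (a' x), Order.max (a x) (a' x)[ s.
Proof.
rewrite /one_stopped indicE /until.
have [aa|aa] := leP (a x) (a' x).
  have [sa|as_] := ltP s (a x).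
    by rewrite (lt_le_trans sa aa) subrr normr0 memNset//= in_itv/= leNgt sa.
  have [sa'|as'] := ltP s (a' x).
    by rewrite sub0r normrN normr1 mem_set//= in_itv/= as_ sa'.
  by rewrite subrr normr0 memNset//= in_itv/= as_ ltNge as'.
have [sa'|as'] := ltP s (a' x).
  by rewrite (lt_trans sa' aa) subrr normr0 memNset//= in_itv/= leNgt sa'.
have [sa|as_] := ltP s (a x).
  by rewrite subr0 normr1 mem_set//= in_itv/= as' sa.
by rewrite subrr normr0 memNset//= in_itv/= as' ltNge as_.
Qed.

Lemma measurable_until2 (b : R -> R) : measurable_fun setT b ->
  measurable_fun [set: RM * RM] (fun z : RM * RM => until (b z.2) z.1).
Proof.
move=> mb; rewrite /until; apply: measurable_fun_ifT.
- apply: measurable_fun_ltr; first exact: measurable_fst.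
  by apply: measurableT_comp => //; exact: measurable_snd.
- exact: measurable_cst.
- exact: measurable_cst.
Qed.

Lemma measurable_one_stopped2 :
  measurable_fun [set: RM * RM] (fun z : RM * RM => one_stopped z.1 z.2).
Proof.
apply: measurableT_comp; first exact: normr_measurable.
by apply: measurable_funB; exact: measurable_until2.
Qed.

Lemma one_stopped_dominator s : dominator 1 (one_stopped s).
Proof.
split; last exact: one_stopped01.
apply: measurableT_comp; first exact: normr_measurable.
by apply: measurable_funB; apply: measurable_fun_ifT => //; apply: measurable_fun_ltr.
Qed.

Lemma integral_one_stopped x : (\int[mu]_s (one_stopped s x)%:E = (`|a x - a' x|)%:E)%E.
Proof.
under eq_integral do rewrite one_stoppedE.
have muE : mu `[Order.min (a x) (a' x), Order.max (a x) (a' x)[ = (`|a x - a' x|)%:E.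
  rewrite lebesgue_measure_itv/= lte_fin.
  have [aa|aa] := leP (a x) (a' x).
    rewrite distrC ger0_norm ?subr_ge0//; move: aa; rewrite le_eqVlt => /predU1P[->|->].
      by rewrite ltxx subrr.
    by rewrite EFinB.
  by rewrite aa ger0_norm ?subr_ge0 ?(ltW aa)// EFinB.
by rewrite integral_indic// setIT; exact: muE.
Qed.

Lemma conv_one_stopped_out s x : ~ `[0, T]%classic s -> conv (one_stopped s) x = 0.
Proof.
move=> nsT; rewrite /conv -[RHS](mul0r (fine (mu setT))).
rewrite (_ : (fun _ => _) = cst 0).
  by rewrite /Rintegral; under eq_integral do rewrite /=; rewrite integral0 mul0r.
apply/funext => y; rewrite one_stoppedE indicE memNset ?mulr0//= in_itv/=.
move=> /andP[]; rewrite ge_min lt_max; have /andP[a0 aT0] := aT y; have /andP[a0' aT0'] := aT' y.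
move=> H1 H2; apply: nsT; rewrite /= in_itv/=; apply/andP; split.
  by case/orP: H1; exact: le_trans.
by case/orP: H2 => /ltW/le_trans; apply.
Qed.

Definition conv_stopped_int x t := \int[mu]_(s in `[0, t]) conv (one_stopped s) x.

Lemma measurable_conv_one_stopped x : measurable_fun setT (fun s => conv (one_stopped s) x).
Proof.
apply/measurable_EFinP.
pose f (z : RM * RM) := (ek x z.2 * one_stopped z.1 z.2)%:E.
have -> : EFin \o (fun s => conv (one_stopped s) x) = fubini_F mu f.
  by apply/funext => s; rewrite /= -(convE x (one_stopped_dominator s)).
apply: (@measurable_fun_fubini_tonelli_F _ _ RM RM R mu f).
  apply/measurable_EFinP; apply: measurable_funM; last exact: measurable_one_stopped2.
  by apply: measurableT_comp; [exact: measurable_ek|exact: measurable_snd].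
by move=> z; rewrite lee_fin mulr_ge0 ?ek_ge0//; case/andP: (one_stopped01 z.1 z.2).
Qed.

Lemma prim_conv_stopped x : prim_on 0 T (conv_stopped_int x) (fun s => conv (one_stopped s) x).
Proof.
apply: integ_eq_prim_on => t /andP[t0 tT]; split.
  apply: measurable_bounded_integrable => //.
  - exact: compact_finite_measure (@segment_compact _ 0 t).
  - by apply: measurable_funS (measurable_conv_one_stopped x).
  - exists 2; split; first exact: num_real.
    move=> y y2 s _ /=; rewrite ger0_norm ?(conv_ge0 _ (one_stopped_dominator s))//.
    by apply: le_trans (conv_le _ (one_stopped_dominator s)) _; lra.
by rewrite /conv_stopped_int set_itv1 Rintegral_set1 subr0.
Qed.

(** Integrating in time first, by Tonelli, turns the indicator into the length of the gap. No factor
    [T] appears: this is the term that is not small in time. *)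
Lemma conv_stopped_intT x :
  conv_stopped_int x T - conv_stopped_int x 0 = conv (fun y => `|a y - a' y|) x.
Proof.
rewrite {2}/conv_stopped_int set_itv1 Rintegral_set1 subr0 /conv_stopped_int.
rewrite Rintegral_mkcond.
(* Both stopping times lie in [0, T], so the integrand vanishes elsewhere and the integral extends
   to the whole line. *)
rewrite (_ : _ \_ _ = fun s => conv (one_stopped s) x); last first.
  apply/funext => s; rewrite patchE; case: ifPn => // /negP nsT.
  by rewrite conv_one_stopped_out// => sT; apply: nsT; rewrite inE.
rewrite /Rintegral /conv /Rintegral; congr fine.
pose f (z : RM * RM) := (ek x z.2 * one_stopped z.1 z.2)%:E.
transitivity (\int[mu]_s \int[mu]_y f (s, y))%E.
  by apply: eq_integral => s _; rewrite (convE x (one_stopped_dominator s)).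
transitivity (\int[mu]_y \int[mu]_s f (s, y))%E.
  apply: (@fubini_tonelli _ _ RM RM R mu mu f).
    apply/measurable_EFinP; apply: measurable_funM; last exact: measurable_one_stopped2.
    by apply: measurableT_comp; [exact: measurable_ek|exact: measurable_snd].
  by move=> z; rewrite lee_fin mulr_ge0 ?ek_ge0//; case/andP: (one_stopped01 z.1 z.2).
apply: eq_integral => y _; rewrite /f /=.
under eq_integral do rewrite EFinM.
rewrite ge0_integralZl_EFin ?ek_ge0//.
- by rewrite integral_one_stopped.
- by move=> s _; rewrite lee_fin; case/andP: (one_stopped01 s y).
- apply/measurable_EFinP; apply: measurableT_comp; first exact: normr_measurable.
  by apply: measurable_funB; apply: measurable_fun_ifT => //; apply: measurable_fun_ltr.
Qed.

End ConvolutionInTime.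

(** * Uniform and Lipschitz bounds of the cutoff *)

Section CutoffBounds.
Variable R : realType.
Implicit Types (chi : R -> R) (x y A L : R).

Record cutoff_bounds A chi : Prop := CutoffBounds {
  cut0 : forall x, `|chi x| <= A;
  cut1 : forall x, `|derive1n 1 chi x| <= A;
  cut2 : forall x, `|derive1n 2 chi x| <= A;
  cutL0 : forall x y, `|chi x - chi y| <= A * `|x - y|;
  cutL1 : forall x y, `|derive1n 1 chi x - derive1n 1 chi y| <= A * `|x - y|;
  cutL2 : forall x y, `|derive1n 2 chi x - derive1n 2 chi y| <= A * `|x - y|;
  cut1_out : forall x, ~~ (0 <= x <= 1) -> derive1n 1 chi x = 0;
  cut2_out : forall x, ~~ (0 <= x <= 1) -> derive1n 2 chi x = 0;
  cut0_l : forall x, x <= 0 -> chi x = 0;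
  cut0_r : forall x, 1 <= x -> chi x = 1;
  cut_m0 : measurable_fun setT chi;
  cut_m1 : measurable_fun setT (derive1n 1 chi);
  cut_m2 : measurable_fun setT (derive1n 2 chi) }.

Lemma cutoff_bounds_weaken A A' chi : A <= A' -> cutoff_bounds A chi -> cutoff_bounds A' chi.
Proof.
move=> AA [H0 H1 H2 L0 L1 L2 H3 H4 H5 H6 H7 H8 H9]; split=> //.
- by move=> x; exact: le_trans (H0 x) AA.
- by move=> x; exact: le_trans (H1 x) AA.
- by move=> x; exact: le_trans (H2 x) AA.
- by move=> x y; apply: le_trans (L0 x y) _; rewrite ler_wpM2r.
- by move=> x y; apply: le_trans (L1 x y) _; rewrite ler_wpM2r.
- by move=> x y; apply: le_trans (L2 x y) _; rewrite ler_wpM2r.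
Qed.

Lemma lipschitz_of_derive1_le A (f : R -> R) : (forall x, derivable f x 1) ->
  (forall x, `|f^`()%classic x| <= A) -> forall x y, `|f x - f y| <= A * `|x - y|.
Proof.
move=> df fA x y; wlog xy : x y / y <= x.
  move=> H; have [/H //|/ltW/H] := leP y x.
  by rewrite distrC (distrC y).
have [||c _ ->] := @MVT_segment R f (f^`()%classic) y x xy.
- by move=> z _; split; [exact: df|rewrite derive1E].
- by apply: derivable_within_continuous => z _; exact: df.
by rewrite normrM ler_wpM2r.
Qed.

(** The derivatives are continuous and vanish off [0, 1], hence bounded. The Lipschitz constant of
    the second one requires the third, whence four summands in the constant. *)
Lemma admissible_cutoff_bounds chi : admissible_chi chi ->
  exists A, 1 <= A /\ cutoff_bounds A chi.
Proof.
move=> [dchi [_ [chil chir]]].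
have cchi n : continuous (derive1n n chi).
  by move=> x; apply: differentiable_continuous; apply/derivable1_diffP; exact: dchi.
have zl n x : x < 0 -> derive1n n chi x = 0.
  elim: n x => [x /ltW/chil //|n IH x x0].
  rewrite derive1nS derive1E (near_eq_derive (g := cst (0 : R))) ?derive_cst//.
  by near=> y; apply: IH; near: y; exact: lt_nbhsl.
have zr n x : 1 < x -> derive1n n.+1 chi x = 0.
  elim: n x => [x x1|n IH x x1].
    rewrite derive1nS derive1E (near_eq_derive (g := cst (1 : R))) ?derive_cst//.
    by near=> y; apply: chir; apply: ltW; near: y; exact: lt_nbhsr.
  rewrite derive1nS derive1E (near_eq_derive (g := cst (0 : R))) ?derive_cst//.
  by near=> y; apply: IH; near: y; exact: lt_nbhsr.
have bd (f : R -> R) : continuous f -> (forall x, x < 0 -> f x = 0) ->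
    (forall x, 1 < x -> `|f x| <= 1) -> exists2 A, 1 <= A & forall x, `|f x| <= A.
  move=> cf fl fr.
  have cn : {within `[0, 1], continuous (fun x => `|f x|)}.
    apply: continuous_subspaceT => x; apply: continuous_comp; first exact: cf.
    exact: norm_continuous.
  have [c _ fc] := EVT_max ler01 cn.
  exists (1 + `|f c|); first by rewrite lerDl.
  move=> x; have [x0|x0] := ltP x 0; first by rewrite fl// normr0 addr_ge0.
  have [x1|x1] := ltP 1 x; first by apply: le_trans (fr x x1) _; rewrite lerDl.
  by apply: le_trans (fc x _) _; rewrite ?in_itv/= ?x0 ?x1// lerDr.
have [A0 A01 H0] : exists2 A, 1 <= A & forall x, `|chi x| <= A.
  by apply: bd; [exact: (cchi 0%N)|move=> x /ltW; exact: chil|move=> x /ltW/chir ->; rewrite normr1].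
have H n : exists2 A, 1 <= A & forall x, `|derive1n n.+1 chi x| <= A.
  by apply: bd => // x x1; [exact: zl|rewrite zr// normr0].
have [A1 A11 H1] := H 0%N; have [A2 A21 H2] := H 1%N; have [A3 A31 H3] := H 2%N.
exists (A0 + A1 + A2 + A3); split; first by lra.
have out x : ~~ (0 <= x <= 1) -> x < 0 \/ 1 < x.
  by case/nandP; rewrite -ltNge => ?; [left|right].
have W f x A : `|f x| <= A -> A <= A0 + A1 + A2 + A3 -> `|f x : R| <= A0 + A1 + A2 + A3 by exact: le_trans.
have Lp n A : (forall x, `|derive1n n.+1 chi x| <= A) -> A <= A0 + A1 + A2 + A3 ->
    forall x y, `|derive1n n chi x - derive1n n chi y| <= (A0 + A1 + A2 + A3) * `|x - y|.
  move=> HA AA x y; apply: (@lipschitz_of_derive1_le _ (derive1n n chi)); first exact: dchi.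
  by move=> z; apply: le_trans AA; exact: HA.
split => //.
- by move=> x; apply: W (H0 x) _; lra.
- by move=> x; apply: W (H1 x) _; lra.
- by move=> x; apply: W (H2 x) _; lra.
- by apply: (Lp 0%N A1) => //; lra.
- by apply: (Lp 1%N A2) => //; lra.
- by apply: (Lp 2%N A3) => //; lra.
- by move=> x /out[?|?]; [exact: zl|exact: zr].
- by move=> x /out[?|?]; [exact: zl|exact: zr].
- by apply: continuous_measurable_fun; exact: (cchi 0%N).
- by apply: continuous_measurable_fun; exact: (cchi 1%N).
- by apply: continuous_measurable_fun; exact: (cchi 2%N).
Unshelve. all: by end_near. Qed.

End CutoffBounds.

(** * Pointwise bounds of the densities F and G *)

Section SourceBounds.
Variables (R : realType) (chi : R -> R) (A : R).
Hypotheses (cut : cutoff_bounds A chi) (A1 : 1 <= A).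
Local Notation chi1 := (derive1n 1 chi).
Local Notation chi2 := (derive1n 2 chi).
Implicit Types (X Y : state R) (x xi eta N Phi Z : R).

Let A0 : 0 <= A := le_trans ler01 A1.

(** Two sizes are needed: [A] bounds every unknown, while [N], later square integrable in the label,
    bounds those that decay. [zeta] is only bounded and [q] tends to be near 1, so neither is
    bounded by [N]. *)
Record pt_bound N X xi : Prop := PtBound {
  pb_zeta : `|zeta X xi| <= A;
  pb_U : `|Ubar X xi| <= A;
  pb_q : `|qq X xi| <= A;
  pb_w : `|ww X xi| <= A;
  pb_h : `|hh X xi| <= A;
  pb_r : `|rbar X xi| <= A;
  pb_UN : `|Ubar X xi| <= N;
  pb_wN : `|ww X xi| <= N;
  pb_hN : `|hh X xi| <= N;
  pb_rN : `|rbar X xi| <= N }.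

(** As in the V norm, the difference of [zeta] is measured uniformly and the others in L^2: [Z] will
    be independent of the label, [Phi] a function of it. *)
Record pt_diff Z Phi X Y xi : Prop := PtDiff {
  pd_zeta : `|zeta X xi - zeta Y xi| <= Z;
  pd_U : `|Ubar X xi - Ubar Y xi| <= Phi;
  pd_q : `|qq X xi - qq Y xi| <= Phi;
  pd_w : `|ww X xi - ww Y xi| <= Phi;
  pd_h : `|hh X xi - hh Y xi| <= Phi;
  pd_r : `|rbar X xi - rbar Y xi| <= Phi }.

(* Where it vanishes, [|zeta| <= A] puts [y] outside [0, 1], so [chi'(y) = 0]. *)
Definition core xi : R := if `|xi| <= A + 1 then 1 else 0.

Lemma core01 xi : 0 <= core xi <= 1.
Proof. by rewrite /core; case: ifP; rewrite lexx ler01. Qed.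

Lemma core_ge0 xi : 0 <= core xi. Proof. by case/andP: (core01 xi). Qed.

Lemma core_out N X xi : pt_bound N X xi -> core xi = 0 -> ~~ (0 <= yy X xi <= 1).
Proof.
move=> pb; rewrite /core; case: ifPn; first by move=> _ /eqP; rewrite oner_eq0.
rewrite -ltNge => H _; apply/negP => /andP[y0 y1]; move: H; rewrite ltNge => /negP; apply.
have -> : xi = yy X xi - zeta X xi by rewrite /yy; ring.
by rewrite (addrC A); apply: normrB_le; [rewrite ger0_norm|exact: pb_zeta pb].
Qed.

Lemma Apow n : 1 <= A ^+ n. Proof. exact: exprn_ege1. Qed.
Lemma Apow_le n p : (n <= p)%N -> A ^+ n <= A ^+ p.
Proof. by move=> np; rewrite ler_weXn2l. Qed.

Let E X xi : R := chi1 (yy X xi) ^+ 2 + chi (yy X xi) * chi2 (yy X xi).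

Let E_le X xi : `|E X xi| <= 2 * A ^+ 2.
Proof.
rewrite /E !expr2; have -> : 2 * (A * A) = A * A + A * A by ring.
apply: normrD_le; apply: normrM_le; [exact: cut1 cut _|exact: cut1 cut _|exact: cut0 cut _|exact: cut2 cut _].
Qed.

Lemma Gfun_core N X xi : pt_bound N X xi -> core xi = 0 -> Gfun chi X xi = 0.
Proof.
move=> pb /(core_out pb) out.
by rewrite /Gfun (cut1_out cut out) (cut2_out cut out) expr0n/= !mulr0 addr0 mulr0 mul0r.
Qed.

(** Linear in [N] because each term of F has a decaying factor: [Ubar], [h] or [rbar]. *)
Lemma Ffun_le N X xi : `|cc X| <= A -> `|kk X| <= A -> pt_bound N X xi ->
  `|Ffun chi X xi| <= 5 * A ^+ 3 * N.
Proof.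
move=> cA kA pb; have N0 : 0 <= N by exact: le_trans (pb_UN pb).
have H1 : `|2 * cc X| <= 2 * A by rewrite normrM ger0_norm// ler_wpM2l.
have T1 := normrM_le (normrM_le (normrM_le H1 (cut0 cut (yy X xi))) (pb_UN pb)) (pb_q pb).
have T2 := normrM_le (normrM_le (pb_U pb) (pb_UN pb)) (pb_q pb).
have T3 : `|hh X xi / 2| <= N.
  by rewrite normrM (ger0_norm (x := 2^-1)) ?invr_ge0//; have := pb_hN pb; move: N0; lra.
have T4 := normrM_le kA (pb_rN pb).
rewrite -expr2 in T2.
apply: le_trans (normrD_le (normrD_le (normrD_le T1 T2) T3) T4) _.
have X1 : N <= A ^+ 3 * N by rewrite ler_peMl// Apow.
have X2 : A ^+ 1 * N <= A ^+ 3 * N by rewrite ler_wpM2r// Apow_le.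
have X3 : A ^+ 2 * N <= A ^+ 3 * N by rewrite ler_wpM2r// Apow_le.
rewrite expr1 in X2.
rewrite [leLHS](_ : _ = 2 * (A ^+ 3 * N) + A ^+ 2 * N + N + A * N); last by ring.
by rewrite -mulrA; lra.
Qed.

Lemma Gfun_le N X xi : `|cc X| <= A -> pt_bound N X xi ->
  `|Gfun chi X xi| <= 4 * A ^+ 5 * core xi.
Proof.
move=> cA pb; have [c0|c0] := eqVneq (core xi) 0.
  by rewrite (Gfun_core pb c0) normr0 c0 mulr0.
have -> : core xi = 1 by move: c0; rewrite /core; case: ifP => //; rewrite eqxx.
have H1 : `|2 * cc X ^+ 2| <= 2 * A ^+ 2.
  by rewrite normrM ger0_norm// ler_wpM2l// expr2 expr2 normrM_le.
have := normrM_le (normrM_le H1 (E_le X xi)) (pb_q pb); rewrite /Gfun => /le_trans; apply.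
by rewrite le_eqVlt; apply/orP; left; apply/eqP; ring.
Qed.

Lemma Ffun_diff N N' Phi Z z0 X Y xi : 0 <= Z -> 0 <= z0 ->
  `|cc X| <= A -> `|kk X| <= A -> `|cc Y| <= A ->
  `|cc X - cc Y| <= z0 -> `|kk X - kk Y| <= z0 ->
  pt_bound N X xi -> pt_bound N' Y xi -> pt_diff Z Phi X Y xi ->
  `|Ffun chi X xi - Ffun chi Y xi| <= 9 * A ^+ 3 * Phi + 3 * A ^+ 3 * ((z0 + Z) * N').
Proof.
move=> Z0 z00 cA kA cA' dc dk pb pb' pd.
have N0 : 0 <= N' by exact: le_trans (pb_UN pb').
have P0 : 0 <= Phi by exact: le_trans (pd_U pd).
have H1 : `|2 * cc X| <= 2 * A by rewrite normrM ger0_norm// ler_wpM2l.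
have dH1 : `|2 * cc X - 2 * cc Y| <= 2 * z0 by rewrite -mulrBr normrM ger0_norm// ler_wpM2l.
have dchi : `|chi (yy X xi) - chi (yy Y xi)| <= A * Z.
  apply: le_trans (cutL0 cut _ _) _; rewrite ler_wpM2l//.
  by rewrite /yy opprD addrACA subrr add0r (pd_zeta pd).
have D1 := normr_mulB H1 (cut0 cut (yy Y xi)) dH1 dchi.
have D2 := normr_mulB (pb_U pb) (pb_q pb') (pd_U pd) (pd_q pd).
have B1 := normrM_le H1 (cut0 cut (yy X xi)).
have B2 := normrM_le (pb_UN pb') (pb_q pb').
have D3 := normr_mulB B1 B2 D1 D2.
have D4 := normr_mulB (pb_U pb) (normrM_le (pb_U pb') (pb_q pb')) (pd_U pd) D2.
have D5 : `|(hh X xi - hh Y xi) / 2| <= Phi.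
  by rewrite normrM (ger0_norm (x := 2^-1)) ?invr_ge0//; have := pd_h pd; move: P0; lra.
have D6 := normr_mulB kA (pb_rN pb') dk (pd_r pd).
set f := (X in `|X|).
have -> : f = (2 * cc X * chi (yy X xi) * (Ubar X xi * qq X xi) - 2 * cc Y * chi (yy Y xi) * (Ubar Y xi * qq Y xi))
  + (Ubar X xi * (Ubar X xi * qq X xi) - Ubar Y xi * (Ubar Y xi * qq Y xi))
  + (hh X xi - hh Y xi) / 2 + (kk X * rbar X xi - kk Y * rbar Y xi) by rewrite /f /Ffun; field.
apply: le_trans (normrD_le (normrD_le (normrD_le D3 D4) D5) D6) _.
have X1 : Phi <= A ^+ 3 * Phi by rewrite ler_peMl// Apow.
have X2 : A ^+ 1 * Phi <= A ^+ 3 * Phi by rewrite ler_wpM2r// Apow_le.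
have X3 : A ^+ 2 * Phi <= A ^+ 3 * Phi by rewrite ler_wpM2r// Apow_le.
rewrite expr1 in X2.
have ZN : 0 <= Z * N' by exact: mulr_ge0.
have zN : 0 <= z0 * N' by exact: mulr_ge0.
have Y1 : A ^+ 2 * (z0 * N') <= A ^+ 3 * (z0 * N') by rewrite ler_wpM2r// Apow_le.
have Y2 : z0 * N' <= A ^+ 3 * (z0 * N') by rewrite ler_peMl// Apow.
have Y3 : 0 <= A ^+ 3 * (Z * N') by rewrite mulr_ge0// exprn_ge0.
rewrite [leLHS](_ : _ = 4 * (A ^+ 3 * Phi) + 3 * (A ^+ 2 * Phi) + Phi + A * Phi
   + 2 * (A ^+ 3 * (Z * N')) + 2 * (A ^+ 2 * (z0 * N')) + z0 * N'); last by ring.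
rewrite [leRHS](_ : _ = 9 * (A ^+ 3 * Phi) + 3 * (A ^+ 3 * (z0 * N')) + 3 * (A ^+ 3 * (Z * N'))); last by ring.
by lra.
Qed.

Lemma Gfun_diff N N' Phi Z z0 X Y xi : 0 <= Z -> 0 <= z0 ->
  `|cc X| <= A -> `|cc Y| <= A -> `|cc X - cc Y| <= z0 ->
  pt_bound N X xi -> pt_bound N' Y xi -> pt_diff Z Phi X Y xi ->
  `|Gfun chi X xi - Gfun chi Y xi| <= 4 * A ^+ 4 * Phi + 8 * A ^+ 5 * ((z0 + Z) * core xi).
Proof.
move=> Z0 z00 cA cA' dc pb pb' pd.
have P0 : 0 <= Phi by exact: le_trans (pd_U pd).
have A40 : 0 <= A ^+ 4 * Phi by rewrite mulr_ge0// exprn_ge0.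
have [c0|c0] := eqVneq (core xi) 0.
  by rewrite (Gfun_core pb c0) (Gfun_core pb' c0) subrr normr0 c0 !mulr0 addr0 -mulrA mulr_ge0.
have -> : core xi = 1 by move: c0; rewrite /core; case: ifP => //; rewrite eqxx.
have dy : `|yy X xi - yy Y xi| <= Z.
  by rewrite /yy opprD addrACA subrr add0r (pd_zeta pd).
have L0 : `|chi (yy X xi) - chi (yy Y xi)| <= A * Z by apply: le_trans (cutL0 cut _ _) _; rewrite ler_wpM2l.
have L1 : `|chi1 (yy X xi) - chi1 (yy Y xi)| <= A * Z by apply: le_trans (cutL1 cut _ _) _; rewrite ler_wpM2l.
have L2 : `|chi2 (yy X xi) - chi2 (yy Y xi)| <= A * Z by apply: le_trans (cutL2 cut _ _) _; rewrite ler_wpM2l.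
have dE : `|E X xi - E Y xi| <= 4 * A ^+ 2 * Z.
  have D1 := normr_mulB (cut1 cut (yy X xi)) (cut1 cut (yy Y xi)) L1 L1.
  have D2 := normr_mulB (cut0 cut (yy X xi)) (cut2 cut (yy Y xi)) L0 L2.
  rewrite /E opprD addrACA; apply: le_trans (normrD_le D1 D2) _.
  by rewrite le_eqVlt; apply/orP; left; apply/eqP; ring.
have dcc := normr_mulB cA cA' dc dc.
have B1 := normrM_le cA cA.
have D3 := normr_mulB B1 (E_le Y xi) dcc dE.
have B3 := normrM_le B1 (E_le X xi).
have D4 := normr_mulB B3 (pb_q pb') D3 (pd_q pd).
have G W : Gfun chi W xi = 2 * (cc W * cc W * E W xi * qq W xi).
  by rewrite /Gfun -/(E W xi) (expr2 (cc W)) !mulrA.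
rewrite !G -mulrBr normrM (ger0_norm (x := 2))//.
apply: le_trans (ler_wpM2l _ D4) _ => //.
have Y1 : A ^+ 4 * z0 <= A ^+ 5 * z0 by rewrite ler_wpM2r// Apow_le.
by rewrite [leLHS](_ : _ = 4 * (A ^+ 4 * Phi) + 8 * (A ^+ 5 * Z) + 8 * (A ^+ 4 * z0)); [lra|ring].
Qed.

End SourceBounds.

(** * The nonlocal terms P and Q of one state *)

Section NonlocalTerms.
Variables (R : realType) (chi : R -> R) (A : R).
Hypotheses (cut : cutoff_bounds A chi) (A1 : 1 <= A).
Local Notation mu := (@lebesgue_measure R).
Local Notation chi1 := (derive1n 1 chi).
Local Notation coreA := (core A).
Implicit Types (X Y : state R) (x xi eta C Z s : R) (N Phi sigma : R -> R) (D : set R).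

Let A0 : 0 <= A := le_trans ler01 A1.

Record regular N X D : Prop := Regular {
  rg_mz : measurable_fun setT (zeta X);
  rg_mU : measurable_fun setT (Ubar X);
  rg_mq : measurable_fun setT (qq X);
  rg_mh : measurable_fun setT (hh X);
  rg_mr : measurable_fun setT (rbar X);
  rg_mD : measurable D;
  rg_c : `|cc X| <= A;
  rg_k : `|kk X| <= A;
  rg_ae : \forall eta \ae mu, pt_bound A (N eta) X eta }.

Definition kern X xi eta : R := expR (- `|yy X xi - yy X eta|).
(** With the indicator inside, the two integrals in P, and likewise in Q, become one integral over
    the line. *)
Definition src X D eta : R := \1_D eta * Ffun chi X eta + Gfun chi X eta.

(** Each [y] is within [A] of its label, so the kernel is compared with a fixed convolution kernel
    without any appeal to monotonicity of [y]. *)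
Lemma kern_le X xi eta : `|zeta X xi| <= A -> `|zeta X eta| <= A ->
  kern X xi eta <= expR (2 * A) * ek xi eta.
Proof.
move=> Hx Hy; rewrite /kern /ek -expRD ler_expR.
have : `|xi - eta| <= `|yy X xi - yy X eta| + (A + A).
  have -> : xi - eta = (yy X xi - yy X eta) - (zeta X xi - zeta X eta) by rewrite /yy; ring.
  by apply: normrB_le => //; exact: normrB_le.
by lra.
Qed.

Lemma expR_norm_diff (a b c : R) : expR (- a) <= c -> expR (- b) <= c ->
  `|expR (- a) - expR (- b)| <= c * `|a - b|.
Proof.
wlog ab : a b / a <= b.
  move=> H ac bc; have [/H|/ltW/H] := leP a b; first exact.
  by rewrite distrC (distrC a); exact.
move=> ac _; rewrite ger0_norm; last by rewrite subr_ge0 ler_expR lerN2.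
rewrite distrC ger0_norm ?subr_ge0//.
have -> : expR (- b) = expR (- a) * expR (a - b) by rewrite -expRD; congr expR; ring.
have H := expR_ge1Dx (a - b).
have H1 : expR (- a) * (1 + (a - b)) <= expR (- a) * expR (a - b) by rewrite ler_wpM2l// expR_ge0.
have H2 : expR (- a) * (b - a) <= c * (b - a) by rewrite ler_wpM2r// subr_ge0.
by lra.
Qed.

Lemma kern_diff Z X Y xi eta :
  `|zeta X xi| <= A -> `|zeta X eta| <= A -> `|zeta Y xi| <= A -> `|zeta Y eta| <= A ->
  `|zeta X xi - zeta Y xi| <= Z -> `|zeta X eta - zeta Y eta| <= Z ->
  `|kern X xi eta - kern Y xi eta| <= expR (2 * A) * ek xi eta * (2 * Z).
Proof.
move=> H1 H2 H3 H4 H5 H6.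
apply: le_trans (expR_norm_diff (kern_le H1 H2) (kern_le H3 H4)) _.
rewrite ler_wpM2l ?mulr_ge0 ?expR_ge0 ?ek_ge0//.
apply: le_trans (ler_dist_dist _ _) _.
have -> : yy X xi - yy X eta - (yy Y xi - yy Y eta) =
  (zeta X xi - zeta Y xi) - (zeta X eta - zeta Y eta) by rewrite /yy; ring.
by apply: le_trans (normrB_le H5 H6) _; lra.
Qed.

Section Measurability.
Variables (N : R -> R) (X : state R) (D : set R).
Hypothesis rg : regular N X D.

Lemma measurable_yy : measurable_fun setT (yy X).
Proof. by apply: measurable_funD; [exact: measurable_id|exact: rg_mz rg]. Qed.

Lemma measurable_kern xi : measurable_fun setT (kern X xi).
Proof.
apply: measurableT_comp; first exact: measurable_expR.
apply: measurableT_comp; first exact: oppr_measurable.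
apply: measurableT_comp; first exact: normr_measurable.
by apply: measurable_funB; [exact: measurable_cst|exact: measurable_yy].
Qed.

Let mcomp (f : R -> R) : measurable_fun setT f -> measurable_fun setT (fun eta => f (yy X eta)).
Proof. by move=> mf; apply: measurableT_comp => //; exact: measurable_yy. Qed.

Lemma measurable_Ffun : measurable_fun setT (Ffun chi X).
Proof.
apply: measurable_funD; last by apply: measurable_funM; [exact: measurable_cst|exact: rg_mr rg].
apply: measurable_funD; last by apply: measurable_funM; [exact: rg_mh rg|exact: measurable_cst].
apply: measurable_funD.
  apply: measurable_funM; last exact: rg_mq rg.
  apply: measurable_funM; last exact: rg_mU rg.
  by apply: measurable_funM; [exact: measurable_cst|exact: mcomp (cut_m0 cut)].
by apply: measurable_funM; [apply: measurable_funX; exact: rg_mU rg|exact: rg_mq rg].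
Qed.

Lemma measurable_Gfun : measurable_fun setT (Gfun chi X).
Proof.
apply: measurable_funM; last exact: rg_mq rg.
apply: measurable_funM; first exact: measurable_cst.
apply: measurable_funD; first by apply: measurable_funX; exact: mcomp (cut_m1 cut).
by apply: measurable_funM; [exact: mcomp (cut_m0 cut)|exact: mcomp (cut_m2 cut)].
Qed.

Lemma measurable_ind : measurable_fun setT (\1_D : R -> R).
Proof. exact: measurable_indic (rg_mD rg). Qed.

Lemma measurable_src : measurable_fun setT (src X D).
Proof.
apply: measurable_funD; last exact: measurable_Gfun.
by apply: measurable_funM; [exact: measurable_ind|exact: measurable_Ffun].
Qed.

End Measurability.

Lemma ind01 D x : 0 <= (\1_D x : R) <= 1.
Proof. by rewrite indicE; case: (x \in D); rewrite ?lexx ?ler01. Qed.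

Lemma dominator_core : dominator 1 coreA.
Proof.
split; last by move=> x; exact: core01.
rewrite /core; apply: measurable_fun_ifT => //.
by apply: measurable_fun_ler => //; exact: normr_measurable.
Qed.

Lemma measurable_sg_sub xi : measurable_fun setT (fun eta => Num.sg (xi - eta)).
Proof.
have E : (fun eta => Num.sg (xi - eta)) = (fun eta => if eta < xi then 1 else if xi < eta then -1 else 0).
  apply/funext => eta; have [h|h|->] := ltgtP eta xi.
  - by rewrite gtr0_sg// subr_gt0.
  - by rewrite ltr0_sg// subr_lt0.
  - by rewrite subrr sgr0.
rewrite E; apply: measurable_fun_ifT => //; first exact: measurable_fun_ltr.
by apply: measurable_fun_ifT => //; exact: measurable_fun_ltr.
Qed.

Section OneState.
Variables (N : R -> R) (CN : R) (X : state R) (D : set R) (sigma : R -> R) (xi : R).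
Hypotheses (domN : dominator CN N) (rg : regular N X D).
Hypotheses (msig : measurable_fun setT sigma) (sig1 : forall eta, `|sigma eta| <= 1)
  (zxi : `|zeta X xi| <= A).

Let W eta := N eta + coreA eta.
Let dW : dominator (CN + 1) W := dominatorD domN dominator_core.
Let c5 := 5 * A ^+ 5 * expR (2 * A).
Let c50 : 0 <= c5.
Proof. by rewrite mulr_ge0 ?expR_ge0// mulr_ge0// exprn_ge0. Qed.

Let part (f : R -> R) : measurable_fun setT f ->
  (forall eta, pt_bound A (N eta) X eta -> `|f eta| <= 5 * A ^+ 5 * W eta) ->
  mu.-integrable setT (EFin \o (fun eta => sigma eta * kern X xi eta * f eta)) /\
  `|\int[mu]_eta (sigma eta * kern X xi eta * f eta)| <= c5 * conv W xi.
Proof.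
move=> mf fle; apply: (norm_Rintegral_le_conv c50 dW).
  by apply: measurable_funM => //; apply: measurable_funM => //; exact: measurable_kern rg xi.
apply: aeS (rg_ae rg) _ => eta pb.
have K : `|kern X xi eta| <= expR (2 * A) * ek xi eta.
  by rewrite ger0_norm ?expR_ge0//; apply: kern_le => //; exact: pb_zeta pb.
apply: le_trans (normrM_le (normrM_le (sig1 eta) K) (fle _ pb)) _.
by rewrite /c5 le_eqVlt; apply/orP; left; apply/eqP; ring.
Qed.

Lemma src_le eta : pt_bound A (N eta) X eta -> `|src X D eta| <= 5 * A ^+ 5 * W eta.
Proof.
move=> pb; have F := Ffun_le cut A1 (rg_c rg) (rg_k rg) pb; have G := Gfun_le cut (rg_c rg) pb.
have I : `|\1_D eta : R| <= 1 by have /andP[a b] := ind01 D eta; rewrite ger0_norm.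
apply: le_trans (normrD_le (normrM_le I F) G) _; rewrite mul1r /W mulrDr.
have N0 : 0 <= N eta := dominator_ge0 eta domN; have c0 := core_ge0 A eta.
apply: lerD.
  by rewrite ler_wpM2r// ler_wpM2l// Apow_le.
by rewrite ler_wpM2r// ler_wpM2r ?exprn_ge0// ler_nat.
Qed.

Lemma int_src_le :
  mu.-integrable setT (EFin \o (fun eta => sigma eta * kern X xi eta * src X D eta)) /\
  `|\int[mu]_eta (sigma eta * kern X xi eta * src X D eta)| <= c5 * conv W xi.
Proof. by apply: part; [exact: measurable_src rg|exact: src_le]. Qed.

Lemma int_src_split :
  \int[mu]_(eta in D) (sigma eta * kern X xi eta * Ffun chi X eta) +
  \int[mu]_eta (sigma eta * kern X xi eta * Gfun chi X eta) =
  \int[mu]_eta (sigma eta * kern X xi eta * src X D eta).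
Proof.
have [IF _] : mu.-integrable setT (EFin \o (fun eta => sigma eta * kern X xi eta * (\1_D eta * Ffun chi X eta))) /\ `|\int[mu]_eta (sigma eta * kern X xi eta * (\1_D eta * Ffun chi X eta))| <= c5 * conv W xi.
  apply: part; first by apply: measurable_funM; [exact: measurable_ind rg|exact: measurable_Ffun rg].
  move=> eta pb; have F := Ffun_le cut A1 (rg_c rg) (rg_k rg) pb.
  have I : `|\1_D eta : R| <= 1 by have /andP[a b] := ind01 D eta; rewrite ger0_norm.
  apply: le_trans (normrM_le I F) _; rewrite mul1r.
  have N0 : 0 <= N eta := dominator_ge0 eta domN; have c0 := core_ge0 A eta.
  apply: ler_pM => //; first by rewrite mulr_ge0// exprn_ge0.
    by rewrite ler_wpM2l// Apow_le.
  by rewrite /W lerDl.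
have [IG _] : mu.-integrable setT (EFin \o (fun eta => sigma eta * kern X xi eta * Gfun chi X eta)) /\ `|\int[mu]_eta (sigma eta * kern X xi eta * Gfun chi X eta)| <= c5 * conv W xi.
  apply: part; first exact: measurable_Gfun rg.
  move=> eta pb; apply: le_trans (Gfun_le cut (rg_c rg) pb) _.
  have N0 : 0 <= N eta := dominator_ge0 eta domN; have c0 := core_ge0 A eta.
  apply: ler_pM => //; first by rewrite mulr_ge0// exprn_ge0.
    by rewrite ler_wpM2r ?exprn_ge0// ler_nat.
  by rewrite /W lerDr.
rewrite Rintegral_mkcond (_ : _ \_ D = fun eta => sigma eta * kern X xi eta * (\1_D eta * Ffun chi X eta)); last first.
  apply/funext => eta; rewrite patchE indicE; case: ifPn => _; first by rewrite mul1r.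
  by rewrite mul0r mulr0.
rewrite -RintegralD//; apply: eq_Rintegral => eta _.
by rewrite -mulrDr.
Qed.

End OneState.

Section PQ.
Variables (N : R -> R) (CN : R) (X : state R) (ta : R -> \bar R) (s : R) (xi : R).
Let D := [set eta | (s%:E < ta eta)%E].
Hypotheses (domN : dominator CN N) (rg : regular N X D) (zxi : `|zeta X xi| <= A).

Let one_le (eta : R) : `|1 : R| <= 1. Proof. by rewrite normr1. Qed.
Let sg_le (eta : R) : `|Num.sg (xi - eta)| <= 1.
Proof. by rewrite normr_sg; case: eqP. Qed.
Let msg := measurable_sg_sub xi.

Lemma PmUE : PmU chi ta s X xi = - 2 * cc X * chi (yy X xi) * Ubar X xi - Ubar X xi ^+ 2
  + (\int[mu]_eta (1 * kern X xi eta * src X D eta)) / 2.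
Proof.
rewrite /PmU -(int_src_split domN rg (measurable_cst _) one_le zxi) mulrDl addrA.
congr (_ + _ / 2 + _ / 2); apply: eq_Rintegral => eta _; by rewrite mul1r.
Qed.

Lemma QfunE : Qfun chi ta s X xi = 2 * cc X ^+ 2 * chi (yy X xi) * chi1 (yy X xi)
  - (\int[mu]_eta (Num.sg (xi - eta) * kern X xi eta * src X D eta)) / 2.
Proof.
by rewrite /Qfun -(int_src_split domN rg msg sg_le zxi) [X in _ = _ - X]mulrDl opprD addrA.
Qed.

Let c10 := 10 * A ^+ 5 * expR (2 * A).
Let W eta := N eta + coreA eta.
Let cW0 : 0 <= conv W xi.
Proof. exact: conv_ge0 (dominatorD domN dominator_core). Qed.
Let e1 : 1 <= expR (2 * A).
Proof. by rewrite -expR0 ler_expR mulr_ge0. Qed.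

Lemma PmU_le n : pt_bound A n X xi -> `|PmU chi ta s X xi| <= c10 * (n + conv W xi).
Proof.
move=> pb; rewrite PmUE.
have [_ I] := int_src_le domN rg (measurable_cst _) one_le zxi.
have n0 : 0 <= n by exact: le_trans (pb_UN pb).
have T1 : `|- 2 * cc X| <= 2 * A.
  by rewrite normrM normrN (ger0_norm (x := 2))// ler_wpM2l// (rg_c rg).
have T2 := normrM_le (normrM_le T1 (cut0 cut (yy X xi))) (pb_UN pb).
have T3 := normrM_le (pb_U pb) (pb_UN pb).
have T4 : `|(\int[mu]_eta (1 * kern X xi eta * src X D eta)) / 2| <= 5 * A ^+ 5 * expR (2 * A) * conv W xi.
  rewrite normrM (ger0_norm (x := 2^-1)) ?invr_ge0//.
  apply: le_trans (ler_piMr _ _) I => //; lra.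
rewrite expr2; apply: le_trans (normrD_le (normrB_le T2 T3) T4) _.
have X1 : A ^+ 2 * n <= A ^+ 5 * expR (2 * A) * n.
  rewrite ler_wpM2r//; apply: le_trans (Apow_le A1 (isT : 2 <= 5)%N) _.
  by rewrite ler_peMr// exprn_ge0.
have X2 : A ^+ 1 * n <= A ^+ 2 * n by rewrite ler_wpM2r// Apow_le.
have X3 : 0 <= A ^+ 5 * expR (2 * A) * conv W xi by rewrite !mulr_ge0 ?exprn_ge0 ?expR_ge0.
have X4 : 0 <= A ^+ 5 * expR (2 * A) * n by rewrite !mulr_ge0 ?exprn_ge0 ?expR_ge0.
rewrite expr1 in X2; rewrite /c10.
rewrite [leLHS](_ : _ = 2 * (A ^+ 2 * n) + A * n + 5 * (A ^+ 5 * expR (2 * A) * conv W xi)); last by ring.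
rewrite [leRHS](_ : _ = 10 * (A ^+ 5 * expR (2 * A) * n) + 10 * (A ^+ 5 * expR (2 * A) * conv W xi)); last by ring.
by lra.
Qed.

Lemma Qfun_le n : pt_bound A n X xi -> `|Qfun chi ta s X xi| <= c10 * (coreA xi + conv W xi).
Proof.
move=> pb; rewrite QfunE.
have [_ I] := int_src_le domN rg msg sg_le zxi.
have T4 : `|(\int[mu]_eta (Num.sg (xi - eta) * kern X xi eta * src X D eta)) / 2| <= 5 * A ^+ 5 * expR (2 * A) * conv W xi.
  rewrite normrM (ger0_norm (x := 2^-1)) ?invr_ge0//.
  apply: le_trans (ler_piMr _ _) I => //; lra.
have T1 : `|2 * cc X ^+ 2 * chi (yy X xi) * chi1 (yy X xi)| <= 2 * A ^+ 4 * coreA xi.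
  have [c0|c0] := eqVneq (coreA xi) 0.
    by rewrite (cut1_out cut (core_out pb c0)) mulr0 normr0 c0 mulr0.
  have -> : coreA xi = 1 by move: c0; rewrite /core; case: ifP => //; rewrite eqxx.
  have H1 : `|2 * cc X ^+ 2| <= 2 * A ^+ 2.
    by rewrite normrM ger0_norm// ler_wpM2l// expr2 expr2 normrM_le// (rg_c rg).
  apply: le_trans (normrM_le (normrM_le H1 (cut0 cut (yy X xi))) (cut1 cut (yy X xi))) _.
  by rewrite le_eqVlt; apply/orP; left; apply/eqP; ring.
apply: le_trans (normrB_le T1 T4) _.
have c0 := core_ge0 A xi.
have X1 : A ^+ 4 * coreA xi <= A ^+ 5 * expR (2 * A) * coreA xi.
  rewrite ler_wpM2r//; apply: le_trans (Apow_le A1 (isT : 4 <= 5)%N) _.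
  by rewrite ler_peMr// exprn_ge0.
have X3 : 0 <= A ^+ 5 * expR (2 * A) * conv W xi by rewrite !mulr_ge0 ?exprn_ge0 ?expR_ge0.
have X4 : 0 <= A ^+ 5 * expR (2 * A) * coreA xi by rewrite !mulr_ge0 ?exprn_ge0 ?expR_ge0.
rewrite /c10.
rewrite [leRHS](_ : _ = 10 * (A ^+ 5 * expR (2 * A) * coreA xi) + 10 * (A ^+ 5 * expR (2 * A) * conv W xi)); last by ring.
by rewrite -!(mulrA 5) -(mulrA 2); lra.
Qed.

End PQ.

End NonlocalTerms.

(** * Differences of P and Q between two states *)

Section NonlocalDifferences.
Variables (R : realType) (chi : R -> R) (A : R).
Hypotheses (cut : cutoff_bounds A chi) (A1 : 1 <= A).
Local Notation mu := (@lebesgue_measure R).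
Local Notation chi1 := (derive1n 1 chi).
Local Notation coreA := (core A).
Variables (N Phi : R -> R) (CN CP Z z0 : R) (X Y : state R) (ta ta' : R -> \bar R) (s : R).
Let D := [set eta | (s%:E < ta eta)%E].
Let D' := [set eta | (s%:E < ta' eta)%E].
Hypotheses (domN : dominator CN N) (domP : dominator CP Phi)
  (rg : regular A N X D) (rg' : regular A N Y D') (Z0 : 0 <= Z) (z00 : 0 <= z0)
  (dc : `|cc X - cc Y| <= z0) (dk : `|kk X - kk Y| <= z0)
  (pd : \forall eta \ae mu, pt_diff Z (Phi eta) X Y eta).
Implicit Types (eta xi : R).

Let A0 : 0 <= A := le_trans ler01 A1.

(** Differences of [c], [k] and [zeta] do not decay in the label, but they always multiply a density
    bounded by [N] or supported in the core. *)
Definition discrepancy eta : R := Phi eta + (z0 + Z) * (N eta + coreA eta).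
Definition set_discrepancy (E E' : set R) eta : R := `|\1_E eta - \1_E' eta|.

Let xD := set_discrepancy D D'.
Let H := discrepancy.

Lemma dominator_discrepancy : dominator (CP + (z0 + Z) * (CN + 1)) H.
Proof.
apply: dominatorD domP (dominatorZ _ (dominatorD domN (dominator_core A))).
exact: addr_ge0.
Qed.

Lemma dominator_set_discrepancy : dominator 1 xD.
Proof.
split.
  apply: measurableT_comp; first exact: normr_measurable.
  by apply: measurable_funB; [exact: measurable_ind rg|exact: measurable_ind rg'].
move=> x; rewrite /xD /set_discrepancy normr_ge0 !indicE.
by case: (x \in D); case: (x \in D');
  rewrite ?subrr ?sub0r ?subr0 ?normrN ?normr0 ?normr1 ?lexx ?ler01.
Qed.

Let H0 eta : 0 <= H eta := dominator_ge0 eta dominator_discrepancy.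
Let x0 eta : 0 <= xD eta := dominator_ge0 eta dominator_set_discrepancy.
Let N0 eta : 0 <= N eta := dominator_ge0 eta domN.
Let P0 eta : 0 <= Phi eta := dominator_ge0 eta domP.
Let c0 eta : 0 <= coreA eta := core_ge0 A eta.
Let A30 : 0 <= A ^+ 3. Proof. exact: exprn_ge0. Qed.
Let A50 : 0 <= A ^+ 5. Proof. exact: exprn_ge0. Qed.

Let zz : 0 <= z0 + Z. Proof. exact: addr_ge0. Qed.

Lemma src_diff eta : pt_bound A (N eta) X eta -> pt_bound A (N eta) Y eta ->
  pt_diff Z (Phi eta) X Y eta ->
  `|src chi X D eta - src chi Y D' eta| <= 13 * A ^+ 5 * (H eta + xD eta).
Proof.
move=> pb pb' pd'.
have dF := Ffun_diff cut A1 Z0 z00 (rg_c rg) (rg_k rg) (rg_c rg') dc dk pb pb' pd'.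
have dG := Gfun_diff cut A1 Z0 z00 (rg_c rg) (rg_c rg') dc pb pb' pd'.
have Q1 : 0 <= (z0 + Z) * N eta by exact: mulr_ge0.
have Q2 : 0 <= (z0 + Z) * coreA eta by exact: mulr_ge0.
have X1 : A ^+ 3 * Phi eta <= A ^+ 5 * Phi eta by rewrite ler_wpM2r// Apow_le.
have X2 : A ^+ 4 * Phi eta <= A ^+ 5 * Phi eta by rewrite ler_wpM2r// Apow_le.
have X3 : A ^+ 3 * ((z0 + Z) * N eta) <= A ^+ 5 * ((z0 + Z) * N eta) by rewrite ler_wpM2r// Apow_le.
have X4 : 0 <= A ^+ 5 * ((z0 + Z) * coreA eta) by rewrite mulr_ge0.
have X5 : 0 <= A ^+ 5 * Phi eta by rewrite mulr_ge0.
have X6 : 0 <= A ^+ 5 * ((z0 + Z) * N eta) by rewrite mulr_ge0.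
have RE : 13 * A ^+ 5 * (H eta + xD eta) = 13 * (A ^+ 5 * Phi eta) + 13 * (A ^+ 5 * ((z0 + Z) * N eta))
   + 13 * (A ^+ 5 * ((z0 + Z) * coreA eta)) + 13 * (A ^+ 5 * xD eta).
  by rewrite /H /discrepancy; ring.
(* Where exactly one label has stopped, F of the other is not small but bounded: with [A] in place
   of [N], it is charged to [xD]. *)
have Bd := fun W (p : pt_bound A (N eta) W eta) => @PtBound _ A A W eta (pb_zeta p) (pb_U p) (pb_q p) (pb_w p)
  (pb_h p) (pb_r p) (pb_U p) (pb_w p) (pb_h p) (pb_r p).
have F1 := Ffun_le cut A1 (rg_c rg) (rg_k rg) (Bd _ pb).
have F2 := Ffun_le cut A1 (rg_c rg') (rg_k rg') (Bd _ pb').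
have A4 : 5 * A ^+ 3 * A <= 5 * A ^+ 5.
  by rewrite -mulrA -exprSr ler_wpM2l// Apow_le.
rewrite RE /src /xD /set_discrepancy !indicE.
case: (eta \in D); case: (eta \in D') => /=.
- rewrite !mul1r subrr normr0 opprD addrACA.
  by apply: le_trans (normrD_le dF dG) _; rewrite -!mulrA; lra.
- rewrite mul1r mul0r add0r subr0 normr1 -addrA.
  by apply: le_trans (normrD_le F1 dG) _; rewrite -!mulrA in A4 *; move: A50 => A50'; lra.
- rewrite mul1r mul0r add0r sub0r normrN normr1 opprD addrCA.
  rewrite -normrN in F2.
  by apply: le_trans (normrD_le F2 dG) _; rewrite -!mulrA in A4 *; move: A50 => A50'; lra.
- rewrite subrr normr0 !mul0r !add0r; apply: le_trans dG _; rewrite -!mulrA mulr0; lra.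
Qed.

Section AtPoint.
Variables (sigma : R -> R) (xi : R).
Hypotheses (msig : measurable_fun setT sigma) (sig1 : forall eta, `|sigma eta| <= 1)
  (zX : `|zeta X xi| <= A) (zY : `|zeta Y xi| <= A) (dz : `|zeta X xi - zeta Y xi| <= Z).

(** Of the constant 23, the densities contribute 13 by [src_diff], and the kernels 10: their
    difference [2 * Z] against the bound 5 of a density. *)
Lemma int_src_diff :
  `|\int[mu]_eta (sigma eta * kern X xi eta * src chi X D eta)
    - \int[mu]_eta (sigma eta * kern Y xi eta * src chi Y D' eta)|
  <= 23 * A ^+ 5 * expR (2 * A) * conv (fun eta => H eta + xD eta) xi.
Proof.
have [I1 _] := int_src_le cut A1 domN rg msig sig1 zX.
have [I2 _] := int_src_le cut A1 domN rg' msig sig1 zY.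
rewrite -RintegralB//.
have dHx := dominatorD dominator_discrepancy dominator_set_discrepancy.
have e0 : 0 <= expR (2 * A) by exact: expR_ge0.
have c23 : 0 <= 23 * A ^+ 5 * expR (2 * A) by rewrite !mulr_ge0.
apply: (proj2 (norm_Rintegral_le_conv c23 dHx _ _)).
  apply: measurable_funB.
    apply: measurable_funM; last exact: measurable_src cut _ _ _ rg.
    by apply: measurable_funM => //; exact: measurable_kern rg xi.
  apply: measurable_funM; last exact: measurable_src cut _ _ _ rg'.
  by apply: measurable_funM => //; exact: measurable_kern rg' xi.
apply: aeS (aeI (aeI (rg_ae rg) (rg_ae rg')) pd) _ => eta [[pb pb'] pd'].
have dS := src_diff pb pb' pd'.
have S' := src_le cut A1 domN rg' pb'.
have K := kern_le zX (pb_zeta pb).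
have dK := kern_diff zX (pb_zeta pb) zY (pb_zeta pb') dz (pd_zeta pd').
have K' : `|kern X xi eta| <= expR (2 * A) * ek xi eta by rewrite ger0_norm ?expR_ge0.
have M := normr_mulB K' S' dK dS.
have -> : sigma eta * kern X xi eta * src chi X D eta - sigma eta * kern Y xi eta * src chi Y D' eta
  = sigma eta * (kern X xi eta * src chi X D eta - kern Y xi eta * src chi Y D' eta) by ring.
apply: le_trans (normrM_le (sig1 eta) M) _; rewrite mul1r.
pose e := expR (2 * A) * ek xi eta.
have ee : 0 <= e by exact: mulr_ge0 e0 (ek_ge0 _ _).
have X1 : A ^+ 5 * e * (Z * (N eta + coreA eta)) <= A ^+ 5 * e * H eta.
  rewrite ler_wpM2l ?(mulr_ge0 A50 ee)// /H /discrepancy.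
  have : 0 <= z0 * (N eta + coreA eta) by rewrite mulr_ge0// addr_ge0.
  by have := P0 eta; lra.
have X2 : 0 <= A ^+ 5 * e * xD eta by exact: mulr_ge0 (mulr_ge0 A50 ee) _.
rewrite [leLHS](_ : _ = 13 * (A ^+ 5 * e * H eta) + 13 * (A ^+ 5 * e * xD eta)
   + 10 * (A ^+ 5 * e * (Z * (N eta + coreA eta)))); last by rewrite /e; ring.
rewrite [leRHS](_ : _ = 23 * (A ^+ 5 * e * H eta) + 23 * (A ^+ 5 * e * xD eta)); last by rewrite /e; ring.
by lra.
Qed.

End AtPoint.

Variable xi : R.
Hypotheses (pbX : pt_bound A (N xi) X xi) (pbY : pt_bound A (N xi) Y xi)
  (pdxi : pt_diff Z (Phi xi) X Y xi).
Let c40 := 40 * A ^+ 5 * expR (2 * A).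
Let G := conv (fun eta => H eta + xD eta) xi.
Let G0 : 0 <= G.
Proof. exact: conv_ge0 (dominatorD dominator_discrepancy dominator_set_discrepancy). Qed.
Let e1 : 1 <= expR (2 * A).
Proof. by rewrite -expR0 ler_expR mulr_ge0. Qed.
Let dy : `|yy X xi - yy Y xi| <= Z.
Proof. by rewrite /yy opprD addrACA subrr add0r (pd_zeta pdxi). Qed.

Let local_le (l x : R) : 0 <= x -> l <= 8 * A ^+ 4 * x ->
  l + (23 * A ^+ 5 * expR (2 * A) * G) / 2 <= c40 * (x + G).
Proof.
move=> x0' lH.
have X1 : A ^+ 4 * x <= A ^+ 5 * expR (2 * A) * x.
  rewrite ler_wpM2r//; apply: le_trans (Apow_le A1 (isT : 4 <= 5)%N) _.
  by rewrite ler_peMr.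
have X2 : 0 <= A ^+ 5 * expR (2 * A) * x by rewrite !mulr_ge0 ?expR_ge0.
have X3 : 0 <= A ^+ 5 * expR (2 * A) * G by rewrite !mulr_ge0 ?expR_ge0.
rewrite /c40 [leRHS](_ : _ = 40 * (A ^+ 5 * expR (2 * A) * x) + 40 * (A ^+ 5 * expR (2 * A) * G)); last by ring.
have Y1 : 8 * A ^+ 4 * x = 8 * (A ^+ 4 * x) by ring.
have Y2 : (23 * A ^+ 5 * expR (2 * A) * G) / 2 = 23 / 2 * (A ^+ 5 * expR (2 * A) * G) by field.
by rewrite Y2; rewrite Y1 in lH; lra.
Qed.

Lemma PmU_diff : `|PmU chi ta s X xi - PmU chi ta' s Y xi| <= c40 * (H xi + G).
Proof.
rewrite (PmUE cut A1 domN rg (pb_zeta pbX)) (PmUE cut A1 domN rg' (pb_zeta pbY)).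
have one_le (eta : R) : `|1 : R| <= 1 by rewrite normr1.
have I := int_src_diff (measurable_cst (1 : R)) one_le (pb_zeta pbX) (pb_zeta pbY) (pd_zeta pdxi).
clear one_le.
rewrite -/D -/D'; pose i1 := \int[mu]_eta (1 * kern X xi eta * src chi X D eta).
pose i2 := \int[mu]_eta (1 * kern Y xi eta * src chi Y D' eta); rewrite -/i1 -/i2.
have I2 : `|(i1 - i2) / 2| <= (23 * A ^+ 5 * expR (2 * A) * G) / 2.
  by rewrite normrM (ger0_norm (x := 2^-1)) ?invr_ge0// ler_wpM2r ?invr_ge0.
have H1 : `|2 * cc X| <= 2 * A by rewrite normrM ger0_norm// ler_wpM2l// (rg_c rg).
have dH1 : `|2 * cc X - 2 * cc Y| <= 2 * z0 by rewrite -mulrBr normrM ger0_norm// ler_wpM2l.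
have dchi : `|chi (yy X xi) - chi (yy Y xi)| <= A * Z.
  by apply: le_trans (cutL0 cut _ _) _; rewrite ler_wpM2l.
have D1 := normr_mulB H1 (cut0 cut (yy Y xi)) dH1 dchi.
have D2 := normr_mulB (normrM_le H1 (cut0 cut (yy X xi))) (pb_UN pbY) D1 (pd_U pdxi).
have D3 := normr_mulB (pb_U pbX) (pb_U pbY) (pd_U pdxi) (pd_U pdxi).
set l := (X in `|X|).
have -> : l = - (2 * cc X * chi (yy X xi) * Ubar X xi - 2 * cc Y * chi (yy Y xi) * Ubar Y xi)
   - (Ubar X xi * Ubar X xi - Ubar Y xi * Ubar Y xi) + (i1 - i2) / 2 by rewrite /l; field.
rewrite -normrN in D2; apply: le_trans (normrD_le (normrB_le D2 D3) I2) _.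
apply: local_le => //.
have Q1 : 0 <= Z * N xi by exact: mulr_ge0.
have Q2 : 0 <= z0 * N xi by exact: mulr_ge0.
have Q3 : 0 <= A ^+ 4 * ((z0 + Z) * coreA xi) by rewrite !mulr_ge0// exprn_ge0.
have X1 : A ^+ 2 * Phi xi <= A ^+ 4 * Phi xi by rewrite ler_wpM2r// Apow_le.
have X2 : A ^+ 1 * Phi xi <= A ^+ 4 * Phi xi by rewrite ler_wpM2r// Apow_le.
have X3 : A ^+ 2 * (Z * N xi) <= A ^+ 4 * (Z * N xi) by rewrite ler_wpM2r// Apow_le.
have X4 : A ^+ 1 * (z0 * N xi) <= A ^+ 4 * (z0 * N xi) by rewrite ler_wpM2r// Apow_le.
have X5 : 0 <= A ^+ 4 * Phi xi by rewrite mulr_ge0// exprn_ge0.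
have X6 : 0 <= A ^+ 4 * (Z * N xi) by rewrite mulr_ge0// exprn_ge0.
have X7 : 0 <= A ^+ 4 * (z0 * N xi) by rewrite mulr_ge0// exprn_ge0.
rewrite !expr1 in X2 X4.
rewrite [leLHS](_ : _ = 2 * (A ^+ 2 * Phi xi) + 2 * (A * Phi xi) + 2 * (A ^+ 2 * (Z * N xi)) + 2 * (A * (z0 * N xi))); last by ring.
rewrite [leRHS](_ : _ = 8 * (A ^+ 4 * Phi xi) + 8 * (A ^+ 4 * (Z * N xi)) + 8 * (A ^+ 4 * (z0 * N xi)) + 8 * (A ^+ 4 * ((z0 + Z) * coreA xi))); last by rewrite /H /discrepancy; ring.
by lra.
Qed.

(** Unlike for P, no pointwise [Phi xi] remains: the local part of Q is supported in the core and
    the rest is a convolution. Hence [U] and [zeta] are controlled uniformly by constants. *)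
Lemma Qfun_diff : `|Qfun chi ta s X xi - Qfun chi ta' s Y xi| <= c40 * ((z0 + Z) * coreA xi + G).
Proof.
rewrite (QfunE cut A1 domN rg (pb_zeta pbX)) (QfunE cut A1 domN rg' (pb_zeta pbY)).
have sg_le (eta : R) : `|Num.sg (xi - eta)| <= 1 by rewrite normr_sg; case: eqP.
have I := int_src_diff (measurable_sg_sub xi) sg_le (pb_zeta pbX) (pb_zeta pbY) (pd_zeta pdxi).
rewrite -/D -/D'; pose i1 := \int[mu]_eta (Num.sg (xi - eta) * kern X xi eta * src chi X D eta).
pose i2 := \int[mu]_eta (Num.sg (xi - eta) * kern Y xi eta * src chi Y D' eta); rewrite -/i1 -/i2.
have I2 : `|(i1 - i2) / 2| <= (23 * A ^+ 5 * expR (2 * A) * G) / 2.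
  by rewrite normrM (ger0_norm (x := 2^-1)) ?invr_ge0// ler_wpM2r ?invr_ge0.
pose f W := 2 * (cc W * cc W * (chi (yy W xi) * chi1 (yy W xi))).
have L : `|f X - f Y| <= 8 * A ^+ 4 * ((z0 + Z) * coreA xi).
  have [k0|k0] := eqVneq (coreA xi) 0.
    rewrite /f (cut1_out cut (core_out pbX k0)) (cut1_out cut (core_out pbY k0)) !mulr0 subrr normr0.
    by rewrite !mulr_ge0// exprn_ge0.
  have k1 : coreA xi = 1 by move: k0; rewrite /core; case: ifP => //; rewrite eqxx.
  have L0 : `|chi (yy X xi) - chi (yy Y xi)| <= A * Z by apply: le_trans (cutL0 cut _ _) _; rewrite ler_wpM2l.
  have L1 : `|chi1 (yy X xi) - chi1 (yy Y xi)| <= A * Z by apply: le_trans (cutL1 cut _ _) _; rewrite ler_wpM2l.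
  have D1 := normr_mulB (cut0 cut (yy X xi)) (cut1 cut (yy Y xi)) L0 L1.
  have D2 := normr_mulB (rg_c rg) (rg_c rg') dc dc.
  have D3 := normr_mulB (normrM_le (rg_c rg) (rg_c rg)) (normrM_le (cut0 cut (yy Y xi)) (cut1 cut (yy Y xi))) D2 D1.
  rewrite /f -mulrBr normrM (ger0_norm (x := 2))//.
  apply: le_trans (ler_wpM2l _ D3) _ => //.
  have Y1 : A ^+ 3 * z0 <= A ^+ 4 * z0 by rewrite ler_wpM2r// Apow_le.
  have Y2 : 0 <= A ^+ 4 * Z by rewrite mulr_ge0// exprn_ge0.
  have Y3 : 0 <= A ^+ 4 * z0 by rewrite mulr_ge0// exprn_ge0.
  rewrite k1.
  rewrite [leLHS](_ : _ = 4 * (A ^+ 4 * Z) + 4 * (A ^+ 3 * z0)); last by ring.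
  by rewrite -mulrA; lra.
set l := (X in `|X|).
have -> : l = (f X - f Y) - (i1 - i2) / 2 by rewrite /l /f; field.
by apply: le_trans (normrB_le L I2) _; apply: local_le => //; exact: mulr_ge0.
Qed.

End NonlocalDifferences.

(** * Norms, null sets and continuity in time *)

Section NormsAndAlmostEverywhere.
Variable R : realType.
Local Notation mu := (@lebesgue_measure R).
Implicit Types (f : R -> R) (C s t T : R).

Lemma lebesgue_setT_gt0 : (0 < mu setT)%E.
Proof.
apply: (@lt_le_trans _ _ (mu `[0, 1]%classic)).
  by rewrite lebesgue_measure_itv/= lte01 oppr0 adde0 lte01.
by apply: le_measure; rewrite ?inE.
Qed.

Lemma Linfnorm_leP f C : (Linfnorm f <= C%:E)%E <-> \forall x \ae mu, `|f x| <= C.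
Proof.
rewrite /Linfnorm unlock lebesgue_setT_gt0; split.
  by move/ess_supP => H; apply: aeS H _ => x; rewrite /= lee_fin.
by move=> H; apply/ess_supP; apply: aeS H _ => x; rewrite /= lee_fin.
Qed.

Lemma L2norm_leP f C : 0 <= C -> (L2norm f <= C%:E)%E <-> (sqint f <= (C ^+ 2)%:E)%E.
Proof.
move=> C0.
have N0 : (0 <= L2norm f)%E by exact: Lnorm_ge0.
have E : (L2norm f `^ 2 = sqint f)%E.
  rewrite /L2norm poweR_Lnorm//; apply: eq_integral => x _.
  have -> : (`|(EFin \o f) x| = (`|f x|)%:E)%E by [].
  by rewrite poweR_EFin powR_mulrn ?normr_ge0// real_normK ?num_real.
have C2 : (C%:E `^ 2 = (C ^+ 2)%:E)%E by rewrite poweR_EFin powR_mulrn.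
rewrite -E -C2; split => H.
  by apply: gt0_ler_poweR => //; rewrite in_itv/= ?N0 ?leey ?lee_fin ?C0.
rewrite leNgt; apply/negP => CN.
have N1 : L2norm f \is a fin_num.
  rewrite ge0_fin_numE//; apply: (@lty_poweRy _ _ 2) => //.
  by apply: le_lt_trans H _; rewrite C2 ltry.
move: CN N0 H; rewrite C2 -(fineK N1) lte_fin lee_fin poweR_EFin lee_fin => CN N0'; rewrite powR_mulrn//.
by rewrite leNgt ltrXn2r// nnegrE.
Qed.

(** Rational times and the two endpoints share one null set; continuity in time extends the bound
    from them to all times. *)
Lemma ae_all_times C T (g : R -> R -> R) : 0 < T ->
  (forall x, {within `[0, T], continuous (g ^~ x)}) ->
  (forall t, 0 <= t <= T -> \forall x \ae mu, `|g t x| <= C) ->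
  \forall x \ae mu, forall t, 0 <= t <= T -> `|g t x| <= C.
Proof.
move=> T0 cg gC.
pose P' (n : nat) x := match @unpickle rat n with
  | Some r => 0 <= (ratr r : R) <= T -> `|g (ratr r) x| <= C | None => True end.
have H : \forall x \ae mu, forall n, P' n x.
  apply: ae_foralln => n; rewrite /P'; case: unpickle => [r|]; last exact: aeW.
  have [rT|nrT] := boolP (0 <= (ratr r : R) <= T); last first.
    by apply: aeW => x H; case/negP: nrT.
  by apply: aeS (gC _ rT) _ => x H _.
have H0 := gC 0; have HT := gC T.
have {}H0 : \forall x \ae mu, `|g 0 x| <= C by apply: H0; rewrite lexx ltW.
have {}HT : \forall x \ae mu, `|g T x| <= C by apply: HT; rewrite lexx ltW.
apply: aeS (aeI H (aeI H0 HT)) _ => x [Hr [h0 hT]] t /andP[t0 tT].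
move: t0; rewrite le_eqVlt => /predU1P[<- //|t0].
move: tT; rewrite le_eqVlt => /predU1P[-> //|tT].
rewrite leNgt; apply/negP => Cg.
have [ci _ _] := (continuous_within_itvP _ T0).1 (cg x).
have ct : {for t, continuous (fun s => `|g s x|)}.
  by apply: continuous_comp; [apply: ci; rewrite in_itv/= t0|exact: norm_continuous].
have : \forall s \near t, C < `|g s x| by apply: (cvgr_gt _ ct).
move=> /nbhs_ballP[e /= e0 be].
have [r] : exists r : rat, (ratr r : R) \in `]Order.max 0 (t - e), t[.
  by apply: rat_in_itvoo; rewrite gt_max t0/= ltrBlDr ltrDl.
rewrite in_itv/= gt_max => /andP[/andP[r0 rte] rt].
have Hr' := Hr (pickle r); rewrite /P' pickleK in Hr'.
have : C < `|g (ratr r) x|.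
  by apply: be; rewrite /ball/= gtr0_norm ?subr_gt0// ltrBlDl -ltrBlDr.
rewrite ltNge => /negP; apply; apply: Hr'.
by rewrite (ltW r0) (ltW (lt_trans rt tT)).
Qed.

End NormsAndAlmostEverywhere.

(** * A solution as a family of stopped trajectories *)

Section SolutionTrajectories.
Variables (R : realType) (chi : R -> R) (X0 : state R) (X : R -> state R).
Hypothesis sol : is_solution chi X0 X.
Local Notation mu := (@lebesgue_measure R).
Implicit Types (s t T xi : R).

Lemma prim_on_ext_in (a b : R) (f g g' : R -> R) : (forall x, a <= x <= b -> g x = g' x) ->
  prim_on a b f g -> prim_on a b f g'.
Proof.
move=> gg H s t as_ st tb; have [i e] := H s t as_ st tb.
have E x : x \in `[s, t]%classic -> g x = g' x.
  by rewrite inE/= in_itv/= => /andP[sx xt]; apply: gg; rewrite (le_trans as_ sx) (le_trans xt tb).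
split; first by apply: eq_integrable i => // x /E/= ->.
by rewrite e; apply: eq_Rintegral.
Qed.

Let sol0 : X 0 = X0. Proof. by case: sol. Qed.

Lemma sol_cc t : 0 <= t -> cc (X t) = cc X0.
Proof. by case: sol => _ [_ [_ [H _]]] /H[]. Qed.

Lemma sol_kk t : 0 <= t -> kk (X t) = kk X0.
Proof. by case: sol => _ [_ [_ [H _]]] /H[]. Qed.

Lemma sol_inVbar t : 0 <= t -> inVbar (X t).
Proof. by case: sol => _ [+ _]; exact. Qed.

Lemma sol_eqs t xi : 0 <= t ->
  [/\ integ_eq (fun s => UU chi (X s) xi) t (yy (X t) xi - yy (X 0) xi),
      integ_eq (fun s => - Qfun chi (tau X) s (X s) xi) t (UU chi (X t) xi - UU chi (X 0) xi),
      integ_eq (fun s => ind (tau X) xi s * ww (X s) xi) t (qq (X t) xi - qq (X 0) xi) &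
      [/\ integ_eq (fun s => ind (tau X) xi s * (hh (X s) xi / 2
                 - PmU chi (tau X) s (X s) xi * qq (X s) xi + kk (X s) * rbar (X s) xi))
              t (ww (X t) xi - ww (X 0) xi),
      integ_eq (fun s => ind (tau X) xi s * (2 * (- PmU chi (tau X) s (X s) xi) * ww (X s) xi))
              t (hh (X t) xi - hh (X 0) xi) &
      integ_eq (fun s => - (ind (tau X) xi s * kk (X s) * ww (X s) xi))
              t (rbar (X t) xi - rbar (X 0) xi)]].
Proof.
by move=> t0; rewrite sol0; case: sol => _ [_ [_ [_ H]]]; have [? [? [? [? [? ?]]]]] := H t xi t0.
Qed.

Lemma sol_prim_y T xi : prim_on 0 T (fun t => yy (X t) xi) (fun s => UU chi (X s) xi).
Proof. by apply: integ_eq_prim_on => t /andP[t0 _]; case: (sol_eqs xi t0). Qed.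

Lemma sol_prim_U T xi :
  prim_on 0 T (fun t => UU chi (X t) xi) (fun s => - Qfun chi (tau X) s (X s) xi).
Proof. by apply: integ_eq_prim_on => t /andP[t0 _]; case: (sol_eqs xi t0). Qed.

Lemma sol_prim_q T xi :
  prim_on 0 T (fun t => qq (X t) xi) (fun s => ind (tau X) xi s * ww (X s) xi).
Proof. by apply: integ_eq_prim_on => t /andP[t0 _]; case: (sol_eqs xi t0). Qed.

Lemma sol_prim_w T xi : prim_on 0 T (fun t => ww (X t) xi)
  (fun s => ind (tau X) xi s * (hh (X s) xi / 2
     - PmU chi (tau X) s (X s) xi * qq (X s) xi + kk X0 * rbar (X s) xi)).
Proof.
apply: (prim_on_ext_in (g := fun s => ind (tau X) xi s * (hh (X s) xi / 2
     - PmU chi (tau X) s (X s) xi * qq (X s) xi + kk (X s) * rbar (X s) xi))).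
  by move=> s /andP[s0 _]; rewrite (sol_kk s0).
by apply: integ_eq_prim_on => t /andP[t0 _]; case: (sol_eqs xi t0) => _ _ _ [].
Qed.

Lemma sol_prim_h T xi : prim_on 0 T (fun t => hh (X t) xi)
  (fun s => ind (tau X) xi s * (2 * (- PmU chi (tau X) s (X s) xi) * ww (X s) xi)).
Proof. by apply: integ_eq_prim_on => t /andP[t0 _]; case: (sol_eqs xi t0) => _ _ _ []. Qed.

Lemma sol_prim_r T xi : prim_on 0 T (fun t => rbar (X t) xi)
  (fun s => - (ind (tau X) xi s * kk X0 * ww (X s) xi)).
Proof.
apply: (prim_on_ext_in (g := fun s => - (ind (tau X) xi s * kk (X s) * ww (X s) xi))).
  by move=> s /andP[s0 _]; rewrite (sol_kk s0).
by apply: integ_eq_prim_on => t /andP[t0 _]; case: (sol_eqs xi t0) => _ _ _ [].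
Qed.

Lemma tau_ge0 xi : (0 <= tau X xi)%E.
Proof.
rewrite /tau; case: ifP => // _; apply: ereal_sup_ubound; exists 0 => //.
by split => // t /andP[t0 t1]; have := le_lt_trans t0 t1; rewrite ltxx.
Qed.

Lemma tau_q_pos xi s : 0 <= s -> (s%:E < tau X xi)%E -> 0 < qq (X s) xi.
Proof.
rewrite /tau => s0; case: ifP => _; first by rewrite lte_fin ltNge s0.
move=> /ereal_sup_gt[_ [t [t0 H] <-]]; rewrite lte_fin => st.
by apply: H; rewrite s0.
Qed.

Lemma tau_q_nonpos xi : qq (X 0) xi <= 0 -> tau X xi = 0%E.
Proof.
move=> q0; apply/eqP; rewrite eq_le tau_ge0 andbT leNgt; apply/negP => t0.
by have := tau_q_pos (lexx 0) t0; rewrite ltNge q0.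
Qed.

(** By continuity a positive value would stay positive past the supremum, and a negative one would
    be preceded by a zero at an earlier time, where [q] is positive. *)
Lemma tau_stop xi s : 0 <= qq (X 0) xi -> tau X xi = s%:E -> qq (X s) xi = 0.
Proof.
move=> q0 ts; have s0 : 0 <= s by rewrite -lee_fin -ts tau_ge0.
move: (ts); rewrite /tau; case: ifPn => [/eqP q00 [<-] //|q00 tE].
have {}q0 : 0 < qq (X 0) xi by rewrite lt_neqAle eq_sym q00.
have [sn|sp|//] := ltgtP (qq (X s) xi) 0.
  have cq := prim_on_continuous s0 (@sol_prim_q s xi).
  have [] := IVT s0 cq (v := 0); first by rewrite ge_min (ltW sn) orbT le_max (ltW q0).
  move=> t; rewrite in_itv/= => /andP[t0 ts']; rewrite /= => qt.
  have tlt : t < s by rewrite lt_neqAle ts' andbT; apply/eqP => E; rewrite -E qt ltxx in sn.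
  by have := tau_q_pos t0 (_ : (t%:E < tau X xi)%E); rewrite ts lte_fin => /(_ tlt); rewrite qt ltxx.
have ss : s < s + 1 by rewrite ltrDl.
have cq := prim_on_continuous (ltW ss) (prim_on_sub s0 (lexx _) (@sol_prim_q (s + 1) xi)).
have [_ cr _] := (continuous_within_itvP _ ss).1 cq.
have : \forall t \near s^'+, 0 < qq (X t) xi by apply: (cvgr_gt _ cr).
move=> [e /= e0 be].
have : ((s + e)%:E <= tau X xi)%E.
  rewrite /tau (negbTE q00); apply: ereal_sup_ubound; exists (s + e) => //.
  split; first by rewrite addr_ge0// ltW.
  move=> t /andP[t0 te]; have [ts'|st|->//] := ltgtP t s.
    by apply: tau_q_pos => //; rewrite ts lte_fin.
  by apply: be => //=; rewrite distrC gtr0_norm ?subr_gt0// ltrBlDl.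
by rewrite ts lee_fin leNgt ltrDl e0.
Qed.

(** After [tau] the value of [q] is frozen and nonpositive. So the set of labels still moving at
    time [s] is a superlevel set of [q], and measurable. *)
Lemma tau_gtP xi s : 0 <= s -> (s%:E < tau X xi)%E = (0 < qq (X s) xi).
Proof.
move=> s0; apply/idP/idP; first exact: tau_q_pos.
apply: contraTT; rewrite -!leNgt => ts.
have [t tE] : exists t, tau X xi = t%:E.
  exists (fine (tau X xi)); rewrite fineK// ge0_fin_numE ?tau_ge0//.
  exact: le_lt_trans ts (ltry _).
have t0 : 0 <= t by rewrite -lee_fin -tE tau_ge0.
rewrite tE lee_fin in ts.
have -> : qq (X s) xi = qq (X t) xi.
  apply/eqP; rewrite -subr_eq0 -normr_le0 -[leRHS](mul0r (s - t)).
  apply: prim_on_lip (prim_on_sub t0 (lexx s) (@sol_prim_q s xi)) _ => // x /andP[tx _].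
  by rewrite /ind tE lte_fin ltNge (ltW tx)/= mul0r normr0.
have [q0|q0] := leP 0 (qq (X 0) xi); first by rewrite (tau_stop q0 tE).
have := tau_q_nonpos (ltW q0); rewrite tE => -[->]; exact: ltW.
Qed.

(** The cap makes the time real. It lies beyond [T], so that [stop_time <= T] still means a genuine
    stop by time [T]. *)
Definition stop_time T xi : R := fine (Order.min (tau X xi) (T + 1)%:E).

Section Stop.
Variable T : R.
Hypothesis T0 : 0 <= T.

Let T1 : 0 <= T + 1. Proof. by rewrite addr_ge0. Qed.

Lemma stop_timeE xi : (stop_time T xi)%:E = Order.min (tau X xi) (T + 1)%:E.
Proof.
rewrite /stop_time fineK// ge0_fin_numE; last by rewrite le_min tau_ge0 lee_fin.
by rewrite gt_min ltry orbT.
Qed.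

Lemma stop_time_ge0 xi : 0 <= stop_time T xi.
Proof. by rewrite -lee_fin stop_timeE le_min tau_ge0 lee_fin. Qed.

Lemma stop_time_gt xi s : s <= T -> (s < stop_time T xi) = (s%:E < tau X xi)%E.
Proof.
move=> sT; rewrite -lte_fin stop_timeE lt_min lte_fin.
by rewrite (le_lt_trans sT) ?ltrDl// andbT.
Qed.

Lemma ind_until xi s : s <= T -> ind (tau X) xi s = until (stop_time T xi) s.
Proof. by move=> sT; rewrite /ind /until stop_time_gt. Qed.

Lemma sol_trajectory xi : 0 <= qq (X 0) xi ->
  trajectory T (stop_time T xi) (kk X0) (fun t => qq (X t) xi) (fun t => ww (X t) xi)
    (fun t => hh (X t) xi) (fun t => rbar (X t) xi) (fun t => PmU chi (tau X) t (X t) xi).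
Proof.
move=> q0; split.
- exact: stop_time_ge0.
- by apply: prim_on_ext_in (@sol_prim_q T xi) => s /andP[_ sT]; rewrite ind_until.
- by apply: prim_on_ext_in (@sol_prim_w T xi) => s /andP[_ sT]; rewrite ind_until.
- by apply: prim_on_ext_in (@sol_prim_h T xi) => s /andP[_ sT]; rewrite ind_until.
- by apply: prim_on_ext_in (@sol_prim_r T xi) => s /andP[_ sT]; rewrite ind_until.
- by move=> s /andP[s0 sT]; rewrite stop_time_gt// => /(tau_q_pos s0).
- move=> aT; apply: tau_stop q0 _; rewrite stop_timeE.
  have [//|] := leP (tau X xi) (T + 1)%:E => /ltW tT.
  by move: aT; rewrite -lee_fin stop_timeE (min_r tT) lee_fin leNgt ltrDl ltr01.
Qed.

Lemma measurable_qq t : 0 <= t -> measurable_fun setT (qq (X t)).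
Proof.
move=> /sol_inVbar[_ [_ [[[mv _] _] _]]].
have -> : qq (X t) = (fun xi => vv (X t) xi + 1) by apply/funext => xi; rewrite /vv subrK.
exact: measurable_funD.
Qed.

Lemma measurable_tau_gt t : 0 <= t -> measurable [set xi : measurableTypeR R | (t%:E < tau X xi)%E].
Proof.
move=> t0.
have -> : [set xi : measurableTypeR R | (t%:E < tau X xi)%E] = qq (X t) @^-1` `]0, +oo[.
  by apply/seteqP; split => xi /=; rewrite in_itv/= andbT tau_gtP.
by rewrite -[X in measurable X]setTI; exact: (measurable_qq t0).
Qed.

Lemma measurable_stop_time : measurable_fun setT (fun xi => Order.min (stop_time T xi) T).
Proof.
apply: (measurability (@RGenOInfty.G R)); first exact: RGenOInfty.measurableE.
move=> _ [_ [x ->] <-]; rewrite setTI.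
have [xT|Tx] := ltP x T; last first.
  rewrite (_ : _ @^-1` _ = set0)//; apply/seteqP; split => // xi /=.
  by rewrite in_itv/= andbT lt_min => /andP[_]; rewrite ltNge Tx.
have [x0|x0] := ltP x 0.
  rewrite (_ : _ @^-1` _ = setT)//; apply/seteqP; split => // xi _ /=.
  by rewrite in_itv/= andbT lt_min xT andbT (lt_le_trans x0)// stop_time_ge0.
rewrite (_ : _ @^-1` _ = [set xi : measurableTypeR R | (x%:E < tau X xi)%E]); first exact: measurable_tau_gt.
by apply/seteqP; split => xi /=; rewrite in_itv/= andbT lt_min xT andbT stop_time_gt// ltW.
Qed.

End Stop.
End SolutionTrajectories.

(** * Components of the norm of a state *)

Section NormComponents.
Variable R : realType.
Local Notation mu := (@lebesgue_measure R).
Implicit Types (C : R) (f : R -> R) (X : state R).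

Lemma L2norm_ge0 f : (0 <= L2norm f)%E. Proof. exact: Lnorm_ge0. Qed.
Lemma Linfnorm_ge0 f : (0 <= Linfnorm f)%E. Proof. exact: Lnorm_ge0. Qed.
Lemma Enorm_ge0 f : (0 <= Enorm f)%E.
Proof. by rewrite /Enorm adde_ge0 ?L2norm_ge0 ?Linfnorm_ge0. Qed.

Lemma leeD_le (x y c : \bar R) : (x + y <= c)%E -> (0 <= x)%E -> (0 <= y)%E -> (x <= c)%E /\ (y <= c)%E.
Proof.
by move=> H x0 y0; split; apply: le_trans H; [rewrite leeDl|rewrite leeDr].
Qed.

Lemma Enorm_le f C : (Enorm f <= C%:E)%E -> (L2norm f <= C%:E)%E /\ (Linfnorm f <= C%:E)%E.
Proof. by move=> H; apply: leeD_le H _ _; [exact: L2norm_ge0|exact: Linfnorm_ge0]. Qed.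

Lemma Vbarnorm_le X C : (Vbarnorm X <= C%:E)%E ->
  [/\ (Linfnorm (zeta X) <= C%:E)%E, (Enorm (Ubar X) <= C%:E)%E, `|cc X| <= C &
  [/\ (Enorm (vv X) <= C%:E)%E, (Enorm (ww X) <= C%:E)%E, (Enorm (hh X) <= C%:E)%E,
      (Enorm (rbar X) <= C%:E)%E & `|kk X| <= C]].
Proof.
have nn (x : R) : (0 <= `|x|%:E)%E by rewrite lee_fin.
have P := (Enorm_ge0, Linfnorm_ge0, L2norm_ge0, nn).
rewrite /Vbarnorm => H.
have [||H1 k] := leeD_le H; [by do ?apply: adde_ge0; rewrite ?P|by rewrite ?P|].
have [||H2 r] := leeD_le H1; [by do ?apply: adde_ge0; rewrite ?P|by rewrite ?P|].
have [||H3 h] := leeD_le H2; [by do ?apply: adde_ge0; rewrite ?P|by rewrite ?P|].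
have [||H4 w] := leeD_le H3; [by do ?apply: adde_ge0; rewrite ?P|by rewrite ?P|].
have [||H5 v] := leeD_le H4; [by do ?apply: adde_ge0; rewrite ?P|by rewrite ?P|].
have [||H6 c] := leeD_le H5; [by do ?apply: adde_ge0; rewrite ?P|by rewrite ?P|].
have [z U] := leeD_le H6 (Linfnorm_ge0 _) (Enorm_ge0 _).
by split => //; split.
Qed.

End NormComponents.

(** The constant of [PmU_le] and [Qfun_le]. *)
Definition nonlocal_const (R : realType) (A : R) : R := 10 * A ^+ 5 * expR (2 * A).

(** * A priori rates of one solution *)

Section AprioriBounds.
Variables (R : realType) (chi : R -> R) (X0 : state R) (X : R -> state R).
Hypothesis sol : is_solution chi X0 X.
Local Notation mu := (@lebesgue_measure R).
Implicit Types (s t T S xi A C : R).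

Definition bounded_by A S (N : R -> R) : Prop :=
  \forall xi \ae mu, forall t, 0 <= t <= S -> pt_bound A (N xi) (X t) xi.

Lemma sol_measurable t : 0 <= t -> [/\ measurable_fun setT (zeta (X t)),
  measurable_fun setT (Ubar (X t)), measurable_fun setT (ww (X t)),
  measurable_fun setT (hh (X t)) & measurable_fun setT (rbar (X t))].
Proof.
by move=> /(sol_inVbar sol)[[mz _] [[[mU _] _] [_ [[[mw _] _] [[[mh _] _] [[mr _] _]]]]]].
Qed.

Lemma continuous_cutoff_comp (f : R -> R) A S : cutoff_bounds A chi -> 0 < S ->
  {within `[0, S], continuous f} -> {within `[0, S], continuous (chi \o f)}.
Proof.
move=> cut S0 cf x.
apply: (@continuous_comp (subspace `[0, S]) _ _ f chi); first exact: cf.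
apply/cvgrPdist_le => e e0.
have A0 : 0 <= A by exact: le_trans (cut0 cut 0).
have A1 : 0 < A + 1 by rewrite ltr_wpDl.
near=> y; apply: le_trans (cutL0 cut _ _) _.
apply: (@le_trans _ _ ((A + 1) * `|f x - y|)); first by rewrite ler_wpM2r// lerDl.
rewrite -ler_pdivlMl//.
near: y; apply: cvgr_dist_le; first exact: cvg_id.
by rewrite mulr_gt0// invr_gt0.
Unshelve. all: by end_near. Qed.

Section Continuity.
Variables (A S : R).
Hypotheses (cut : cutoff_bounds A chi) (S0 : 0 < S).

Lemma sol_continuous xi :
  [/\ {within `[0, S], continuous (fun t => zeta (X t) xi)},
      {within `[0, S], continuous (fun t => Ubar (X t) xi)},
      {within `[0, S], continuous (fun t => qq (X t) xi)} &
  [/\ {within `[0, S], continuous (fun t => ww (X t) xi)},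
      {within `[0, S], continuous (fun t => hh (X t) xi)} &
      {within `[0, S], continuous (fun t => rbar (X t) xi)}]].
Proof.
have S0' := ltW S0.
have cy := prim_on_continuous S0' (@sol_prim_y _ _ _ _ sol S xi).
have cU := prim_on_continuous S0' (@sol_prim_U _ _ _ _ sol S xi).
split.
- have -> : (fun t => zeta (X t) xi) = (fun t => yy (X t) xi - xi).
    by apply/funext => t; rewrite /yy; ring.
  by move=> x; apply: cvgB; [exact: cy|exact: cvg_cst].
- have cX := continuous_cutoff_comp cut S0 cy.
  apply: (@subspace_eq_continuous _ _ _ (fun t => UU chi (X t) xi - cc X0 * chi (yy (X t) xi))).
    move=> t; rewrite inE/= in_itv/= => /andP[t0 _].
    by rewrite /from_subspace /UU (sol_cc sol t0); ring.
  move=> x; apply: cvgB; first exact: cU.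
  by apply: cvgM; [exact: cvg_cst|exact: cX].
- exact: prim_on_continuous S0' (@sol_prim_q _ _ _ _ sol S xi).
split.
- exact: prim_on_continuous S0' (@sol_prim_w _ _ _ _ sol S xi).
- exact: prim_on_continuous S0' (@sol_prim_h _ _ _ _ sol S xi).
- exact: prim_on_continuous S0' (@sol_prim_r _ _ _ _ sol S xi).
Qed.

Lemma pt_bound_cst C Y xi : `|zeta Y xi| <= C -> `|Ubar Y xi| <= C -> `|qq Y xi| <= C ->
  `|ww Y xi| <= C -> `|hh Y xi| <= C -> `|rbar Y xi| <= C -> pt_bound C C Y xi.
Proof. by []. Qed.

(** This [C] depends on the solution; it only starts the bootstrap of [sup_bound], which replaces it
    by [A]. *)
Lemma crude_bound : exists C, 0 <= C /\ bounded_by C S (fun=> C).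
Proof.
case: sol => _ [_ [/(_ S)[C0 HC] _]].
pose C := `|C0| + 1.
have CC : C0 + 1 <= C by rewrite lerD2r ler_norm.
have C00 : 0 <= C by rewrite addr_ge0.
exists C; split => //.
have Linf (f : R -> R) c : c <= C -> (Linfnorm f <= c%:E)%E -> \forall xi \ae mu, `|f xi| <= C.
  by move=> cC /Linfnorm_leP H; apply: aeS H _ => x /le_trans; apply.
have comp t : 0 <= t <= S -> [/\ \forall xi \ae mu, `|zeta (X t) xi| <= C,
     \forall xi \ae mu, `|Ubar (X t) xi| <= C, \forall xi \ae mu, `|qq (X t) xi| <= C &
    [/\ \forall xi \ae mu, `|ww (X t) xi| <= C, \forall xi \ae mu, `|hh (X t) xi| <= C &
     \forall xi \ae mu, `|rbar (X t) xi| <= C]].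
  move=> /HC/Vbarnorm_le[z /Enorm_le[_ U] _ [/Enorm_le[_ v] /Enorm_le[_ w] /Enorm_le[_ h] /Enorm_le[_ r] _]].
  have c0 : C0 <= C by apply: le_trans CC; rewrite lerDl.
  split; [exact: Linf z|exact: Linf U| |split; [exact: Linf w|exact: Linf h|exact: Linf r]].
  move/Linfnorm_leP : v => v; apply: aeS v _ => x; rewrite /vv => vx.
  have -> : qq (X t) x = (qq (X t) x - 1) + 1 by ring.
  by apply: le_trans (normrD_le vx (lexx _)) _; rewrite normr1.
have AE (g : R -> R -> R) : (forall x, {within `[0, S], continuous (g ^~ x)}) ->
    (forall t, 0 <= t <= S -> \forall x \ae mu, `|g t x| <= C) ->
    \forall x \ae mu, forall t, 0 <= t <= S -> `|g t x| <= C by exact: ae_all_times.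
have z := AE (fun t xi => zeta (X t) xi) (fun xi => let: And4 a _ _ _ := sol_continuous xi in a)
  (fun t tS => let: And4 a _ _ _ := comp t tS in a).
have U := AE (fun t xi => Ubar (X t) xi) (fun xi => let: And4 _ a _ _ := sol_continuous xi in a)
  (fun t tS => let: And4 _ a _ _ := comp t tS in a).
have q := AE (fun t xi => qq (X t) xi) (fun xi => let: And4 _ _ a _ := sol_continuous xi in a)
  (fun t tS => let: And4 _ _ a _ := comp t tS in a).
have w := AE (fun t xi => ww (X t) xi) (fun xi => let: And4 _ _ _ (And3 a _ _) := sol_continuous xi in a)
  (fun t tS => let: And4 _ _ _ (And3 a _ _) := comp t tS in a).
have h := AE (fun t xi => hh (X t) xi) (fun xi => let: And4 _ _ _ (And3 _ a _) := sol_continuous xi in a)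
  (fun t tS => let: And4 _ _ _ (And3 _ a _) := comp t tS in a).
have r := AE (fun t xi => rbar (X t) xi) (fun xi => let: And4 _ _ _ (And3 _ _ a) := sol_continuous xi in a)
  (fun t tS => let: And4 _ _ _ (And3 _ _ a) := comp t tS in a).
apply: aeS (aeI (aeI (aeI z U) (aeI q w)) (aeI h r)) _.
by move=> xi [[[z' U'] [q' w']] [h' r']] t tS; apply: pt_bound_cst; auto.
Qed.

End Continuity.

Section Rates.
Variables (A S CN : R) (N : R -> R).
Hypotheses (A1 : 1 <= A) (cut : cutoff_bounds A chi) (S0 : 0 <= S) (dN : dominator CN N)
  (cA : `|cc X0| <= A) (kA : `|kk X0| <= A) (bd : bounded_by A S N).
Local Notation coreA := (core A).
Local Notation c10 := (nonlocal_const A).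

Let A0 : 0 <= A := le_trans ler01 A1.
Let W xi := N xi + coreA xi.
Let dW : dominator (CN + 1) W := dominatorD dN (dominator_core A).

Lemma sol_regular s : 0 <= s <= S -> regular A N (X s) [set xi | (s%:E < tau X xi)%E].
Proof.
move=> sS; have s0 : 0 <= s by case/andP: sS.
have [mz mU mw mh mr] := sol_measurable s0.
split => //.
- exact: (measurable_qq sol s0).
- exact: (measurable_tau_gt sol s0).
- by rewrite (sol_cc sol s0).
- by rewrite (sol_kk sol s0).
- by apply: aeS bd _ => xi /(_ s sS).
Qed.

(** With [|xi| > A + 1] and [|zeta| <= A], the value [y] remains on one side of [0, 1], where [chi]
    is constant. *)
Lemma core_out_dichotomy xi s t : coreA xi = 0 -> `|zeta (X s) xi| <= A -> `|zeta (X t) xi| <= A ->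
  chi (yy (X s) xi) = chi (yy (X t) xi).
Proof.
rewrite /core; case: ifPn => [_ /eqP|]; first by rewrite oner_eq0.
rewrite -ltNge => H _; rewrite !ler_norml => /andP[s1 s2] /andP[t1 t2].
move: H; rewrite ltr_normr => /orP[] H.
  by rewrite !(cut0_r cut)// /yy; lra.
by rewrite !(cut0_l cut)// /yy; lra.
Qed.

(** Square integrable in the label as soon as [N] is. *)
Definition growth_rate xi : R := 3 * A * c10 * (N xi + coreA xi + conv W xi).

Let c10A : 10 * A ^+ 5 <= c10.
Proof.
rewrite /nonlocal_const ler_peMr ?mulr_ge0 ?exprn_ge0//.
by rewrite -expR0 ler_expR mulr_ge0.
Qed.

Lemma sol_rates : \forall xi \ae mu, forall s t, 0 <= s -> s <= t -> t <= S ->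
  [/\ `|zeta (X t) xi - zeta (X s) xi| <= 2 * A ^+ 2 * (t - s),
      `|Ubar (X t) xi - Ubar (X s) xi| <= growth_rate xi * (t - s),
      `|qq (X t) xi - qq (X s) xi| <= growth_rate xi * (t - s) &
  [/\ `|ww (X t) xi - ww (X s) xi| <= growth_rate xi * (t - s),
      `|hh (X t) xi - hh (X s) xi| <= growth_rate xi * (t - s) &
      `|rbar (X t) xi - rbar (X s) xi| <= growth_rate xi * (t - s)]].
Proof.
apply: aeS bd _ => xi pb s t s0 st tS.
have I x : s < x < t -> 0 <= x <= S.
  by move=> /andP[sx xt]; rewrite (le_trans s0 (ltW sx)) (le_trans (ltW xt) tS).
have N0 : 0 <= N xi := dominator_ge0 xi dN.
have cv0 : 0 <= conv W xi := conv_ge0 xi dW.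
have k0 : 0 <= coreA xi := core_ge0 A xi.
have c100 : 0 <= c10 by rewrite /nonlocal_const !mulr_ge0 ?exprn_ge0 ?expR_ge0.
have c101 : 10 <= c10 by apply: le_trans c10A; rewrite ler_peMr// exprn_ege1.
have Pb x : s < x < t -> `|PmU chi (tau X) x (X x) xi| <= c10 * (N xi + conv W xi).
  move=> /I xS; apply: (PmU_le cut A1 dN (sol_regular xS)); last exact: pb.
  exact: pb_zeta (pb x xS).
have Qb x : s < x < t -> `|Qfun chi (tau X) x (X x) xi| <= c10 * (coreA xi + conv W xi).
  move=> /I xS; apply: (Qfun_le cut A1 dN (sol_regular xS)); last exact: pb.
  exact: pb_zeta (pb x xS).
have ts0 : 0 <= t - s by rewrite subr_ge0.
have ib xi0 x b : 0 <= b -> forall y, `|y| <= b -> `|ind (tau X) xi0 x * y| <= b.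
  by move=> b0 y yb; rewrite /ind; case: ifP; rewrite ?mul1r// mul0r normr0.
have tS' : 0 <= t <= S by rewrite (le_trans s0).
have sS : 0 <= s <= S by rewrite s0 (le_trans st).
have dy : `|yy (X t) xi - yy (X s) xi| <= 2 * A ^+ 2 * (t - s).
  apply: prim_on_lip (prim_on_sub s0 tS (@sol_prim_y _ _ _ _ sol S xi)) _ => // x /I xS.
  have x0 : 0 <= x by case/andP: xS.
  have := normrD_le (pb_U (pb x xS)) (normrM_le cA (cut0 cut (yy (X x) xi))).
  rewrite /UU (sol_cc sol x0) => /le_trans; apply.
  have : A * 1 <= A * A by rewrite ler_wpM2l.
  by rewrite mulr1 expr2; lra.
have dU : `|UU chi (X t) xi - UU chi (X s) xi| <= c10 * (coreA xi + conv W xi) * (t - s).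
  apply: prim_on_lip (prim_on_sub s0 tS (@sol_prim_U _ _ _ _ sol S xi)) _ => // x xst.
  by rewrite normrN; exact: Qb.
have gA : 3 * (A * (c10 * (N xi + coreA xi + conv W xi))) = growth_rate xi.
  by rewrite /growth_rate; ring.
have g1 : 3 * (c10 * (N xi + coreA xi + conv W xi)) <= growth_rate xi.
  have m0 : 0 <= c10 * (N xi + coreA xi + conv W xi) by rewrite mulr_ge0// !addr_ge0.
  by rewrite -gA ler_wpM2l// ler_peMl.
have cN : 10 * N xi <= c10 * N xi by rewrite ler_wpM2r.
have ck : 0 <= c10 * coreA xi by rewrite mulr_ge0.
have cW : 0 <= c10 * conv W xi by rewrite mulr_ge0.
have rate (f g : R -> R) : prim_on 0 S f g -> (forall x, s < x < t -> `|g x| <= growth_rate xi) ->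
    `|f t - f s| <= growth_rate xi * (t - s).
  by move=> F G; apply: prim_on_lip (prim_on_sub s0 tS F) _.
have gr0 : 0 <= growth_rate xi.
  by apply: le_trans g1; rewrite mulr_ge0// mulr_ge0// !addr_ge0.
split.
- have -> : zeta (X t) xi - zeta (X s) xi = yy (X t) xi - yy (X s) xi by rewrite /yy; ring.
  exact: dy.
- have -> : Ubar (X t) xi - Ubar (X s) xi = (UU chi (X t) xi - UU chi (X s) xi)
      - cc X0 * (chi (yy (X t) xi) - chi (yy (X s) xi)).
    have [st0 tt0] : 0 <= s /\ 0 <= t by split => //; exact: le_trans st.
    by rewrite /UU (sol_cc sol st0) (sol_cc sol tt0); ring.
  (* [Ubar] is [U] minus [c chi(y)], and the latter changes only in the core; this keeps its rate
     square integrable. *)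
  have dchi : `|chi (yy (X t) xi) - chi (yy (X s) xi)| <= A * (2 * A ^+ 2 * (t - s)) * coreA xi.
    have [c0|c0] := eqVneq (coreA xi) 0.
      rewrite (core_out_dichotomy c0 (pb_zeta (pb t tS')) (pb_zeta (pb s sS))).
      by rewrite subrr normr0 c0 mulr0.
    have -> : coreA xi = 1 by move: c0; rewrite /core; case: ifP => //; rewrite eqxx.
    by rewrite mulr1; apply: le_trans (cutL0 cut _ _) _; rewrite ler_wpM2l.
  apply: le_trans (normrB_le dU (normrM_le cA dchi)) _.
  have A4 : 2 * A ^+ 4 * coreA xi <= c10 * coreA xi.
    rewrite ler_wpM2r//; apply: le_trans c10A.
    have : A ^+ 4 <= A ^+ 5 by rewrite Apow_le.
    by have := exprn_ge0 5 A0; lra.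
  have -> : A * (A * (2 * A ^+ 2 * (t - s)) * coreA xi) = 2 * A ^+ 4 * coreA xi * (t - s) by ring.
  rewrite -mulrDl ler_wpM2r//; apply: le_trans g1.
  have : 0 <= c10 * N xi by rewrite mulr_ge0.
  by lra.
- apply: rate (@sol_prim_q _ _ _ _ sol S xi) _ => x xst; apply: ib => //.
  apply: le_trans (pb_wN (pb x (I x xst))) _; apply: le_trans g1; lra.
split.
- apply: rate (@sol_prim_w _ _ _ _ sol S xi) _ => x xst; apply: ib => //.
  have xS := I x xst; have p := pb x xS.
  have T1 : `|hh (X x) xi / 2| <= N xi.
    by rewrite normrM (ger0_norm (x := 2^-1)) ?invr_ge0//; have := pb_hN p; lra.
  have T2 := normrM_le (Pb x xst) (pb_q p).
  have T3 := normrM_le kA (pb_rN p).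
  apply: le_trans (normrD_le (normrB_le T1 T2) T3) _; rewrite -gA.
  have X1 : N xi <= A * N xi by rewrite ler_peMl.
  have X2 : A * (10 * N xi) <= A * (c10 * N xi) by rewrite ler_wpM2l.
  have X3 : 0 <= A * (c10 * coreA xi) by rewrite mulr_ge0.
  have X4 : 0 <= A * (c10 * conv W xi) by rewrite mulr_ge0.
  by lra.
- apply: rate (@sol_prim_h _ _ _ _ sol S xi) _ => x xst; apply: ib => //.
  have xS := I x xst; have p := pb x xS.
  have T2 := normrM_le (Pb x xst) (pb_w p).
  have -> : 2 * - PmU chi (tau X) x (X x) xi * ww (X x) xi = - (2 * (PmU chi (tau X) x (X x) xi * ww (X x) xi)) by ring.
  rewrite normrN normrM (ger0_norm (x := 2))// -gA.
  have X3 : 0 <= A * (c10 * coreA xi) by rewrite mulr_ge0.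
  have X4 : 0 <= A * (c10 * conv W xi) by rewrite mulr_ge0.
  have X5 : 0 <= A * (c10 * N xi) by rewrite mulr_ge0// mulr_ge0.
  by lra.
- apply: rate (@sol_prim_r _ _ _ _ sol S xi) _ => x xst.
  rewrite normrN -mulrA; apply: ib => //.
  have xS := I x xst; have p := pb x xS.
  apply: le_trans (normrM_le kA (pb_wN p)) _; rewrite -gA.
  have X2 : A * (10 * N xi) <= A * (c10 * N xi) by rewrite ler_wpM2l.
  have X1 : N xi <= A * N xi by rewrite ler_peMl.
  have X3 : 0 <= A * (c10 * coreA xi) by rewrite mulr_ge0.
  have X4 : 0 <= A * (c10 * conv W xi) by rewrite mulr_ge0.
  by lra.
Qed.

End Rates.
End AprioriBounds.

(** * Uniform bound and square integrable majorant of one solution *)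

Section SolutionDominator.
Variables (R : realType) (chi : R -> R) (X0 : state R) (X : R -> state R).
Hypothesis sol : is_solution chi X0 X.
Local Notation mu := (@lebesgue_measure R).
Variables (M A : R).
Hypotheses (M0 : 0 < M) (AM : M + 3 <= A) (cut : cutoff_bounds A chi) (A1 : 1 <= A) (inB0 : inB M X0).
Implicit Types (s t T S xi C : R).
Local Notation coreA := (core A).
Local Notation c10 := (nonlocal_const A).

Let A0 : 0 <= A := le_trans ler01 A1.
Let sol0 : X 0 = X0. Proof. by case: sol. Qed.

Lemma initial_norms : [/\ (Linfnorm (zeta X0) <= M%:E)%E, (Enorm (Ubar X0) <= M%:E)%E, `|cc X0| <= M &
  [/\ (Enorm (vv X0) <= M%:E)%E, (Enorm (ww X0) <= M%:E)%E, (Enorm (hh X0) <= M%:E)%E,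
      (Enorm (rbar X0) <= M%:E)%E & `|kk X0| <= M]].
Proof.
case: inB0 => _ [_ H]; apply: Vbarnorm_le; apply: le_trans H; rewrite leeDl//.
exact: Linfnorm_ge0.
Qed.

Lemma initial_bound : \forall xi \ae mu,
  [/\ `|zeta X0 xi| <= M, `|Ubar X0 xi| <= M, `|qq X0 xi| <= M + 1 &
  [/\ `|ww X0 xi| <= M, `|hh X0 xi| <= M & `|rbar X0 xi| <= M]].
Proof.
have [z /Enorm_le[_ U] _ [/Enorm_le[_ v] /Enorm_le[_ w] /Enorm_le[_ h] /Enorm_le[_ r] _]] := initial_norms.
move/Linfnorm_leP: z => z; move/Linfnorm_leP: U => U; move/Linfnorm_leP: v => v.
move/Linfnorm_leP: w => w; move/Linfnorm_leP: h => h; move/Linfnorm_leP: r => r.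
apply: aeS (aeI (aeI (aeI z U) (aeI v w)) (aeI h r)) _ => xi [[[z' U'] [v' w']] [h' r']].
split => //.
have -> : qq X0 xi = (qq X0 xi - 1) + 1 by ring.
by apply: normrD_le; [exact: v'|rewrite normr1].
Qed.

Let cA : `|cc X0| <= A.
Proof. by have [_ _ H _] := initial_norms; apply: le_trans H _; move: AM M0; lra. Qed.
Let kA : `|kk X0| <= A.
Proof. by have [_ _ _ [_ _ _ _ H]] := initial_norms; apply: le_trans H _; move: AM M0; lra. Qed.

Lemma dominator_cst C : 0 <= C -> dominator C (fun=> C).
Proof. by move=> C0; split; [exact: measurable_cst|move=> x; rewrite C0 lexx]. Qed.

Definition sup_rate (a : R) : R := 9 * a * (a + 1) * nonlocal_const a.

Lemma sup_rates a S : 1 <= a -> cutoff_bounds a chi -> `|cc X0| <= a -> `|kk X0| <= a ->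
  bounded_by X a S (fun=> a) ->
  \forall xi \ae mu, forall s t, 0 <= s -> s <= t -> t <= S -> forall b, pt_bound b b (X s) xi ->
    pt_bound (b + sup_rate a * (t - s)) (b + sup_rate a * (t - s)) (X t) xi.
Proof.
move=> a1 cuta ca ka bda.
have a0 : 0 <= a := le_trans ler01 a1.
apply: aeS (sol_rates sol a1 cuta (dominator_cst a0) ca ka bda) _ => xi H s t s0 st tS b pb.
have [z U q [w h r]] := H s t s0 st tS.
have ts0 : 0 <= t - s by rewrite subr_ge0.
have n0 : 1 <= nonlocal_const a.
  rewrite /nonlocal_const; have : 1 <= a ^+ 5 by exact: exprn_ege1.
  have : 1 <= expR (2 * a) by rewrite -expR0 ler_expR mulr_ge0.
  by move=> e1 a5; rewrite -[leLHS]mulr1; apply: ler_pM => //; lra.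
have g : growth_rate a (fun=> a) xi <= sup_rate a.
  rewrite /growth_rate /sup_rate.
  have := conv_le xi (dominatorD (dominator_cst a0) (dominator_core a)).
  have := core01 a xi => /andP[k0 k1] cv.
  have : a + core a xi + conv (fun x => a + core a x) xi <= 3 * (a + 1) by lra.
  move=> /(ler_wpM2l (_ : 0 <= 3 * a * nonlocal_const a)) -/(_ _)/le_trans; apply.
    by rewrite !mulr_ge0// (le_trans ler01).
  by rewrite le_eqVlt; apply/orP; left; apply/eqP; ring.
have g2 : 2 * a ^+ 2 <= sup_rate a.
  rewrite /sup_rate; apply: (@le_trans _ _ (9 * a * (a + 1) * 1)).
    by rewrite expr2; have := mulr_ge0 a0 a0; lra.
  by rewrite ler_wpM2l// !mulr_ge0// addr_ge0.
have step (u v c : R) : `|v| <= b -> `|u - v| <= c * (t - s) -> c <= sup_rate a ->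
    `|u| <= b + sup_rate a * (t - s).
  move=> vb uv cs; have -> : u = v + (u - v) by ring.
  by apply: normrD_le => //; apply: le_trans uv _; rewrite ler_wpM2r.
apply: pt_bound_cst.
- exact: step (pb_zeta pb) z g2.
- exact: step (pb_U pb) U g.
- exact: step (pb_q pb) q g.
- exact: step (pb_w pb) w g.
- exact: step (pb_h pb) h g.
- exact: step (pb_r pb) r g.
Qed.

Lemma pt_bound_le b b' N N' (Y : state R) xi : b <= b' -> N <= N' -> pt_bound b N Y xi -> pt_bound b' N' Y xi.
Proof.
by move=> bb NN [*]; split; first [exact: le_trans bb|exact: le_trans NN].
Qed.

Lemma initial_pt_bound : \forall xi \ae mu, pt_bound (M + 1) (M + 1) X0 xi.
Proof.
have W x : x <= M -> x <= M + 1 by move=> /le_trans; apply; rewrite lerDl.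
apply: aeS initial_bound _ => xi [/W z /W U q [/W w /W h /W r]].
exact: pt_bound_cst.
Qed.

(** A bootstrap, because the rates are controlled by the very bound sought. The crude [C] yields a
    time step [d] in which the unknowns grow by at most 1, hence from [A - 1] to [A]; the rate of
    [A] then holds back to time 0, where the bound is [M + 1 <= A - 2], and gives [A - 1] again.
    Only the number of steps depends on [C]. *)
Lemma sup_bound S : 0 < S -> S <= 1 -> S * sup_rate A <= 1 -> bounded_by X A S (fun=> A).
Proof.
move=> S0 S1 SA.
have rA0 : 0 <= sup_rate A.
  by rewrite /sup_rate /nonlocal_const !mulr_ge0 ?addr_ge0 ?exprn_ge0 ?expR_ge0.
have [C' [C'0 crude']] := crude_bound sol cut S0.
pose C := C' + A + 1.
have CA : A <= C by rewrite /C; lra.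
have C1 : 1 <= C := le_trans A1 CA.
have crude : bounded_by X C S (fun=> C).
  apply: aeS crude' _ => xi H t tS; apply: pt_bound_le (H t tS); rewrite /C; move: A0 => A0'; lra.
have cutC := cutoff_bounds_weaken CA cut.
have MA2 : M + 1 <= A - 2 by move: AM; lra.
have MA1 : M + 1 <= A - 1 by move: AM; lra.
have A1A : A - 1 <= A by rewrite gerBl.
have A21 : A - 2 + 1 <= A - 1 by lra.
have RC := sup_rates C1 cutC (le_trans cA CA) (le_trans kA CA) crude.
have rC0 : 0 <= sup_rate C.
  have C0 := le_trans ler01 C1.
  by rewrite /sup_rate /nonlocal_const !mulr_ge0 ?addr_ge0 ?exprn_ge0 ?expR_ge0.
have iC0 : 0 < (1 + sup_rate C)^-1 by rewrite invr_gt0 ltr_wpDr.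
have [n hn] := ltr_add_invr (y := 0) (x := (1 + sup_rate C)^-1) iC0.
rewrite add0r in hn.
pose d := S / n.+1%:R.
have n0 : 0 < n.+1%:R :> R by rewrite ltr0n.
have d0 : 0 <= d by rewrite divr_ge0// ltW.
have dC : sup_rate C * d <= 1.
  have d1 : d <= (1 + sup_rate C)^-1.
    by apply: le_trans (ltW hn); rewrite /d ler_piMl// invr_ge0 ltW.
  apply: (@le_trans _ _ ((1 + sup_rate C) * (1 + sup_rate C)^-1)).
    by apply: ler_pM => //; rewrite lerDr.
  by rewrite divff// gt_eqF// ltr_wpDr.
have step k : (k <= n.+1)%N -> bounded_by X (A - 1) (k%:R * d) (fun=> A - 1).
  elim: k => [|k IH] kn.
    apply: aeS initial_pt_bound _ => xi P t; rewrite mul0r => /andP[t0 t0'].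
    have -> : t = 0 by apply/eqP; rewrite eq_le t0 t0'.
    by rewrite sol0; exact: pt_bound_le P.
  have kS : k.+1%:R * d <= S.
    rewrite /d mulrC -mulrA ler_piMr ?(ltW S0)// mulrC ler_pdivrMr// mul1r ler_nat//.
  have kd : k.+1%:R * d = k%:R * d + d by rewrite -natr1; ring.
  have kd0 : 0 <= k%:R * d by rewrite mulr_ge0.
  have {}IH := IH (ltnW kn).
  have ext : bounded_by X A (k.+1%:R * d) (fun=> A).
    apply: aeS (aeI IH RC) _ => xi [H1 H2] t /andP[t0 tk].
    have [tk'|kt] := leP t (k%:R * d).
      by apply: pt_bound_le (H1 t _) => //; rewrite t0.
    have P := H1 (k%:R * d) (introT andP (conj kd0 (lexx _))).
    have := H2 _ _ kd0 (ltW kt) (le_trans tk kS) _ P.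
    have L : sup_rate C * (t - k%:R * d) <= 1.
      by apply: le_trans dC; rewrite ler_wpM2l// lerBlDl -kd.
    by have L' := lerD (lexx (A - 1)) L; rewrite subrK in L'; apply: pt_bound_le.
  apply: aeS (aeI initial_pt_bound (sup_rates A1 cut cA kA ext)) _ => xi [P0 H2] t /andP[t0 tk].
  have P : pt_bound (A - 2) (A - 2) (X 0) xi.
    by rewrite sol0; exact: pt_bound_le P0.
  have := H2 _ _ (lexx 0) t0 tk _ P; rewrite subr0.
  have L : sup_rate A * t <= 1.
    by apply: le_trans SA; rewrite mulrC ler_wpM2r//; apply: le_trans tk kS.
  by have L' := le_trans (lerD (lexx (A - 2)) L) A21; apply: pt_bound_le.
have := step n.+1 (leqnn _).
have -> : n.+1%:R * d = S by rewrite /d mulrC divfK// gt_eqF.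
by move=> H; apply: aeS H _ => xi H t tS; exact: pt_bound_le (H t tS).
Qed.

Variable S : R.
Hypotheses (S0 : 0 < S) (S1 : S <= 1) (SA : S * sup_rate A <= 1) (Sc : S * (3 * A * c10) <= 10^-1).

Let sb := sup_bound S0 S1 SA.

(** Truncation makes a function that is bounded almost everywhere bounded everywhere, as [dominator]
    requires. *)
Definition clamp (x : R) : R := Order.min A `|x|.

Lemma dominator_clamp (f : R -> R) : measurable_fun setT f -> dominator A (fun x => clamp (f x)).
Proof.
move=> mf; split; last by move=> x; rewrite le_min A0 normr_ge0/= ge_min lexx.
by apply: measurable_minr => //; apply: measurableT_comp.
Qed.

Lemma clamp_id x : `|x| <= A -> clamp x = `|x|.
Proof. by move=> xA; rewrite /clamp min_r. Qed.

Lemma sqint_clamp (f : R -> R) C : 0 <= C -> measurable_fun setT f -> (L2norm f <= C%:E)%E ->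
  (sqint (fun x => clamp (f x)) <= (C ^+ 2)%:E)%E.
Proof.
move=> C0 mf /(L2norm_leP _ C0); apply: le_trans.
have mn : measurable_fun setT (fun x => `|f x|) by apply: measurableT_comp.
apply: (@le_trans _ _ (sqint (fun x => `|f x|))).
  apply: sqint_le => //; first exact: (dominator_clamp mf).1.
  apply: aeW => x; rewrite ger0_norm; first by rewrite ge_min lexx orbT.
  by rewrite le_min A0 normr_ge0.
by rewrite /sqint; under eq_integral do rewrite real_normK ?num_real//.
Qed.

Lemma sqint_core : (sqint coreA <= (2 * (A + 1))%:E)%E.
Proof.
have E x : (coreA x ^+ 2)%:E = (\1_`[- (A + 1), A + 1] x)%:E.
  rewrite /core indicE; case: ifPn => H.
    by rewrite expr1n mem_set//= in_itv/= -ler_norml.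
  by rewrite expr0n memNset//= in_itv/= -ler_norml; exact/negP.
have muE : mu `[- (A + 1), A + 1] = (2 * (A + 1))%:E.
  rewrite lebesgue_measure_itv/= lte_fin ifT; last by move: A0 => X1; lra.
  by rewrite -EFinD; congr EFin; ring.
rewrite /sqint; under eq_integral do rewrite E.
by rewrite integral_indic// setIT -muE.
Qed.

Let Dom (Phi : R -> R) : Prop := \forall xi \ae mu, forall t, 0 <= t <= S ->
  [/\ `|Ubar (X t) xi| <= Phi xi, `|ww (X t) xi| <= Phi xi,
      `|hh (X t) xi| <= Phi xi & `|rbar (X t) xi| <= Phi xi].

Let n0 xi := (clamp (Ubar X0 xi) + clamp (ww X0 xi)) + (clamp (hh X0 xi) + clamp (rbar X0 xi)).
Let psi xi := n0 xi + (3 * A * c10) * (coreA xi + conv coreA xi).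

Let m0 : [/\ measurable_fun setT (Ubar X0), measurable_fun setT (ww X0),
   measurable_fun setT (hh X0) & measurable_fun setT (rbar X0)].
Proof. by have [_ ? ? ? ?] := sol_measurable sol (lexx 0); rewrite -sol0. Qed.

Let dn0 : dominator ((A + A) + (A + A)) n0.
Proof.
by have [? ? ? ?] := m0; apply: dominatorD; apply: dominatorD; exact: dominator_clamp.
Qed.

Let c30 : 0 <= 3 * A * c10.
Proof. by rewrite /nonlocal_const !mulr_ge0 ?exprn_ge0 ?expR_ge0. Qed.

Let dcore2 : dominator (1 + 2 * 1) (fun xi => coreA xi + conv coreA xi).
Proof. exact: dominatorD (dominator_core A) (dominator_conv (dominator_core A)). Qed.

Let dpsi : dominator ((A + A) + (A + A) + 3 * A * c10 * (1 + 2 * 1)) psi.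
Proof. exact: dominatorD dn0 (dominatorZ c30 dcore2). Qed.

(** The factor 4 of [dominator_iteration] times the bound of [sqint psi], in which every sum costs a
    factor 2 by [sqintD_le]. *)
Definition solution_sqint : R :=
  4 * (2 * (2 * (2 * M ^+ 2 + 2 * M ^+ 2) + 2 * (2 * M ^+ 2 + 2 * M ^+ 2))
   + 2 * ((3 * A * c10) ^+ 2 * (2 * (2 * (A + 1)) + 2 * (4 * (2 * (A + 1)))))).

Definition solution_sup : R := 2 * ((A + A) + (A + A) + 3 * A * c10 * (1 + 2 * 1)).

Let sqint_psi : (sqint psi <= (2 * (2 * (2 * M ^+ 2 + 2 * M ^+ 2) + 2 * (2 * M ^+ 2 + 2 * M ^+ 2))
   + 2 * ((3 * A * c10) ^+ 2 * (2 * (2 * (A + 1)) + 2 * (4 * (2 * (A + 1))))))%:E)%E.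
Proof.
have [_ /Enorm_le[U _] _ [_ /Enorm_le[w _] /Enorm_le[h _] /Enorm_le[r _] _]] := initial_norms.
have [mU mw mh mr] := m0; have M0' := ltW M0.
have cl (f : R -> R) : measurable_fun setT f -> measurable_fun setT (fun x => clamp (f x)).
  by move=> mf; exact: (dominator_clamp mf).1.
apply: sqintD_le; [exact: dn0.1|exact: (dominatorZ c30 dcore2).1| |].
  apply: sqintD_le; [by apply: measurable_funD; exact: cl|by apply: measurable_funD; exact: cl| |].
    by apply: sqintD_le; [exact: cl|exact: cl|exact: sqint_clamp|exact: sqint_clamp].
  by apply: sqintD_le; [exact: cl|exact: cl|exact: sqint_clamp|exact: sqint_clamp].
apply: sqintZ_le; first exact: dcore2.1.
apply: sqintD_le; [exact: (dominator_core A).1|exact: (dominator_conv (dominator_core A)).1|exact: sqint_core|].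
exact: sqint_conv_le (dominator_core A) sqint_core.
Qed.

(** Inserting a majorant [Phi] into the rates returns the data, a core term and [S * (3 * A * c10)]
    times [Phi + conv Phi]: the hypothesis of [dominator_iteration], started at the constant [A] of
    [sup_bound]. *)
Lemma solution_dominator : exists N, [/\ dominator solution_sup N,
  bounded_by X A S N & (sqint N <= solution_sqint%:E)%E].
Proof.
have th0 : 0 <= S * (3 * A * c10) by rewrite mulr_ge0// ltW.
have [] := @dominator_iteration R Dom psi _ A (S * (3 * A * c10)) _ _ _ _ _ sqint_psi dpsi th0 Sc A0.
- move=> f g fg Df; apply: aeS Df _ => xi H t tS; have [a b c d] := H t tS.
  by split; apply: le_trans (fg xi).
- move=> f Df.
  have H : \forall xi \ae mu, forall n : nat, forall t, 0 <= t <= S ->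
    [/\ `|Ubar (X t) xi| <= f xi + n.+1%:R^-1, `|ww (X t) xi| <= f xi + n.+1%:R^-1,
      `|hh (X t) xi| <= f xi + n.+1%:R^-1 & `|rbar (X t) xi| <= f xi + n.+1%:R^-1].
    by apply: ae_foralln => n; apply: Df; rewrite invr_gt0 ltr0n.
  apply: aeS H _ => xi H t tS.
  have lim (x : R) : (forall n : nat, x <= f xi + n.+1%:R^-1) -> x <= f xi.
    move=> Hx; rewrite leNgt; apply/negP => fx.
    have [n] := ltr_add_invr fx; rewrite ltNge => /negP; apply; exact: Hx.
  by split; apply: lim => n; have [] := H n t tS.
- by apply: aeS sb _ => xi H t tS; have [*] := H t tS.
- move=> C' Phi dPhi DPhi.
  have bP : bounded_by X A S Phi.
    apply: aeS (aeI sb DPhi) _ => xi [H1 H2] t tS.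
    by have [*] := H1 t tS; have [*] := H2 t tS.
  apply: aeS (aeI (aeI sb initial_bound) (sol_rates sol A1 cut dPhi cA kA bP)) _.
  move=> xi [[H1 _] H2] t tS; case/andP: (tS) => t0 tS'.
  have [_ dU _ [dw dh dr]] := H2 0 t (lexx 0) t0 tS'.
  have I0 : (0 : R) <= 0 <= S by rewrite lexx ltW.
  have P0 := H1 0 I0; rewrite sol0 subr0 in P0 dU dw dh dr.
  have g0 : 0 <= growth_rate A Phi xi.
    rewrite /growth_rate mulr_ge0// !addr_ge0 ?core_ge0//; first exact: (dominator_ge0 _ dPhi).
    by apply: conv_ge0; exact: dominatorD dPhi (dominator_core A).
  have gE : growth_rate A Phi xi * t <= (3 * A * c10) * (coreA xi + conv coreA xi)
     + S * (3 * A * c10) * (Phi xi + conv Phi xi).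
    apply: (@le_trans _ _ (growth_rate A Phi xi * S)); first by rewrite ler_wpM2l.
    rewrite /growth_rate (convD _ dPhi (dominator_core A)).
    have : (3 * A * c10) * (coreA xi + conv coreA xi) * S <= (3 * A * c10) * (coreA xi + conv coreA xi).
      by rewrite ler_piMr// mulr_ge0//; exact: (dominator_ge0 xi dcore2).
    by lra.
  have n0E : n0 xi = (`|Ubar X0 xi| + `|ww X0 xi|) + (`|hh X0 xi| + `|rbar X0 xi|).
    by rewrite /n0 !clamp_id ?(pb_U P0) ?(pb_w P0) ?(pb_h P0) ?(pb_r P0).
  have nU := normr_ge0 (Ubar X0 xi); have nw := normr_ge0 (ww X0 xi).
  have nh := normr_ge0 (hh X0 xi); have nr := normr_ge0 (rbar X0 xi).
  have fin (u u0 : R) : `|u0| <= n0 xi -> `|u - u0| <= growth_rate A Phi xi * t ->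
      `|u| <= psi xi + S * (3 * A * c10) * (Phi xi + conv Phi xi).
    move=> u0n du; have -> : u = u0 + (u - u0) by ring.
    by apply: le_trans (normrD_le u0n du) _; rewrite /psi; lra.
  split; first [apply: fin _ dU|apply: fin _ dw|apply: fin _ dh|apply: fin _ dr]; rewrite n0E; lra.
move=> N [dN DN JN]; exists N; split => //.
apply: aeS (aeI sb DN) _ => xi [H1 H2] t tS.
by have [*] := H1 t tS; have [*] := H2 t tS.
Qed.

End SolutionDominator.

(** * Distance of two solutions: one step of the contraction *)

Section PairOfSolutions.
Variables (R : realType) (chi : R -> R) (A : R).
Hypotheses (cut : cutoff_bounds A chi) (A1 : 1 <= A).
Local Notation mu := (@lebesgue_measure R).
Local Notation coreA := (core A).
Local Notation c10 := (nonlocal_const A).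
Implicit Types (s t xi x : R).

Let A0 : 0 <= A := le_trans ler01 A1.

(** Chosen to bound P, which is at most [c10 * (A + 2 * (A + 1))]. *)
Definition tame_const : R := 5 * A * c10.
Local Notation B := tame_const.

Variables (S m CN : R) (N : R -> R).
Hypotheses (S0 : 0 < S) (S1 : S <= 1) (dN : dominator CN N).

Record controlled (X0 : state R) (X : R -> state R) : Prop := Controlled {
  ct_sol : is_solution chi X0 X;
  ct_c : `|cc X0| <= A;
  ct_k : `|kk X0| <= A;
  ct_bd : bounded_by X A S N;
  ct_data : \forall xi \ae mu, [/\ 0 <= qq X0 xi, m <= qq X0 xi + hh X0 xi &
    qq X0 xi * hh X0 xi = ww X0 xi ^+ 2 + rbar X0 xi ^+ 2] }.

Let c10_ge : 10 <= c10.
Proof.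
rewrite /nonlocal_const -mulrA ler_peMr// -[leLHS]mulr1.
apply: ler_pM => //; first exact: exprn_ege1.
by rewrite -expR0 ler_expR mulr_ge0.
Qed.

Lemma tame_const_ge : A <= B.
Proof.
have : A * 10 <= A * c10 by rewrite ler_wpM2l.
by rewrite /B; move: A0 => X; lra.
Qed.

Lemma controlled_tame X0 X : controlled X0 X -> \forall xi \ae mu,
  trajectory S (stop_time X S xi) (kk X0) (fun t => qq (X t) xi) (fun t => ww (X t) xi)
    (fun t => hh (X t) xi) (fun t => rbar (X t) xi) (fun t => PmU chi (tau X) t (X t) xi) /\
  tame S B m (kk X0) (fun t => qq (X t) xi) (fun t => ww (X t) xi)
    (fun t => hh (X t) xi) (fun t => rbar (X t) xi) (fun t => PmU chi (tau X) t (X t) xi).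
Proof.
move=> cX; have AB := tame_const_ge; have S0' := ltW S0.
have bdA : bounded_by X A S (fun=> A).
  by apply: aeS (ct_bd cX) _ => xi H t tS; have [*] := H t tS.
have X0E : X 0 = X0 by case: (ct_sol cX).
apply: aeS (aeI bdA (ct_data cX)) _ => xi [pb [q0 sum0 cons0]]; split.
  by apply: sol_trajectory => //; [exact: ct_sol cX|rewrite X0E].
split.
- exact: le_trans AB.
- by [].
- exact: le_trans (ct_k cX) AB.
- by move=> s sS; exact: le_trans (pb_q (pb s sS)) AB.
- by move=> s sS; exact: le_trans (pb_w (pb s sS)) AB.
- by move=> s sS; exact: le_trans (pb_h (pb s sS)) AB.
- by move=> s sS; exact: le_trans (pb_r (pb s sS)) AB.
- move=> s sS.
  have rg := sol_regular (ct_sol cX) (ct_c cX) (ct_k cX) bdA sS.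
  have := PmU_le cut A1 (dominator_cst A0) rg (pb_zeta (pb s sS)) (pb s sS).
  move=> /le_trans; apply.
  have := conv_le xi (dominatorD (dominator_cst A0) (dominator_core A)) => cv.
  rewrite -/c10 /B mulrC ler_wpM2r ?(le_trans _ c10_ge)//.
  by move: cv A1; lra.
- by rewrite X0E.
- by rewrite X0E.
Qed.

Variables (X0 Y0 : state R) (X Y : R -> state R).
Hypotheses (cX : controlled X0 X) (cY : controlled Y0 Y).

Let X0E : X 0 = X0. Proof. by case: (ct_sol cX). Qed.
Let Y0E : Y 0 = Y0. Proof. by case: (ct_sol cY). Qed.
Let S0' : 0 <= S := ltW S0.

Let a xi := Order.min (stop_time X S xi) S.
Let a' xi := Order.min (stop_time Y S xi) S.

Definition stop_gap xi : R := `|a xi - a' xi|.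

Let ma : measurable_fun setT a. Proof. exact (measurable_stop_time (ct_sol cX) S0'). Qed.
Let ma' : measurable_fun setT a'. Proof. exact (measurable_stop_time (ct_sol cY) S0'). Qed.
Let aS xi : 0 <= a xi <= S.
Proof. by rewrite le_min stop_time_ge0//= S0' ge_min lexx orbT. Qed.
Let aS' xi : 0 <= a' xi <= S.
Proof. by rewrite le_min stop_time_ge0//= S0' ge_min lexx orbT. Qed.

Lemma dominator_stop_gap : dominator S stop_gap.
Proof.
split.
  apply: measurableT_comp; first exact: normr_measurable.
  exact (measurable_funB ma ma').
move=> xi; rewrite normr_ge0 ler_norml.
have /andP[x1 x2] := aS xi; have /andP[y1 y2] := aS' xi.
by apply/andP; split; lra.
Qed.

Lemma pt_diff_le (Z Z' P P' : R) (V W : state R) xi : Z <= Z' -> P <= P' ->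
  pt_diff Z P V W xi -> pt_diff Z' P' V W xi.
Proof.
by move=> ZZ PP [*]; split; first [exact: le_trans ZZ|exact: le_trans PP].
Qed.

(** As [q] does not decay, its difference is reached through the difference of the data and the
    increments in time, which are bounded by [N] since [S <= 1]. *)
Lemma crude_diff : \forall xi \ae mu, forall t, 0 <= t <= S ->
  [/\ 0 <= qq (X t) xi, 0 <= qq (Y t) xi &
      pt_diff (2 * A) (`|qq X0 xi - qq Y0 xi| + 2 * N xi) (X t) (Y t) xi].
Proof.
apply: aeS (aeI (aeI (controlled_tame cX) (controlled_tame cY)) (aeI (ct_bd cX) (ct_bd cY))) _.
move=> xi [[[tX bX] [tY bY]] [pX pY]] t tS; have [t0 tS'] := andP tS.
have N0 : 0 <= N xi := dominator_ge0 xi dN.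
have [zX _ _ _ _ _ uX wX hX rX] := pX t tS; have [zY _ _ _ _ _ uY wY hY rY] := pY t tS.
split; [exact (traj_q_ge0 tX tS)|exact (traj_q_ge0 tY tS)|].
have D x y : `|x| <= N xi -> `|y| <= N xi -> `|x - y| <= `|qq X0 xi - qq Y0 xi| + 2 * N xi.
  by move=> xN yN; apply: le_trans (normrB_le xN yN) _; have := normr_ge0 (qq X0 xi - qq Y0 xi); lra.
split; [|exact: D| |exact: D|exact: D|exact: D].
  by apply: le_trans (normrB_le zX zY) _; lra.
have Q (V : R -> state R) b : prim_on 0 S (fun t => qq (V t) xi) (fun s => until b s * ww (V s) xi) ->
    (forall s, 0 <= s <= S -> `|ww (V s) xi| <= N xi) -> `|qq (V t) xi - qq (V 0) xi| <= N xi.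
  move=> P wN; apply: (@le_trans _ _ (N xi * (t - 0))).
    apply: prim_on_lip (prim_on_sub (lexx 0) tS' P) _ => // s /andP[s0 st].
    by apply: until_abs_le1 => //; apply: wN; rewrite (ltW s0) (le_trans (ltW st)).
  by rewrite subr0 ler_piMr// (le_trans tS').
have QX := Q X _ (traj_q tX) (fun s sS => pb_wN (pX s sS)).
have QY := Q Y _ (traj_q tY) (fun s sS => pb_wN (pY s sS)).
rewrite -X0E -Y0E.
have -> : qq (X t) xi - qq (Y t) xi = (qq (X 0) xi - qq (Y 0) xi) + ((qq (X t) xi - qq (X 0) xi)
    - (qq (Y t) xi - qq (Y 0) xi)) by ring.
by apply: le_trans (normrD_le (lexx _) (normrB_le QX QY)) _; lra.
Qed.

Lemma rr_eq0_const : \forall xi \ae mu, forall t, 0 <= t <= S ->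
  rr (X t) xi = rr X0 xi /\ rr (Y t) xi = rr Y0 xi.
Proof.
apply: aeS (aeI (controlled_tame cX) (controlled_tame cY)) _ => xi [[tX _] [tY _]] t tS.
have t0 : 0 <= t by case/andP: tS.
rewrite /rr (sol_kk (ct_sol cX) t0) (sol_kk (ct_sol cY) t0).
by rewrite (traj_rk_const tX tS) (traj_rk_const tY tS) X0E Y0E.
Qed.

Lemma set_discrepancy_tau s : 0 <= s < S ->
  set_discrepancy [set xi | (s%:E < tau X xi)%E] [set xi | (s%:E < tau Y xi)%E] = one_stopped a a' s.
Proof.
move=> /andP[s0 sS]; apply/funext => xi; rewrite /set_discrepancy /one_stopped.
have E (W : R -> state R) : (\1_[set eta | (s%:E < tau W eta)%E] xi : R) =
    until (Order.min (stop_time W S xi) S) s.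
  rewrite indicE /until lt_min sS andbT (stop_time_gt W S0' xi (ltW sS)).
  case: (ltP s%:E (tau W xi)) => H; first by rewrite mem_set.
  by rewrite memNset//= ltNge H.
by rewrite !E.
Qed.

Variables (z0 C0 : R) (phi : R -> R).

Record close_data (X Y : state R) xi : Prop := CloseData {
  cd_zeta : `|zeta X xi - zeta Y xi| <= z0;
  cd_UU : `|UU chi X xi - UU chi Y xi| <= z0;
  cd_U : `|Ubar X xi - Ubar Y xi| <= phi xi;
  cd_q : `|qq X xi - qq Y xi| <= phi xi;
  cd_w : `|ww X xi - ww Y xi| <= phi xi;
  cd_h : `|hh X xi - hh Y xi| <= phi xi;
  cd_r : `|rbar X xi - rbar Y xi| <= phi xi;
  cd_g : `|gX X xi - gX Y xi| <= phi xi;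
  cd_kappa : (rr X xi == 0) = (rr Y xi == 0) }.

Variable eta : R.
Hypotheses (m0 : 0 < m) (eta0 : 0 < eta) (eta1 : eta <= 1)
  (etam : 100 * B ^+ 2 * eta <= m) (Seta : 3 * B ^+ 2 * S <= eta).
Hypotheses (z00 : 0 <= z0) (dphi : dominator C0 phi)
  (dc : `|cc X0 - cc Y0| <= z0) (dk : `|kk X0 - kk Y0| <= z0)
  (cd : \forall xi \ae mu, close_data X0 Y0 xi).

(** The gap of the stopping times belongs to the distance because its convolution enters the
    differences of P and Q. *)
Definition within_dist Z (Phi : R -> R) : Prop := \forall xi \ae mu,
  stop_gap xi <= Phi xi /\ forall t, 0 <= t <= S -> pt_diff Z (Phi xi) (X t) (Y t) xi.

Section Step.
Variables (Z CP : R) (Phi : R -> R).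
Hypotheses (Z0 : 0 <= Z) (dPhi : dominator CP Phi) (wd : within_dist Z Phi).

Let c40 := 40 * A ^+ 5 * expR (2 * A).
Let H := discrepancy A N Phi Z z0.
Let dH : dominator (CP + (z0 + Z) * (CN + 1)) H.
Proof. exact: dominator_discrepancy dN dPhi Z0 z00. Qed.
Let c400 : 0 <= c40.
Proof. by rewrite /c40 !mulr_ge0 ?exprn_ge0 ?expR_ge0. Qed.
Let H0 xi : 0 <= H xi := dominator_ge0 xi dH.
Let cH0 xi : 0 <= conv H xi := conv_ge0 xi dH.

Let regX s := sol_regular (ct_sol cX) (ct_c cX) (ct_k cX) (ct_bd cX) (s := s).
Let regY s := sol_regular (ct_sol cY) (ct_c cY) (ct_k cY) (ct_bd cY) (s := s).

Let pdae s : 0 <= s <= S -> \forall xi \ae mu, pt_diff Z (Phi xi) (X s) (Y s) xi.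
Proof. by move=> sS; apply: aeS wd _ => xi [_ /(_ s sS)]. Qed.

Let dcs s : 0 <= s <= S -> `|cc (X s) - cc (Y s)| <= z0.
Proof. by case/andP=> s0 _; rewrite (sol_cc (ct_sol cX) s0) (sol_cc (ct_sol cY) s0). Qed.
Let dks s : 0 <= s <= S -> `|kk (X s) - kk (Y s)| <= z0.
Proof. by case/andP=> s0 _; rewrite (sol_kk (ct_sol cX) s0) (sol_kk (ct_sol cY) s0). Qed.

(** Only the second summand depends on time; over [0, S] its convolution integrates to
    [conv stop_gap]. *)
Let p xi s : R := c40 * (H xi + conv H xi) + c40 * conv (one_stopped a a' s) xi.
Let Pi xi t : R := c40 * (H xi + conv H xi) * t + c40 * conv_stopped_int a a' xi t.

Let prim_Pi xi : prim_on 0 S (Pi xi) (p xi).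
Proof.
apply: prim_onD; first exact: prim_on_cst.
by apply: prim_onZ; exact (prim_conv_stopped ma ma' xi).
Qed.

Let PiE xi : Pi xi S - Pi xi 0 = c40 * (S * (H xi + conv H xi) + conv stop_gap xi).
Proof.
rewrite /Pi -(conv_stopped_intT ma ma' aS aS' xi); ring.
Qed.

Let stopped_conv0 s xi : 0 <= conv (one_stopped a a' s) xi.
Proof. exact: conv_ge0 (one_stopped_dominator ma ma' s). Qed.

Let p0 xi s : 0 <= p xi s.
Proof. by rewrite addr_ge0// mulr_ge0// addr_ge0. Qed.

Let conv_split s xi : 0 <= s < S ->
  conv (fun x => H x + set_discrepancy [set x | (s%:E < tau X x)%E] [set x | (s%:E < tau Y x)%E] x) xi
  = conv H xi + conv (one_stopped a a' s) xi.
Proof.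
by move=> sS; rewrite set_discrepancy_tau// (convD _ dH (one_stopped_dominator ma ma' s)).
Qed.

Let P_diff : \forall xi \ae mu, forall s, 0 <= s < S ->
  `|PmU chi (tau X) s (X s) xi - PmU chi (tau Y) s (Y s) xi| <= p xi s /\
  `|Qfun chi (tau X) s (X s) xi - Qfun chi (tau Y) s (Y s) xi|
     <= c40 * ((z0 + Z) * coreA xi + conv H xi) + c40 * conv (one_stopped a a' s) xi.
Proof.
apply: aeS (aeI (aeI (ct_bd cX) (ct_bd cY)) wd) _ => xi [[pX pY] [_ pd]] s sS.
have sS' : 0 <= s <= S by case/andP: sS => -> /ltW.
split.
  have := PmU_diff cut A1 dN dPhi (regX sS') (regY sS') Z0 z00 (dcs sS') (dks sS')
    (pdae sS') (pX s sS') (pY s sS') (pd s sS').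
  by rewrite -/c40 -/H conv_split// addrA mulrDr.
have := Qfun_diff cut A1 dN dPhi (regX sS') (regY sS') Z0 z00 (dcs sS') (dks sS')
    (pdae sS') (pX s sS') (pY s sS') (pd s sS').
by rewrite -/c40 -/H conv_split// addrA mulrDr.
Qed.

Definition gap_const : R := eta^-1 + 8 / m.
(** The improved bound of the gap: besides the data, everything carries the factor [S] gained in
    [pair_gap_small]. *)
Definition step_gap xi : R := gap_const *
  (phi xi + z0 * N xi + S * (3 * B + 2 * B * c40) * (H xi + conv H xi)).
Local Notation Psi := step_gap.

Let pair_ae : \forall xi \ae mu, close_pair S B m (phi xi) (Phi xi) (N xi) z0 (p xi) (Pi xi)
  (stop_time X S xi) (kk X0) (fun t => qq (X t) xi) (fun t => ww (X t) xi)
    (fun t => hh (X t) xi) (fun t => rbar (X t) xi) (fun t => PmU chi (tau X) t (X t) xi)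
  (stop_time Y S xi) (kk Y0) (fun t => qq (Y t) xi) (fun t => ww (Y t) xi)
    (fun t => hh (Y t) xi) (fun t => rbar (Y t) xi) (fun t => PmU chi (tau Y) t (Y t) xi).
Proof.
apply: aeS (aeI (aeI (controlled_tame cX) (controlled_tame cY)) (aeI (aeI P_diff wd)
  (aeI (aeI (ct_bd cX) (ct_bd cY)) cd))) _ => xi [[[tX tmX] [tY tmY]] [[dP [_ pd]] [[bX bY] d0]]].
split => //.
- by move=> s /dP[].
- by move=> s /pd[].
- by move=> s /pd[].
- by move=> s /pd[].
- by move=> s /pd[].
- by move=> s /bX[].
- by move=> s /bX[].
- by move=> s /bY[].
- by move=> s /bY[].
- by rewrite X0E Y0E; exact: cd_q d0.
- by rewrite X0E Y0E; exact: cd_w d0.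
- by rewrite X0E Y0E; exact: cd_h d0.
- by rewrite X0E Y0E; exact: cd_r d0.
- by rewrite X0E Y0E; exact: cd_g d0.
- by rewrite X0E Y0E; exact: cd_kappa d0.
Qed.

Let gap_conv xi : conv stop_gap xi <= conv H xi.
Proof.
apply: (conv_ae_le xi dominator_stop_gap dH).
apply: aeS wd _ => x [+ _] => /le_trans; apply.
rewrite /H /discrepancy lerDl mulr_ge0 ?addr_ge0//; first exact: (dominator_ge0 _ dN).
exact: core_ge0.
Qed.

Let B0 : 0 <= B := le_trans A0 tame_const_ge.
Let K1_0 : 0 <= 3 * B + 2 * B * c40.
Proof. by rewrite addr_ge0// !mulr_ge0. Qed.
Let N0 xi : 0 <= N xi := dominator_ge0 xi dN.
Let phi0 xi : 0 <= phi xi := dominator_ge0 xi dphi.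
Let PhiH xi : Phi xi <= H xi.
Proof. by rewrite lerDl mulr_ge0 ?addr_ge0 ?core_ge0. Qed.
Let Phi0 xi : 0 <= Phi xi := dominator_ge0 xi dPhi.
Let gap_const0 : 0 <= gap_const.
Proof. by rewrite addr_ge0 ?invr_ge0 ?divr_ge0// ltW. Qed.

Lemma dominator_step_gap : dominator (gap_const * (C0 + z0 * CN + S * (3 * B + 2 * B * c40) *
  (CP + (z0 + Z) * (CN + 1) + 2 * (CP + (z0 + Z) * (CN + 1))))) Psi.
Proof.
apply: dominatorZ => //; apply: dominatorD; first exact: dominatorD dphi (dominatorZ z00 dN).
by apply: dominatorZ; [rewrite mulr_ge0|exact: dominatorD dH (dominator_conv dH)].
Qed.

Lemma step_gap_le : \forall xi \ae mu, stop_gap xi <= Psi xi.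
Proof.
apply: aeS pair_ae _ => xi cp.
have := close_pair_gap S1 eta0 etam Seta cp; rewrite -/(a xi) -/(a' xi) -/(stop_gap xi) PiE.
move=> /le_trans; apply; rewrite /Psi -/gap_const ler_wpM2l//.
have := gap_conv xi; have h0 := H0 xi; have ch0 := cH0 xi; set W := H xi + conv H xi => cg.
(* The convolved gap may be bounded by the old majorant here, because the factor [B * S] in front is
   small. *)
have cgW : S * W + conv stop_gap xi <= 2 * W.
  have : S * W <= W by rewrite ler_piMl// addr_ge0.
  by rewrite /W; lra.
have T1 : B * S * (c40 * (S * W + conv stop_gap xi)) <= B * S * (c40 * (2 * W)).
  by rewrite ler_wpM2l ?mulr_ge0// ler_wpM2l.
have T2 : S * B * Phi xi <= S * B * W.
  by rewrite ler_wpM2l ?mulr_ge0// (le_trans (PhiH xi))// lerDl.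
have T3 : z0 * N xi * S <= z0 * N xi by rewrite ler_piMr// mulr_ge0.
by lra.
Qed.

(** The remaining estimates contain the convolved gap without a factor [S]. Bounding it by the
    improved [Psi] instead of [Phi] is what makes the step contract. *)
Let conv_gap xi : conv stop_gap xi <= conv Psi xi.
Proof. exact: conv_ae_le xi dominator_stop_gap dominator_step_gap step_gap_le. Qed.

(** [D1] stems from Q and has no pointwise [Phi]: bounds of the two convolutions make it a constant,
    suited to [zeta]. The larger [D] is for the L^2 unknowns. *)
Let D1 xi := c40 * (S * ((z0 + Z) * coreA xi + conv H xi) + conv Psi xi).
Let D xi := c40 * (S * (H xi + conv H xi) + conv Psi xi).

Let zZcore xi : 0 <= (z0 + Z) * coreA xi.
Proof. by rewrite mulr_ge0 ?addr_ge0 ?core_ge0. Qed.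

Let cPsi0 xi : 0 <= conv Psi xi := conv_ge0 xi dominator_step_gap.

Let D10 xi : 0 <= D1 xi.
Proof. by rewrite mulr_ge0// addr_ge0// mulr_ge0// addr_ge0. Qed.

Let D1D xi : D1 xi <= D xi.
Proof.
rewrite ler_wpM2l// lerD2r ler_wpM2l// lerD2r /H /discrepancy.
have := Phi0 xi; have : 0 <= (z0 + Z) * N xi by rewrite mulr_ge0// addr_ge0.
by lra.
Qed.

Let UU_close : \forall xi \ae mu, forall t, 0 <= t <= S ->
  `|(UU chi (X t) xi - UU chi (Y t) xi) - (UU chi (X 0) xi - UU chi (Y 0) xi)| <= D1 xi.
Proof.
apply: aeS P_diff _ => xi dP t /andP[t0 tS].
pose k := c40 * ((z0 + Z) * coreA xi + conv H xi).
have k0 : 0 <= k by rewrite mulr_ge0// addr_ge0.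
have PC := prim_onZ (a := 0) (b := S) c40 (prim_conv_stopped ma ma' xi).
have P1 := prim_on_sub (lexx 0) tS (prim_onB (@sol_prim_U _ _ _ _ (ct_sol cX) S xi)
  (@sol_prim_U _ _ _ _ (ct_sol cY) S xi)).
have P2 := prim_on_sub (lexx 0) tS (prim_onD (@prim_on_cst _ 0 S k) PC).
have := prim_on_abs_le t0 P1 P2 => /= /(_ _)/le_trans; apply.
  move=> s /andP[s0 st]; have [_ Q] := dP s (introT andP (conj (ltW s0) (lt_le_trans st tS))).
  by rewrite opprK addrC distrC.
have := prim_on_ge tS (prim_on_sub t0 (lexx S) PC) (C := 0) => mono0.
have TE := conv_stopped_intT ma ma' aS aS' xi.
have kt : k * t <= k * S by rewrite ler_wpM2l.
have cg : c40 * conv stop_gap xi <= c40 * conv Psi xi by rewrite ler_wpM2l.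
have {mono0} := mono0 (fun s _ => mulr_ge0 c400 (stopped_conv0 s xi)); rewrite mul0r => mono.
rewrite -/stop_gap in TE; rewrite -TE in cg.
rewrite /D1 mulrDr mulrCA -/k; move: kt cg mono; rewrite !mulrBr; lra.
Qed.

Let y_close : \forall xi \ae mu, forall t, 0 <= t <= S ->
  `|yy (X t) xi - yy (Y t) xi| <= 2 * z0 + D1 xi.
Proof.
apply: aeS (aeI UU_close cd) _ => xi [dU d0] t /andP[t0 tS].
have P1 := prim_on_sub (lexx 0) tS (prim_onB (@sol_prim_y _ _ _ _ (ct_sol cX) S xi)
  (@sol_prim_y _ _ _ _ (ct_sol cY) S xi)).
have dUU s : 0 < s < t -> `|UU chi (X s) xi - UU chi (Y s) xi| <= z0 + D1 xi.
  move=> /andP[s0 st]; have := dU s (introT andP (conj (ltW s0) (le_trans (ltW st) tS))).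
  have := cd_UU d0; rewrite -X0E -Y0E => H1 H2.
  by have := normrD_le H1 H2; rewrite addrC subrK.
have := prim_on_lip t0 P1 dUU; rewrite /= subr0 => H1.
have := cd_zeta d0; rewrite -X0E -Y0E => H2.
have -> : yy (X t) xi - yy (Y t) xi = (zeta (X 0) xi - zeta (Y 0) xi)
  + (yy (X t) xi - yy (Y t) xi - (yy (X 0) xi - yy (Y 0) xi)) by rewrite /yy; ring.
apply: le_trans (normrD_le H2 H1) _.
have : (z0 + D1 xi) * t <= z0 + D1 xi.
  by rewrite ler_piMr ?addr_ge0// (le_trans tS).
by move: z00; lra.
Qed.

(** [Ubar] follows [U] up to the change in time of the difference of the two [c chi(y)]. Off the
    core this change is zero, so the uniform error of [y] does not spoil square integrability. *)
Let chi_rate : \forall xi \ae mu, forall t, 0 <= t <= S ->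
  `|(Ubar (X t) xi - Ubar (Y t) xi) - (UU chi (X t) xi - UU chi (Y t) xi)
    - (Ubar (X 0) xi - Ubar (Y 0) xi) + (UU chi (X 0) xi - UU chi (Y 0) xi)|
  <= A ^+ 2 * D xi + 5 * A ^+ 2 * (z0 * coreA xi).
Proof.
apply: aeS (aeI (aeI y_close cd) (aeI (ct_bd cX) (ct_bd cY))) _.
move=> xi [[dy d0] [pX pY]] t tS; have t0 : 0 <= t by case/andP: tS.
have I0 : (0 : R) <= 0 <= S by rewrite lexx.
have A20 : 0 <= A ^+ 2 := sqr_ge0 A.
have -> : (Ubar (X t) xi - Ubar (Y t) xi) - (UU chi (X t) xi - UU chi (Y t) xi)
    - (Ubar (X 0) xi - Ubar (Y 0) xi) + (UU chi (X 0) xi - UU chi (Y 0) xi)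
  = (cc X0 * chi (yy (X 0) xi) - cc Y0 * chi (yy (Y 0) xi))
    - (cc X0 * chi (yy (X t) xi) - cc Y0 * chi (yy (Y t) xi)).
  rewrite /UU (sol_cc (ct_sol cX) t0) (sol_cc (ct_sol cY) t0).
  by rewrite (sol_cc (ct_sol cX) (lexx 0)) (sol_cc (ct_sol cY) (lexx 0)); ring.
have DD : 0 <= D xi := le_trans (D10 xi) (D1D xi).
have [k0|k0] := eqVneq (coreA xi) 0.
  rewrite -(core_out_dichotomy cut k0 (pb_zeta (pX 0 I0)) (pb_zeta (pX t tS))).
  rewrite -(core_out_dichotomy cut k0 (pb_zeta (pY 0 I0)) (pb_zeta (pY t tS))).
  by rewrite subrr normr0 k0 !mulr0 addr0 mulr_ge0.
have -> : coreA xi = 1 by move: k0; rewrite /core; case: ifP => //; rewrite eqxx.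
have E s : `|yy (X s) xi - yy (Y s) xi| <= 2 * z0 + D1 xi ->
    `|cc X0 * chi (yy (X s) xi) - cc Y0 * chi (yy (Y s) xi)| <= A * (A * (2 * z0 + D1 xi)) + z0 * A.
  move=> ys; apply: normr_mulB (ct_c cX) (cut0 cut _) dc _.
  by apply: le_trans (cutL0 cut _ _) _; rewrite ler_wpM2l.
have E0 : `|cc X0 * chi (yy (X 0) xi) - cc Y0 * chi (yy (Y 0) xi)| <= A * (A * z0) + z0 * A.
  apply: normr_mulB (ct_c cX) (cut0 cut _) dc _.
  apply: le_trans (cutL0 cut _ _) _; rewrite ler_wpM2l// X0E Y0E.
  have -> : yy X0 xi - yy Y0 xi = zeta X0 xi - zeta Y0 xi by rewrite /yy; ring.
  exact: cd_zeta d0.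
apply: le_trans (normrB_le E0 (E t (dy t tS))) _.
have T1 : A ^+ 2 * D1 xi <= A ^+ 2 * D xi by rewrite ler_wpM2l.
have T2 : A * z0 <= A ^+ 2 * z0 by rewrite ler_wpM2r// expr2 ler_peMr.
rewrite mulr1; move: T1 T2; rewrite expr2; lra.
Qed.

Definition step_const : R := 1 + 5 * A ^+ 2 + 3 * B + 3 * B ^+ 2 + (A ^+ 2 + 1 + 2 * B) * c40.
Let step_const_parts x : 0 <= x ->
  [/\ x <= step_const * x, x + c40 * x + (A ^+ 2 * (c40 * x) + 5 * (A ^+ 2 * x)) <= step_const * x &
      x + (3 * (B * x) + (2 * (B * (c40 * x)) + 3 * (B ^+ 2 * x))) <= step_const * x].
Proof.
move=> x0; have p1 := mulr_ge0 (sqr_ge0 A) x0; have p2 := mulr_ge0 B0 x0.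
have p3 := mulr_ge0 (sqr_ge0 B) x0; have p4 := mulr_ge0 c400 x0.
have p5 := mulr_ge0 (sqr_ge0 A) p4; have p6 := mulr_ge0 B0 p4.
have -> : step_const * x = x + 5 * (A ^+ 2 * x) + 3 * (B * x) + 3 * (B ^+ 2 * x)
   + A ^+ 2 * (c40 * x) + c40 * x + 2 * (B * (c40 * x)) by rewrite /step_const; ring.
by split; lra.
Qed.

Definition step_dist xi : R := step_const *
  (phi xi + z0 * (N xi + coreA xi) + S * (H xi + conv H xi) + (Psi xi + conv Psi xi)).

Variables (sH sP : R).
Hypotheses (cHs : forall xi, conv H xi <= sH) (cPs : forall xi, conv Psi xi <= sP).

(** The old [Phi] and [Z] enter the new bounds through [H], [Z] and [sH] with a factor [S], and
    through [Psi] and [sP], where that factor has already been gained; all else is data. *)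
Lemma within_dist_step :
  within_dist (2 * z0 + c40 * (S * (z0 + Z + sH) + sP)) step_dist.
Proof.
have A20 : 0 <= A ^+ 2 := sqr_ge0 A; have B20 : 0 <= B ^+ 2 := sqr_ge0 B.
apply: aeS (aeI (aeI pair_ae step_gap_le) (aeI (aeI y_close chi_rate) (aeI UU_close cd))) _.
move=> xi [[cp gap] [[dy dchi] [dU d0]]].
have Psi0 : 0 <= Psi xi := dominator_ge0 xi dominator_step_gap.
have W0 : 0 <= H xi + conv H xi by rewrite addr_ge0.
set x1 := phi xi; set x2 := z0 * N xi; set x3 := z0 * coreA xi; set x4 := S * (H xi + conv H xi).
have x10 : 0 <= x1 by exact: phi0.
have x20 : 0 <= x2 by rewrite mulr_ge0.
have x30 : 0 <= x3 by rewrite mulr_ge0// core_ge0.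
have x40 : 0 <= x4 by rewrite mulr_ge0.
have cP0 := cPsi0 xi.
pose sm := ((x1 + x2) + (x3 + x4)) + (conv Psi xi + Psi xi).
have smE : sm = x1 + x2 + x3 + x4 + Psi xi + conv Psi xi by rewrite /sm; ring.
have [s1 s2 s3 [s4 s5 s6]] := le_sum6 x10 x20 x30 x40 cP0 Psi0.
rewrite -/sm in s1 s2 s3 s4 s5 s6.
have s12 : x1 + x2 <= sm by rewrite /sm -addrA lerDl !addr_ge0.
have s45 : x4 + conv Psi xi <= sm.
  by rewrite (_ : sm = (x4 + conv Psi xi) + (x1 + x2 + x3 + Psi xi)) ?lerDl ?addr_ge0// /sm; ring.
have sumE : step_dist xi = step_const * sm.
  by rewrite smE /step_dist /x1 /x2 /x3 /x4; ring.
have DE : D xi = c40 * (x4 + conv Psi xi) by [].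
have Ds : D xi <= c40 * sm by rewrite DE ler_wpM2l.
have sm0 : 0 <= sm := le_trans x10 s1.
have [p1 p2 p3] := step_const_parts sm0.
split; first by rewrite sumE (le_trans gap)// (le_trans s6).
move=> t tS.
have [q w h r] := close_pair_close cp tS.
have pair_le : phi xi + ((3 * (B * Phi xi) + z0 * N xi) * S + 2 * B * (Pi xi S - Pi xi 0)
      + 3 * B ^+ 2 * stop_gap xi) <= step_dist xi.
  have T1 : S * B * Phi xi <= B * x4.
    rewrite /x4 (mulrC S B) -mulrA ler_wpM2l// ler_wpM2l//.
    by rewrite (le_trans (PhiH xi))// lerDl.
  have T2 : z0 * N xi * S <= x2 by rewrite ler_piMr// mulr_ge0.
  have T3 : B * (Pi xi S - Pi xi 0) <= B * (c40 * sm).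
    rewrite ler_wpM2l// (le_trans _ Ds)// PiE DE ler_wpM2l// lerD2l; exact: conv_gap.
  have T4 : B ^+ 2 * stop_gap xi <= B ^+ 2 * sm.
    by rewrite ler_wpM2l// (le_trans gap).
  have T5 := le_trans T1 (ler_wpM2l B0 s4).
  rewrite sumE; apply: le_trans p3.
  have T6 := lerD s12 (lerD (ler_wpM2l (ler0n R 3) T5) (lerD (ler_wpM2l (ler0n R 2) T3) (ler_wpM2l (ler0n R 3) T4))).
  apply: le_trans T6; rewrite -/x1 [leLHS](_ : _ = (x1 + z0 * N xi * S) + (3 * (S * B * Phi xi)
    + (2 * (B * (Pi xi S - Pi xi 0)) + 3 * (B ^+ 2 * stop_gap xi)))); last by ring.
  by rewrite lerD2r lerD2l.
split.
- have -> : zeta (X t) xi - zeta (Y t) xi = yy (X t) xi - yy (Y t) xi by rewrite /yy; ring.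
  apply: le_trans (dy t tS) _; rewrite lerD2l /D1 ler_wpM2l// lerD// ler_wpM2l// lerD//.
  rewrite ler_piMr ?addr_ge0//; by case/andP: (core01 A xi).
- have H1 := cd_U d0; rewrite -X0E -Y0E in H1.
  have -> : Ubar (X t) xi - Ubar (Y t) xi = (Ubar (X 0) xi - Ubar (Y 0) xi) +
   ((UU chi (X t) xi - UU chi (Y t) xi) - (UU chi (X 0) xi - UU chi (Y 0) xi)) +
   ((Ubar (X t) xi - Ubar (Y t) xi) - (UU chi (X t) xi - UU chi (Y t) xi)
    - (Ubar (X 0) xi - Ubar (Y 0) xi) + (UU chi (X 0) xi - UU chi (Y 0) xi)) by ring.
  apply: le_trans (normrD_le (normrD_le H1 (dU t tS)) (dchi t tS)) _.
  have T2 : A ^+ 2 * D xi <= A ^+ 2 * (c40 * sm) by rewrite ler_wpM2l.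
  rewrite sumE; apply: le_trans p2; rewrite -/x1 -/x3 -mulrA.
  apply: lerD; first exact: lerD s1 (le_trans (D1D xi) Ds).
  by apply: lerD => //; rewrite ler_wpM2l// ler_wpM2l.
- exact: le_trans q pair_le.
- exact: le_trans w pair_le.
- exact: le_trans h pair_le.
- exact: le_trans r pair_le.
Qed.

Definition g_const : R := 3 * B + 10 * B ^+ 2 / eta + 20 * B ^+ 2 / m.

Lemma g_close : \forall xi \ae mu, forall t, 0 <= t <= S ->
  `|gX (X t) xi - gX (Y t) xi| <= g_const * (phi xi + z0 * N xi + 4 * Phi xi).
Proof.
apply: aeS (aeI pair_ae wd) _ => xi [cp [_ pd]] t tS; have t0 : 0 <= t by case/andP: tS.
rewrite /gX (sol_kk (ct_sol cX) t0) (sol_kk (ct_sol cY) t0).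
have gE (x1 x2 x3 x4 x5 x6 x7 x8 : R) : g8 x1 x2 x3 x4 x5 x6 x7 x8 = g8 0 0 0 x4 x5 x6 x7 x8 by [].
rewrite (gE (yy (X t) xi)) (gE (yy (Y t) xi)).
apply: le_trans (close_pair_g8 eta0 etam Seta cp tS) _.
have [_ _ q w h r] := pd t tS.
rewrite /g_const ler_wpM2l ?lerD2l; first by [].
  by rewrite !addr_ge0 ?mulr_ge0// ?sqr_ge0// invr_ge0 ltW.
by lra.
Qed.

End Step.

(** * Iteration of the contraction step in L^2 *)

Section Iteration.
Local Notation c40 := (40 * A ^+ 5 * expR (2 * A)).

Definition l2_le (f : R -> R) (e : R) : Prop := (sqint f <= (e ^+ 2)%:E)%E.

Lemma l2_le_weaken f e e' : 0 <= e -> e <= e' -> l2_le f e -> l2_le f e'.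
Proof.
move=> e0 ee /le_trans; apply; rewrite lee_fin lerXn2r// nnegrE//; exact: le_trans ee.
Qed.

(** The factor 2, more than the triangle inequality costs, follows from squares alone and only
    affects constants. *)
Lemma l2_leD f g e e' : measurable_fun setT f -> measurable_fun setT g -> 0 <= e -> 0 <= e' ->
  l2_le f e -> l2_le g e' -> l2_le (fun x => f x + g x) (2 * (e + e')).
Proof.
move=> mf mg e0 e0' F G; apply: le_trans (sqintD_le mf mg F G) _.
by rewrite lee_fin; have := mulr_ge0 e0 e0'; have := sqr_ge0 e; have := sqr_ge0 e'; lra.
Qed.

Lemma l2_leZ f c e : measurable_fun setT f -> l2_le f e -> l2_le (fun x => c * f x) (c * e).
Proof. by move=> mf F; rewrite /l2_le exprMn; exact: sqintZ_le. Qed.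

Lemma l2_le_conv C f e : dominator C f -> l2_le f e -> l2_le (conv f) (2 * e).
Proof.
move=> dF F; apply: le_trans (sqint_conv_le dF F) _.
by rewrite lee_fin exprMn -natrX.
Qed.

Lemma conv_le_l2 C f e x : dominator C f -> 0 <= e -> l2_le f e -> conv f x <= 2 * e.
Proof.
move=> dF e0 F; rewrite -ler_sqr ?nnegrE ?mulr_ge0 ?(conv_ge0 _ dF)//.
apply: le_trans (conv_sup_le x dF F) _.
by rewrite exprMn ler_wpM2r ?sqr_ge0// -natrX ler_nat.
Qed.

Variables (n k del : R).
Hypotheses (n0 : 0 <= n) (k0 : 0 <= k) (lN : l2_le N n) (lcore : l2_le coreA k)
  (del0 : 0 < del) (lphi : l2_le phi del) (zdel : z0 <= del).

(** One number for the uniform and the L^2 part. The sup bound [CP] may change from step to step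
    without affecting [e]. *)
Definition within (e : R) : Prop := exists Z CP Phi,
  [/\ 0 <= Z <= e, dominator CP Phi, l2_le Phi e & within_dist Z Phi].

Lemma withinI e Z CP Phi : 0 <= Z <= e -> dominator CP Phi -> l2_le Phi e ->
  within_dist Z Phi -> within e.
Proof. by move=> *; exists Z, CP, Phi. Qed.

(** [KH] bounds the L^2 norm of [H] relative to [del + e], and [Kp] that of [Psi] relative to
    [del + S * e]. [Ke] and [KZ] do the latter for the new majorant and the new constant. *)
Let KH : R := 2 + 4 * (n + k).
Let K1 : R := 3 * B + 2 * B * c40.
Let Kp : R := gap_const * (4 * (1 + n) + 12 * K1 * KH).
Let Ke : R := step_const * (8 * (1 + 2 * (n + k)) + 24 * KH + 12 * Kp).
Let KZ : R := 2 + c40 * (1 + 2 * KH + 2 * Kp).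
Definition contraction_const : R := Ke + KZ.

Let B0 : 0 <= B := le_trans A0 tame_const_ge.
Let c400 : 0 <= c40.
Proof. by rewrite !mulr_ge0 ?exprn_ge0 ?expR_ge0. Qed.
Let K10 : 0 <= K1. Proof. by rewrite addr_ge0// !mulr_ge0. Qed.
Let KH0 : 0 <= KH. Proof. by rewrite !addr_ge0// mulr_ge0// addr_ge0. Qed.
Let gc0 : 0 <= gap_const.
Proof. by rewrite addr_ge0 ?invr_ge0 ?divr_ge0// ltW. Qed.
Let Kp0 : 0 <= Kp.
Proof. by rewrite mulr_ge0// addr_ge0// !mulr_ge0// addr_ge0. Qed.
Let sc0 : 0 <= step_const.
Proof. by rewrite /step_const !addr_ge0// !mulr_ge0// ?sqr_ge0// !addr_ge0 ?sqr_ge0// mulr_ge0. Qed.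
Let Ke0 : 0 <= Ke.
Proof.
have nk : 0 <= 2 * (n + k) by rewrite mulr_ge0// addr_ge0.
by rewrite mulr_ge0// addr_ge0 ?mulr_ge0// addr_ge0 ?mulr_ge0// addr_ge0.
Qed.
Let KZ0 : 0 <= KZ.
Proof. by rewrite addr_ge0// mulr_ge0// !addr_ge0// mulr_ge0. Qed.

Lemma contraction_const_ge0 : 0 <= contraction_const.
Proof. exact: addr_ge0. Qed.

Lemma within_step e : 0 <= e -> within e -> within (contraction_const * (del + S * e)).
Proof.
move=> e0 [Z [CP [Phi [/andP[Z0 Ze] dPhi lPhi wd]]]].
have d0 := ltW del0.
pose H := discrepancy A N Phi Z z0; pose Psi := step_gap Z Phi.
have dH : dominator _ H := dominator_discrepancy A dN dPhi Z0 z00.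
have dPsi : dominator _ Psi := dominator_step_gap Z0 dPhi.
have dcore := dominator_core A.
pose w := del + S * e.
have Se0 : 0 <= S * e by rewrite mulr_ge0.
have w0 : 0 <= w by rewrite addr_ge0.
have dw : del <= w by rewrite lerDl.
pose h := KH * (del + e).
have h0 : 0 <= h by rewrite mulr_ge0// addr_ge0.
have lH : l2_le H h.
  have l1 := l2_leZ (z0 + Z) (dominatorD dN dcore).1 (l2_leD dN.1 dcore.1 n0 k0 lN lcore).
  have nk0 : 0 <= 2 * (n + k) by rewrite mulr_ge0// addr_ge0.
  have zZ0 : 0 <= z0 + Z by exact: addr_ge0.
  have l2 := l2_leD dPhi.1 (dominatorZ zZ0 (dominatorD dN dcore)).1 e0 (mulr_ge0 zZ0 nk0) lPhi l1.
  apply: l2_le_weaken l2; first by rewrite mulr_ge0// addr_ge0// mulr_ge0.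
  have : (z0 + Z) * (2 * (n + k)) <= (del + e) * (2 * (n + k)) by rewrite ler_wpM2r// lerD.
  by rewrite /h /KH; lra.
(* As [S <= 1], the data in [S * (del + e)] may lose their factor: it is at most [del + S * e]. *)
have Sh : S * h <= KH * w.
  rewrite /h mulrCA ler_wpM2l// /w mulrDr lerD2r ler_piMl//.
have lW : l2_le (fun x => H x + conv H x) (2 * (h + 2 * h)).
  apply: l2_leD => //; [exact: dH.1|exact: (dominator_conv dH).1|by rewrite mulr_ge0|exact: l2_le_conv dH lH].
have dW := dominatorD dH (dominator_conv dH).
have ch0 : 0 <= 2 * (h + 2 * h) by rewrite mulr_ge0// addr_ge0// mulr_ge0.
pose ps := Kp * w.
have ps0 : 0 <= ps by rewrite mulr_ge0.
have lPsi : l2_le Psi ps.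
  have l1 := l2_leZ z0 dN.1 lN.
  have l2 := l2_leD dphi.1 (dominatorZ z00 dN).1 d0 (mulr_ge0 z00 n0) lphi l1.
  have SK0 : 0 <= S * K1 by rewrite mulr_ge0.
  have l3 := l2_leZ (S * K1) dW.1 lW.
  have zn0 : 0 <= 2 * (del + z0 * n) by rewrite mulr_ge0// addr_ge0// mulr_ge0.
  have l4 := l2_leD (dominatorD dphi (dominatorZ z00 dN)).1 (dominatorZ SK0 dW).1 zn0 (mulr_ge0 SK0 ch0) l2 l3.
  have l5 := l2_leZ gap_const (dominatorD (dominatorD dphi (dominatorZ z00 dN)) (dominatorZ SK0 dW)).1 l4.
  apply: l2_le_weaken l5.
    by rewrite mulr_ge0// mulr_ge0// addr_ge0// mulr_ge0.
  rewrite /ps /Kp -[leRHS]mulrA ler_wpM2l//.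
  have T1 : z0 * n <= w * n by rewrite ler_wpM2r// (le_trans zdel).
  have T2 : K1 * (S * h) <= K1 * (KH * w) by rewrite ler_wpM2l.
  by lra.
have lcPsi : l2_le (fun x => Psi x + conv Psi x) (2 * (ps + 2 * ps)).
  apply: l2_leD => //; [exact: dPsi.1|exact: (dominator_conv dPsi).1|by rewrite mulr_ge0|exact: l2_le_conv dPsi lPsi].
have dcPsi := dominatorD dPsi (dominator_conv dPsi).
have W := within_dist_step Z0 dPhi wd (sH := 2 * h) (sP := 2 * ps).
have {}W := W (fun xi => conv_le_l2 xi dH h0 lH) (fun xi => conv_le_l2 xi dPsi ps0 lPsi).
have dM := dominatorZ S0' dW.
have dNc := dominatorZ z00 (dominatorD dN dcore).
have dpN := dominatorD dphi dNc.
have dT := dominatorZ sc0 (dominatorD (dominatorD dpN dM) dcPsi).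
apply: (withinI (Z := 2 * z0 + c40 * (S * (z0 + Z + 2 * h) + 2 * ps)) (Phi := step_dist Z Phi) _ dT) => //.
- apply/andP; split.
    have X1 : 0 <= S * (z0 + Z + 2 * h) by rewrite mulr_ge0// !addr_ge0// mulr_ge0.
    have X2 : 0 <= 2 * ps by rewrite mulr_ge0.
    have := mulr_ge0 c400 (addr_ge0 X1 X2).
    by move: z00; lra.
  have T1 : S * (z0 + Z + 2 * h) <= w + 2 * (KH * w).
    have : S * z0 <= del by apply: le_trans zdel; rewrite ler_piMl.
    have : S * Z <= S * e by rewrite ler_wpM2l.
    by rewrite /w in Sh *; lra.
  have T2 : c40 * (S * (z0 + Z + 2 * h) + 2 * ps) <= c40 * ((1 + 2 * KH + 2 * Kp) * w).
    by rewrite ler_wpM2l// /ps; lra.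
  apply: (@le_trans _ _ (KZ * w)).
    have -> : KZ * w = 2 * w + c40 * ((1 + 2 * KH + 2 * Kp) * w) by rewrite /KZ; ring.
    by rewrite lerD// ler_wpM2l// (le_trans zdel).
  by rewrite ler_wpM2r// lerDr.
- have nk0 : 0 <= 2 * (n + k) by rewrite mulr_ge0// addr_ge0.
  have l1 := l2_leZ z0 (dominatorD dN dcore).1 (l2_leD dN.1 dcore.1 n0 k0 lN lcore).
  have l2 := l2_leD dphi.1 dNc.1 d0 (mulr_ge0 z00 nk0) lphi l1.
  have l3 := l2_leZ S dW.1 lW.
  have x2 : 0 <= 2 * (del + z0 * (2 * (n + k))) by rewrite mulr_ge0// addr_ge0// mulr_ge0.
  have x3 : 0 <= S * (2 * (h + 2 * h)) by rewrite mulr_ge0.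
  have l4 := l2_leD dpN.1 dM.1 x2 x3 l2 l3.
  have x4 : 0 <= 2 * (2 * (del + z0 * (2 * (n + k))) + S * (2 * (h + 2 * h))) by rewrite mulr_ge0// addr_ge0.
  have x5 : 0 <= 2 * (ps + 2 * ps) by rewrite mulr_ge0// addr_ge0// mulr_ge0.
  have l5 := l2_leD (dominatorD dpN dM).1 dcPsi.1 x4 x5 l4 lcPsi.
  have l6 := l2_leZ step_const (dominatorD (dominatorD dpN dM) dcPsi).1 l5.
  apply: l2_le_weaken l6; first by rewrite mulr_ge0// mulr_ge0// addr_ge0.
  apply: (@le_trans _ _ (Ke * w)); last by rewrite ler_wpM2r// lerDl.
  rewrite /Ke -[leRHS]mulrA ler_wpM2l//.
  have T1 : z0 * (2 * (n + k)) <= w * (2 * (n + k)) by rewrite ler_wpM2r// (le_trans zdel).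
  by rewrite /ps; lra.
Qed.

Hypothesis Scontr : S * contraction_const <= 2^-1.

(** One step halves the excess over [2 * contraction_const * del]. After finitely many the trace of
    [e0] is below [del], which has to be positive for this. *)
Lemma within_iterate e0 : 0 <= e0 -> within e0 -> within (3 * contraction_const * del + del).
Proof.
move=> e00 W0; have d0 := ltW del0; have K0 := contraction_const_ge0.
have mono e e' : 0 <= e -> e <= e' -> within e -> within e'.
  move=> e1 ee [Z [CP [Phi [/andP[Z0 Ze] dPhi lPhi wd]]]]; exists Z, CP, Phi; split => //.
    by rewrite Z0 (le_trans Ze).
  exact: l2_le_weaken lPhi.
have It j : within (2 * contraction_const * del + e0 / 2 ^+ j).
  elim: j => [|j IH].
    by apply: mono W0 => //; rewrite expr0 divr1 lerDr !mulr_ge0.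
  have p0 : 0 <= e0 / 2 ^+ j by rewrite divr_ge0// exprn_ge0.
  have q0 : 0 <= 2 * contraction_const * del + e0 / 2 ^+ j by rewrite addr_ge0// !mulr_ge0.
  have := within_step q0 IH; apply: mono; first by rewrite mulr_ge0// addr_ge0// mulr_ge0.
  have := ler_wpM2r q0 Scontr; rewrite exprSr invfM mulrA; lra.
have [j jle] : exists j : nat, e0 / 2 ^+ j <= del.
  have /cvgrPdist_le/(_ del del0) : e0 * 2^-1 ^+ j @[j --> \oo] --> e0 * 0.
    by apply: cvgMr; apply: cvg_expr; rewrite ger0_norm ?invr_ge0// invf_lt1// ltr1n.
  rewrite mulr0; move=> [j _ /(_ j (leqnn j))]; rewrite sub0r normrN => H; exists j.
  by apply: le_trans H; rewrite -exprVn ler_norm.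
apply: mono (It j); first by rewrite addr_ge0 ?divr_ge0 ?exprn_ge0// !mulr_ge0.
by have := mulr_ge0 K0 d0; lra.
Qed.

(** Since [e0] disappears in the iteration, any finite value will do. The gap, at most 1, is made
    square integrable by the bound [2 / m * N]. *)
Lemma within_start : exists e0, 0 <= e0 /\ within e0.
Proof.
have d0 := ltW del0.
have c0 : 0 <= 2 + 2 / m by rewrite addr_ge0// divr_ge0// ltW.
exists (2 * (del + (2 + 2 / m) * n) + 2 * A); split.
  by rewrite addr_ge0 ?mulr_ge0// addr_ge0// mulr_ge0.
apply: (withinI (Z := 2 * A) _ (dominatorD dphi (dominatorZ c0 dN))).
- rewrite mulr_ge0// lerDr mulr_ge0// addr_ge0// mulr_ge0//.
- have := l2_leD dphi.1 (dominatorZ c0 dN).1 d0 (mulr_ge0 c0 n0) lphi (l2_leZ _ dN.1 lN).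
  apply: l2_le_weaken; first by rewrite mulr_ge0// addr_ge0// mulr_ge0.
  by rewrite lerDl mulr_ge0.
apply: aeS (aeI (aeI (controlled_tame cX) (controlled_tame cY)) (aeI (aeI cd crude_diff) (aeI (ct_bd cX) (ct_bd cY)))) _.
move=> xi [[[tX bX] [tY bY]] [[d cr] [pX pY]]].
have N0 : 0 <= N xi := dominator_ge0 xi dN; have p0 : 0 <= phi xi := dominator_ge0 xi dphi.
have mi0 : 0 <= 2 / m * N xi by rewrite mulr_ge0// divr_ge0// ltW.
have B1 : 1 <= B := tame_B bX.
have eta_le : eta <= B ^+ 2 * eta by rewrite ler_peMl ?(ltW eta0)// exprn_ege1.
(* At a stop q = 0, hence h >= m / 2 there, which bounds N from below. *)
have stopped b l q w h r P : trajectory S b l q w h r P -> tame S B m l q w h r P ->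
    (forall t, 0 <= t <= S -> `|h t| <= N xi) -> b <= S -> 1 <= 2 / m * N xi.
  move=> tr bd hN bS; have I : 0 <= b <= S by rewrite (traj_ge0 tr).
  have := traj_sum_lb tr bd I; rewrite (traj_stop tr bS) add0r => lb.
  have := hN b I; rewrite ler_norml => /andP[_ hb].
  rewrite mulrAC ler_pdivlMr// mul1r.
  by move: etam Seta eta_le m0 => X1 X2 X3 X4; lra.
split.
  have [gp|gp] := ltP 0 (stop_gap xi); last by apply: le_trans gp _; rewrite addr_ge0// mulr_ge0.
  have g1 : stop_gap xi <= 1 by apply: le_trans (dominator_le xi dominator_stop_gap) S1.
  suff : 1 <= 2 / m * N xi by rewrite mulrDl; lra.
  have [aS1|Sa] := leP (stop_time X S xi) S.
    by apply: stopped tX bX _ aS1 => t /pX[].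
  have [aS2|Sa2] := leP (stop_time Y S xi) S.
    by apply: stopped tY bY _ aS2 => t /pY[].
  by move: gp; rewrite /stop_gap /a /a' (min_r (ltW Sa)) (min_r (ltW Sa2)) subrr normr0 ltxx.
move=> t tS; have [_ _] := cr t tS; apply: pt_diff_le => //.
by have := cd_q d; rewrite mulrDl; lra.
Qed.

Lemma solutions_close t : 0 <= t <= S -> let e := (3 * contraction_const + 1) * del in
  [/\ \forall xi \ae mu, `|zeta (X t) xi - zeta (Y t) xi| <= e,
      l2_le (fun xi => Ubar (X t) xi - Ubar (Y t) xi) e,
      l2_le (fun xi => qq (X t) xi - qq (Y t) xi) e &
  [/\ l2_le (fun xi => ww (X t) xi - ww (Y t) xi) e,
      l2_le (fun xi => hh (X t) xi - hh (Y t) xi) e,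
      l2_le (fun xi => rbar (X t) xi - rbar (Y t) xi) e &
      measurable_fun setT (fun xi => gX (X t) xi - gX (Y t) xi) ->
      l2_le (fun xi => gX (X t) xi - gX (Y t) xi) (g_const * (2 * (2 * (del + z0 * n) + 4 * e)))]].
Proof.
move=> tS e; have [t0 _] := andP tS; have d0 := ltW del0.
have [e1 [e10 w1]] := within_start.
have [Z [CP [Phi [/andP[Z0 Ze] dPhi lPhi wd]]]] := within_iterate e10 w1.
have eE : 3 * contraction_const * del + del = e by rewrite /e; ring.
rewrite eE in Ze lPhi.
have [mzX mUX mwX mhX mrX] := sol_measurable (ct_sol cX) t0.
have [mzY mUY mwY mhY mrY] := sol_measurable (ct_sol cY) t0.
have mqX := measurable_qq (ct_sol cX) t0; have mqY := measurable_qq (ct_sol cY) t0.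
have L (f g : R -> R) : measurable_fun setT f -> measurable_fun setT g ->
    (\forall xi \ae mu, `|f xi - g xi| <= Phi xi) -> l2_le (fun xi => f xi - g xi) e.
  move=> mf mg H; apply: le_trans lPhi; apply: sqint_le => //; last exact: dPhi.1.
  exact (measurable_funB mf mg).
have pd : \forall xi \ae mu, pt_diff Z (Phi xi) (X t) (Y t) xi.
  by apply: aeS wd _ => xi [_ /(_ t tS)].
split.
- by apply: aeS pd _ => xi [z _ _ _ _ _]; apply: le_trans z Ze.
- by apply: L => //; apply: aeS pd _ => xi [].
- by apply: L => //; apply: aeS pd _ => xi [].
split.
- by apply: L => //; apply: aeS pd _ => xi [].
- by apply: L => //; apply: aeS pd _ => xi [].
- by apply: L => //; apply: aeS pd _ => xi [].
move=> mg.
have dzN := dominatorZ z00 dN; have d4 := dominatorZ (_ : 0 <= 4) dPhi.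
have e0 : 0 <= e by rewrite mulr_ge0// addr_ge0// mulr_ge0// contraction_const_ge0.
have z1 : 0 <= z0 * n by exact: mulr_ge0.
have l1 := l2_leD dphi.1 dzN.1 d0 z1 lphi (l2_leZ z0 dN.1 lN).
have z2 : 0 <= 2 * (del + z0 * n) by rewrite mulr_ge0// addr_ge0.
have z4 : 0 <= 4 * e by rewrite mulr_ge0.
have dd := dominatorD (dominatorD dphi dzN) (d4 (ler0n _ _)).
have l2 := l2_leD (dominatorD dphi dzN).1 (d4 (ler0n _ _)).1 z2 z4 l1 (l2_leZ 4 dPhi.1 lPhi).
apply: le_trans (l2_leZ g_const dd.1 l2).
apply: sqint_le => //; first by apply: measurable_funM => //; exact: dd.1.
by apply: aeS (g_close Z0 dPhi wd) _ => xi /(_ t tS).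
Qed.

End Iteration.
End PairOfSolutions.

(** * Passage between the metric and bounds almost everywhere *)

Section MetricBounds.
Variable R : realType.
Local Notation mu := (@lebesgue_measure R).
Implicit Types (f g u : R -> R) (X Y : state R) (a b c d x : R).

Lemma weak_derivB f g f' g' : weak_deriv f g -> weak_deriv f' g' ->
  weak_deriv (fun x => f x - f' x) (fun x => g x - g' x).
Proof.
move=> H H' a b ab.
have P (u v : R -> R) : weak_deriv u v -> prim_on a b u v by move=> uv s t _ st _; exact: uv.
exact: prim_onB (P _ _ H) (P _ _ H') a b (lexx _) ab (lexx _).
Qed.

(** Chebyshev on an interval of length 1: values above [2 * d] throughout would give a square
    integral of at least [4 * d ^+ 2]. The property [P] keeps the point off a null set. *)
Lemma exists_small_value u b d : measurable_fun setT u -> 0 < d -> (sqint u <= (d ^+ 2)%:E)%E ->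
  forall P : R -> Prop, (\forall x \ae mu, P x) -> exists a, [/\ b <= a <= b + 1, `|u a| <= 2 * d & P a].
Proof.
move=> mu_ d0 ud P aeP; apply: contrapT => nex.
have H : \forall x \ae mu, `|2 * d * \1_`[b, b + 1] x| <= `|u x|.
  apply: aeS aeP _ => x Px; rewrite indicE; case: (boolP (x \in _)) => [|_]; last by rewrite mulr0 normr0.
  rewrite inE/= in_itv/= => xb; rewrite mulr1 ger0_norm ?mulr_ge0 ?ltW//.
  by rewrite ltNge; apply/negP => ux; apply: nex; exists x.
have m1 : measurable_fun setT (\1_`[b, b + 1] : R -> R) by exact: measurable_indic.
have mn : measurable_fun setT (fun x => `|u x|) by apply: measurableT_comp.
have := sqint_le (measurable_funM (measurable_cst (2 * d)) m1) mn H.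
have -> : sqint (fun x => `|u x|) = sqint u.
  by rewrite /sqint; under eq_integral do rewrite real_normK ?num_real//.
rewrite leNgt => /negP; apply; apply: le_lt_trans ud _.
rewrite (sqintZ _ m1) /sqint.
have E x : ((\1_`[b, b + 1] x : R) ^+ 2)%:E = (\1_`[b, b + 1] x)%:E.
  by rewrite indicE; case: (x \in _); rewrite ?expr1n ?expr0n.
under eq_integral do rewrite E.
have muE : mu `[b, b + 1] = 1%E.
  by rewrite lebesgue_measure_itv/= lte_fin ltrDl ltr01 -EFinD; congr EFin; ring.
rewrite integral_indic// setIT [X in (_ < _ * X)%E]muE mule1 lte_fin exprMn -natrX.
by rewrite ltr_pMl ?exprn_gt0// ltr1n.
Qed.

(* On an interval of length at most one, [|g| <= d / 2 + g ^ 2 / (2 d)]. *)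
Lemma weak_deriv_increment f g a b d : a <= b <= a + 1 -> 0 < d -> weak_deriv f g ->
  measurable_fun setT g -> (sqint g <= (d ^+ 2)%:E)%E -> `|f b - f a| <= d.
Proof.
move=> /andP[ab ba] d0 fg mg gd; have [ig ->] := fg a b ab.
have mI : measurable (`[a, b] : set (measurableTypeR R)) by [].
apply: le_trans (le_normr_Rintegral mI ig) _.
have mg2 : measurable_fun setT (fun x => (g x ^+ 2)%:E) by exact: measurable_sq.
have i2 : mu.-integrable setT (EFin \o (fun x => g x ^+ 2)).
  apply/integrableP; split; first exact: mg2.
  under eq_integral do rewrite /= ger0_norm ?sqr_ge0//.
  exact: le_lt_trans gd (ltry _).
have iI : mu.-integrable `[a, b] (EFin \o (fun x => g x ^+ 2)) by apply: integrableS i2.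
have ic (c : R) : mu.-integrable `[a, b] (EFin \o (fun=> c)) by exact: integrable_itv_cst.
pose F x := d / 2 + (2 * d)^-1 * g x ^+ 2.
have iZ : mu.-integrable `[a, b] (EFin \o (fun x => (2 * d)^-1 * g x ^+ 2)).
  by have := integrableZl mI (2 * d)^-1 iI.
have iF : mu.-integrable `[a, b] (EFin \o F) by apply: eq_integrable (integrableD _ (ic (d / 2)) iZ).
apply: (@le_trans _ _ (\int[mu]_(x in `[a, b]) F x)).
  apply: le_Rintegral => //; first exact: integrable_norm ig.
  move=> x _; rewrite /F.
  have -> : d / 2 + (2 * d)^-1 * g x ^+ 2 = (2 * d)^-1 * (d ^+ 2 + g x ^+ 2).
    by field; rewrite gt_eqF.
  rewrite -ler_pdivrMl ?invr_gt0 ?mulr_gt0// invrK -[g x ^+ 2]real_normK ?num_real//.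
  by have := sqr_ge0 (d - `|g x|); lra.
have ZE : \int[mu]_(x in `[a, b]) ((2 * d)^-1 * g x ^+ 2) = (2 * d)^-1 * \int[mu]_(x in `[a, b]) (g x ^+ 2).
  by rewrite RintegralZl.
rewrite RintegralD// ZE.
have c1 : \int[mu]_(x in `[a, b]) (d / 2) <= d / 2.
  have [_ <-] := @prim_on_cst R a b (d / 2) a b (lexx _) ab (lexx _).
  have ba1 : b - a <= 1 by lra.
  have d2 : 0 <= d / 2 by rewrite divr_ge0// ltW.
  by have := ler_wpM2l d2 ba1; rewrite mulrBr mulr1.
have c2 : \int[mu]_(x in `[a, b]) (g x ^+ 2) <= d ^+ 2.
  rewrite -lee_fin /Rintegral fineK; last exact: integrable_fin_num.
  apply: le_trans gd; apply: ge0_subset_integral => //.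
  - by move=> x _; rewrite lee_fin sqr_ge0.
have : (2 * d)^-1 * \int[mu]_(x in `[a, b]) (g x ^+ 2) <= (2 * d)^-1 * d ^+ 2.
  by rewrite ler_wpM2l// invr_ge0 mulr_ge0// ltW.
have -> : (2 * d)^-1 * d ^+ 2 = d / 2 by field; rewrite gt_eqF.
by move=> c3; rewrite [leRHS]splitr; exact: lerD.
Qed.

(** A Sobolev bound for the difference [f] of two [U]. Not [f] but the difference [u] of the [Ubar]
    is in L^2; the part [c chi(y)] is accounted for by the constant [c]. *)
Lemma sup_le_of_l2 f g u c d : 0 < d -> weak_deriv f g -> measurable_fun setT g ->
  measurable_fun setT u -> (sqint g <= (d ^+ 2)%:E)%E -> (sqint u <= (d ^+ 2)%:E)%E ->
  (\forall x \ae mu, `|f x| <= `|u x| + c) -> forall b, `|f b| <= 3 * d + c.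
Proof.
move=> d0 fg mg mu_ gd ud fu b.
have [a [/andP[ba ab] ua fa]] := exists_small_value b mu_ d0 ud fu.
have H := weak_deriv_increment (introT andP (conj ba ab)) d0 fg mg gd.
have -> : f b = f a - (f a - f b) by ring.
by apply: le_trans (normrB_le fa H) _; lra.
Qed.

Lemma measurable_rr X : measurable_fun setT (rbar X) -> measurable_fun setT (qq X) ->
  measurable_fun setT (rr X).
Proof. by move=> mr mq; apply: measurable_funD => //; apply: measurable_funM. Qed.

Lemma measurable_rr_neq X Y : measurable_fun setT (rr X) -> measurable_fun setT (rr Y) ->
  measurable ([set xi | (rr X xi == 0) != (rr Y xi == 0)] : set (measurableTypeR R)).
Proof.
move=> mX mY.
have E (f : R -> R) : measurable_fun setT f -> measurable ([set xi | f xi == 0] : set (measurableTypeR R)).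
  move=> mf; rewrite (_ : [set _ | _] = f @^-1` [set 0]).
    by rewrite -[X in measurable X]setTI; exact: mf.
  by apply/seteqP; split => x /= /eqP.
rewrite (_ : [set _ | _] = ([set xi | rr X xi == 0] `\` [set xi | rr Y xi == 0]) `|`
   ([set xi | rr Y xi == 0] `\` [set xi | rr X xi == 0])).
  by apply: measurableU; apply: measurableD; exact: E.
apply/seteqP; split => x /=; last by case=> -[-> /negP/negbTE ->].
case: (boolP (rr X x == 0)) => e1; case: (boolP (rr Y x == 0)) => e2 // _.
  by left; split => //; exact/negP.
by right; split => //; exact/negP.
Qed.

Lemma kappa_eq0P X Y : measurable_fun setT (rr X) -> measurable_fun setT (rr Y) ->
  kappa X Y = 0 <-> \forall xi \ae mu, (rr X xi == 0) = (rr Y xi == 0).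
Proof.
move=> mX mY; have mD := measurable_rr_neq mX mY; rewrite /kappa; split.
  case: ifPn => [_ /eqP|]; first by rewrite oner_eq0.
  rewrite -leNgt measure_le0 => /eqP mu0 _.
  exists [set xi | (rr X xi == 0) != (rr Y xi == 0)]; split => //.
  by move=> x /= H; apply/eqP.
move=> [B [mB B0 sB]]; case: ifPn => // /negP; case; apply/negP; rewrite -leNgt.
rewrite -B0; apply: le_measure; rewrite ?inE// => x /= H; apply: sB => E.
by move: H; rewrite E eqxx.
Qed.

Lemma kappa01 X Y : 0 <= kappa X Y <= 1.
Proof. by rewrite /kappa; case: ifP; rewrite lexx ler01. Qed.

Lemma dR_components X Y d : (dR X Y <= d%:E)%E ->
  [/\ (Linfnorm (fun xi => (zeta X xi - zeta Y xi)%R) <= d%:E)%E,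
      (L2norm (fun xi => (Ubar X xi - Ubar Y xi)%R) <= d%:E)%E, `|cc X - cc Y| <= d,
      (L2norm (fun xi => (vv X xi - vv Y xi)%R) <= d%:E)%E &
  [/\ (L2norm (fun xi => (ww X xi - ww Y xi)%R) <= d%:E)%E,
      (L2norm (fun xi => (hh X xi - hh Y xi)%R) <= d%:E)%E,
      (L2norm (fun xi => (rbar X xi - rbar Y xi)%R) <= d%:E)%E, `|kk X - kk Y| <= d &
      (L2norm (fun xi => (gX X xi - gX Y xi)%R) <= d%:E)%E /\ kappa X Y <= d]].
Proof.
have nn (x : R) : (0 <= `|x|%:E)%E by rewrite lee_fin.
have k0 : (0 <= (kappa X Y)%:E)%E by rewrite lee_fin; case/andP: (kappa01 X Y).
have P := (Linfnorm_ge0, L2norm_ge0, nn, k0).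
rewrite /dR /Vnorm_diff => H.
have [||H0 k] := leeD_le H; [by do ?apply: adde_ge0; rewrite ?P|by rewrite ?P|].
have [||H1 g] := leeD_le H0; [by do ?apply: adde_ge0; rewrite ?P|by rewrite ?P|].
have [||H2 kk'] := leeD_le H1; [by do ?apply: adde_ge0; rewrite ?P|by rewrite ?P|].
have [||H3 r] := leeD_le H2; [by do ?apply: adde_ge0; rewrite ?P|by rewrite ?P|].
have [||H4 h] := leeD_le H3; [by do ?apply: adde_ge0; rewrite ?P|by rewrite ?P|].
have [||H5 w] := leeD_le H4; [by do ?apply: adde_ge0; rewrite ?P|by rewrite ?P|].
have [||H6 v] := leeD_le H5; [by do ?apply: adde_ge0; rewrite ?P|by rewrite ?P|].
have [||H7 c] := leeD_le H6; [by do ?apply: adde_ge0; rewrite ?P|by rewrite ?P|].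
have [z U] := leeD_le H7 (Linfnorm_ge0 _) (L2norm_ge0 _).
by split => //; split.
Qed.

Lemma dR_le X Y a b c d : 0 <= a -> 0 <= b ->
  (\forall xi \ae mu, `|zeta X xi - zeta Y xi| <= a) ->
  `|cc X - cc Y| <= c -> `|kk X - kk Y| <= c -> kappa X Y <= d ->
  l2_le (fun xi => Ubar X xi - Ubar Y xi) a -> l2_le (fun xi => qq X xi - qq Y xi) a ->
  l2_le (fun xi => ww X xi - ww Y xi) a -> l2_le (fun xi => hh X xi - hh Y xi) a ->
  l2_le (fun xi => rbar X xi - rbar Y xi) a -> l2_le (fun xi => gX X xi - gX Y xi) b ->
  (dR X Y <= (6 * a + 2 * c + b + d)%:E)%E.
Proof.
move=> a0 b0 z dc dk k U q w h r g.
have q' : l2_le (fun xi => vv X xi - vv Y xi) a.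
  by move: q; congr (_ <= _)%E; congr sqint; apply/funext => x; rewrite /vv; ring.
have zL := (Linfnorm_leP _ _).2 z.
have L f c' : 0 <= c' -> l2_le f c' -> (L2norm f <= c'%:E)%E by move=> c0 /(L2norm_leP _ c0).
apply: (@le_trans _ _ ((a%:E + a%:E + c%:E + a%:E + a%:E + a%:E + a%:E + c%:E) + b%:E + d%:E)%E).
  rewrite /dR /Vnorm_diff.
  by do ?apply: leeD; rewrite ?lee_fin//; exact: L.
by rewrite -!EFinD lee_fin le_eqVlt; apply/orP; left; apply/eqP; ring.
Qed.

(* Off [Omega_1] one has [g = q + h]; on it, [|w| + 2 |r k| + 2 q <= q + h]. *)
Lemma gX_near_g2 X xi : 0 <= qq X xi -> `|gX X xi - (qq X xi + hh X xi)| <= `|hh X xi|.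
Proof.
move=> q0; rewrite /gX /g8; case: ifPn => [/and3P[g12 _ _]|_]; last first.
  by rewrite /g2 subrr normr0.
move: g12; rewrite /g1 /g2 => g12.
have := normr_ge0 (ww X xi); have := normr_ge0 (rbar X xi * kk X); have := ler_norm (hh X xi).
by rewrite ler_norml => X1 X2 X3; apply/andP; split; lra.
Qed.

End MetricBounds.

(** * Measurability of the components of a state and of g *)

Section StateMeasurability.
Variable R : realType.
Implicit Types (X : state R).

Lemma inVbar_measurable X : inVbar X ->
  [/\ measurable_fun setT (zeta X), measurable_fun setT (Ubar X), measurable_fun setT (qq X) &
  [/\ measurable_fun setT (ww X), measurable_fun setT (hh X) & measurable_fun setT (rbar X)]].
Proof.
move=> [[mz _] [[[mU _] _] [[[mv _] _] [[[mw _] _] [[[mh _] _] [[mr _] _]]]]]].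
split => //.
have -> : qq X = (fun xi => vv X xi + 1) by apply/funext => xi; rewrite /vv subrK.
exact: measurable_funD.
Qed.

Lemma measurable_gX X : inVbar X -> measurable_fun setT (gX X).
Proof.
move=> /inVbar_measurable[_ _ mq [mw mh mr]].
have mrk : measurable_fun setT (fun x => rbar X x * kk X) by apply: measurable_funM.
have m1 : measurable_fun setT (fun x => `|ww X x| + 2 * `|rbar X x * kk X| + 2 * qq X x).
  apply: measurable_funD; last by apply: measurable_funM.
  apply: measurable_funD; first by apply: measurableT_comp.
  by apply: measurable_funM => //; apply: measurableT_comp.
have m2 : measurable_fun setT (fun x => qq X x + hh X x) by apply: measurable_funD.
apply: measurable_fun_ifT => //.
rewrite /inOmega1 /g1 /g2; apply: measurable_and; first exact: measurable_fun_ler.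
apply: measurable_and; first exact: measurable_fun_ler.
apply: measurable_fun_eqr => //; apply: measurable_funD => //.
exact: measurable_funM.
Qed.

End StateMeasurability.

(** * Choice of the constants and the stability estimate *)

Section Stability.
Variables (R : realType) (chi : R -> R) (A M : R).
Hypotheses (cut : cutoff_bounds A chi) (M0 : 0 < M) (AM : M + 3 <= A).
Local Notation mu := (@lebesgue_measure R).
Local Notation c10 := (nonlocal_const A).
Local Notation B := (tame_const A).
Implicit Types (s t xi x d : R).

Let A1 : 1 <= A. Proof. by move: M0 AM => X Y; lra. Qed.
Let A0 : 0 <= A := le_trans ler01 A1.
Let B1 : 1 <= B := le_trans A1 (tame_const_ge A1).
Let MA : M <= A. Proof. by move: AM => X; lra. Qed.

(** [m] is the lower bound of [q + h] given by [inB]. In [eta], [M + 1] in place of [M] also ensures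
    [eta <= 1]. The L^2 bounds [n] and [k] exceed the square roots of the integrals they stand
    for. *)
Let m : R := M^-1.
Let eta : R := (100 * B ^+ 2 * (M + 1))^-1.
Let n : R := 4 * solution_sqint M A + 1.
Let k : R := 2 * (A + 1).
(** Each summand is one smallness condition on the lifespan [1 / rate]: [S <= 1], the bootstrap, the
    majorant iteration, the small regime and the contraction. *)
Let rate : R := 1 + sup_rate A + 10 * (3 * A * c10) + 3 * B ^+ 2 / eta
  + 2 * contraction_const A m eta n k.
Definition lifespan : R := rate^-1.
Local Notation S := lifespan.

Let m0 : 0 < m. Proof. by rewrite invr_gt0. Qed.
Let c100 : 0 <= c10. Proof. by rewrite /nonlocal_const !mulr_ge0 ?exprn_ge0 ?expR_ge0. Qed.
Let sg0 : 0 <= solution_sqint M A.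
Proof.
rewrite /solution_sqint; have X := sqr_ge0 M; have Y := sqr_ge0 (3 * A * c10).
have Z : 0 <= (3 * A * c10) ^+ 2 * (2 * (2 * (A + 1)) + 2 * (4 * (2 * (A + 1)))).
  by rewrite mulr_ge0// !addr_ge0// !mulr_ge0// addr_ge0.
by move: Z; lra.
Qed.
Let n0 : 0 <= n. Proof. by rewrite addr_ge0// mulr_ge0. Qed.
Let k0 : 0 <= k. Proof. by rewrite mulr_ge0// addr_ge0. Qed.
Let B20 : 1 <= B ^+ 2. Proof. exact: exprn_ege1. Qed.
Let den : 1 <= 100 * B ^+ 2 * (M + 1).
Proof.
have H : 1 * 1 <= B ^+ 2 * (M + 1) by apply: ler_pM => //; rewrite lerDr ltW.
by rewrite -mulrA; move: H; lra.
Qed.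
Let eta0 : 0 < eta. Proof. by rewrite invr_gt0 (lt_le_trans ltr01). Qed.
Let eta1 : eta <= 1. Proof. by rewrite invf_le1// (lt_le_trans ltr01). Qed.
Let etam : 100 * B ^+ 2 * eta <= m.
Proof.
have B2 : 0 < B ^+ 2 := lt_le_trans ltr01 B20.
have -> : 100 * B ^+ 2 * eta = (M + 1)^-1.
  rewrite /eta; field; apply/andP; split; first by rewrite gt_eqF// addr_gt0.
  by rewrite gt_eqF// (lt_le_trans ltr01).
by rewrite lef_pV2 ?posrE ?addr_gt0// lerDl.
Qed.
Let cc0 : 0 <= contraction_const A m eta n k.
Proof. exact: contraction_const_ge0. Qed.
Let rate_parts : [/\ 1 <= rate, sup_rate A <= rate, 10 * (3 * A * c10) <= rate,
  3 * B ^+ 2 / eta <= rate & 2 * contraction_const A m eta n k <= rate].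
Proof.
have X1 : 0 <= sup_rate A by rewrite /sup_rate !mulr_ge0// addr_ge0.
have X2 : 0 <= 10 * (3 * A * c10) by rewrite !mulr_ge0.
have X3 : 0 <= 3 * B ^+ 2 / eta by rewrite divr_ge0 ?mulr_ge0 ?sqr_ge0// ltW.
have X4 : 0 <= 2 * contraction_const A m eta n k by rewrite mulr_ge0.
by rewrite /rate; split; lra.
Qed.
Let rate0 : 0 < rate.
Proof. by case: rate_parts => /(lt_le_trans ltr01). Qed.
Let S0 : 0 < S. Proof. by rewrite invr_gt0. Qed.
Let Sle x : x <= rate -> S * x <= 1.
Proof. by move=> xr; rewrite /S mulrC ler_pdivrMr// mul1r. Qed.
Let S1 : S <= 1. Proof. by case: rate_parts => /Sle; rewrite mulr1. Qed.
Let Seta : 3 * B ^+ 2 * S <= eta.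
Proof. by case: rate_parts => _ _ _ /Sle + _; rewrite mulrA ler_pdivrMr// mul1r mulrC. Qed.
Let Scontr : S * contraction_const A m eta n k <= 2^-1.
Proof. by case: rate_parts => _ _ _ _ /Sle; lra. Qed.

Lemma lifespan_gt0 : 0 < S. Proof. exact: S0. Qed.
Lemma lifespan_le1 : S <= 1. Proof. exact: S1. Qed.

Variables (X0 Y0 : state R) (X Y : R -> state R).
Hypotheses (GX : inG chi X0) (BX : inB M X0) (GY : inG chi Y0) (BY : inB M Y0)
  (solX : is_solution chi X0 X) (solY : is_solution chi Y0 Y).

Lemma common_dominator : exists CN N,
  [/\ dominator CN N, bounded_by X A S N, bounded_by Y A S N & l2_le N n].
Proof.
have [_ R2 R3 _ _] := rate_parts.
have R3' : S * (3 * A * c10) <= 10^-1 by move: (Sle R3); lra.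
have [N [dN bN JN]] := solution_dominator solX M0 AM cut A1 BX S0 S1 (Sle R2) R3'.
have [N' [dN' bN' JN']] := solution_dominator solY M0 AM cut A1 BY S0 S1 (Sle R2) R3'.
exists (solution_sup A + solution_sup A), (fun x => N x + N' x); split.
- exact: dominatorD.
- apply: aeS bN _ => xi H t tS; apply: pt_bound_le (H t tS) => //.
  by rewrite lerDl (dominator_ge0 _ dN').
- apply: aeS bN' _ => xi H t tS; apply: pt_bound_le (H t tS) => //.
  by rewrite lerDr (dominator_ge0 _ dN).
apply: le_trans (sqintD_le dN.1 dN'.1 JN JN') _; rewrite lee_fin /n.
by have := sqr_ge0 (solution_sqint M A); move: sg0; rewrite !expr2; lra.
Qed.

Lemma initial_controlled Z0 Z N : inG chi Z0 -> inB M Z0 -> is_solution chi Z0 Z ->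
  bounded_by Z A S N -> controlled chi A S m N Z0 Z.
Proof.
move=> [_ [_ [_ [_ [q0 [h0 [_ [_ cons]]]]]]]] bZ sZ bd.
have [_ _ c _] := initial_norms bZ; have [_ _ _ [_ _ _ _ kk0]] := initial_norms bZ.
split => //; [exact: le_trans MA|exact: le_trans MA|].
case: bZ => _ [[nz _] H].
have inv : (Linfnorm (fun xi => (qq Z0 xi + hh Z0 xi)^-1)%R <= M%:E)%E.
  apply: le_trans H; rewrite leeDr// /Vbarnorm.
  by do ?apply: adde_ge0; rewrite ?Enorm_ge0 ?Linfnorm_ge0 ?L2norm_ge0 ?lee_fin.
move/Linfnorm_leP : inv => inv.
apply: aeS (aeI (aeI q0 h0) (aeI cons (aeI nz inv))) _ => xi [[q h] [e [z i]]].
split => //.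
have s0 : 0 < qq Z0 xi + hh Z0 xi by rewrite lt_neqAle eq_sym z addr_ge0.
by move: i; rewrite ger0_norm ?invr_ge0 ?(ltW s0)// -[X in _ <= X -> _]invrK lef_pV2 ?posrE ?invr_gt0.
Qed.

Let gK : R := g_const A m eta.
Let eK : R := 3 * contraction_const A m eta n k + 1.
(** 40 comes from adding six L^2 differences of data by [l2_leD], and [3 + 2 * A ^+ 2] from the
    uniform bound of [zeta] and [U]. *)
Let dK : R := 43 + 2 * A ^+ 2.
Definition near_const : R :=
  6 * (eK * dK) + 2 * dK + gK * (2 * (2 * (dK + dK * n) + 4 * (eK * dK))).
Definition far_const : R :=
  6 * (2 * A + 2 * (2 * (M + M) + 2 * n)) + 2 * (2 * A)
  + 2 * (2 * (2 * (M + M) + 2 * n) + 2 * (2 * (2 * (M + M) + 2 * n) + 2 * n)) + 1.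

Let gK0 : 0 <= gK.
Proof.
have X1 := divr_ge0 (sqr_ge0 B) (ltW eta0); have X2 := divr_ge0 (sqr_ge0 B) (ltW m0).
by rewrite /gK /g_const -!(mulrA _ (B ^+ 2)); move: B1 X1 X2; lra.
Qed.
Let eK0 : 0 <= eK. Proof. by rewrite addr_ge0// mulr_ge0. Qed.
Let dK0 : 0 < dK. Proof. by rewrite ltr_pwDl// mulr_ge0// sqr_ge0. Qed.

Lemma near_const_ge0 : 0 <= near_const.
Proof.
have d0 := ltW dK0; have ed : 0 <= eK * dK by exact: mulr_ge0.
have dn : 0 <= dK * n by exact: mulr_ge0.
have X1 : 0 <= 2 * (2 * (dK + dK * n) + 4 * (eK * dK)) by move: d0 ed dn; lra.
by have := mulr_ge0 gK0 X1; rewrite /near_const; move: d0 ed; lra.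
Qed.

Lemma initial_diff_le : \forall xi \ae mu,
  [/\ `|Ubar X0 xi - Ubar Y0 xi| <= 2 * A, `|qq X0 xi - qq Y0 xi| <= 2 * A,
      `|ww X0 xi - ww Y0 xi| <= 2 * A & [/\ `|hh X0 xi - hh Y0 xi| <= 2 * A,
      `|rbar X0 xi - rbar Y0 xi| <= 2 * A & `|gX X0 xi - gX Y0 xi| <= 6 * A]].
Proof.
have [q0X q0Y] : (\forall xi \ae mu, 0 <= qq X0 xi) /\ (\forall xi \ae mu, 0 <= qq Y0 xi).
  by split; [case: GX => _ [_ [_ [_ []]]]|case: GY => _ [_ [_ [_ []]]]].
apply: aeS (aeI (aeI q0X q0Y) (aeI (initial_bound BX) (initial_bound BY))) _.
move=> xi [[qX qY] [[_ bUX bqX [bwX bhX brX]] [_ bUY bqY [bwY bhY brY]]]].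
have D x y : `|x| <= M + 1 -> `|y| <= M + 1 -> `|x - y| <= 2 * A.
  by move=> xM yM; apply: le_trans (normrB_le xM yM) _; move: AM => X1; lra.
have D' x y : `|x| <= M -> `|y| <= M -> `|x - y| <= 2 * A.
  by move=> xM yM; apply: D; [apply: le_trans xM _|apply: le_trans yM _]; rewrite lerDl.
have DU := D' _ _ bUX bUY; have Dq := D _ _ bqX bqY; have Dw := D' _ _ bwX bwY.
have Dh := D' _ _ bhX bhY; have Dr := D' _ _ brX brY.
have Dg : `|gX X0 xi - gX Y0 xi| <= 6 * A.
  have -> : gX X0 xi - gX Y0 xi = (qq X0 xi - qq Y0 xi) + (hh X0 xi - hh Y0 xi)
    + ((gX X0 xi - (qq X0 xi + hh X0 xi)) - (gX Y0 xi - (qq Y0 xi + hh Y0 xi))) by ring.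
  have HX := le_trans (gX_near_g2 qX) (le_trans bhX MA).
  have HY := le_trans (gX_near_g2 qY) (le_trans bhY MA).
  by apply: le_trans (normrD_le (normrD_le Dq Dh) (normrB_le HX HY)) _; lra.
by [].
Qed.

Lemma near_stability d : 0 < d -> (dR X0 Y0 <= d%:E)%E -> kappa X0 Y0 = 0 ->
  forall t, 0 <= t <= S -> (dR (X t) (Y t) <= (near_const * d)%:E)%E.
Proof.
move=> d0 Hd kap0 t tS; have [t0 _] := andP tS; have d0' := ltW d0.
have [CN [N [dN bX bY lN]]] := common_dominator.
have cX := initial_controlled GX BX solX bX; have cY := initial_controlled GY BY solY bY.
have [z U c v [w h r kd [g _]]] := dR_components Hd.
have VX : inVbar X0 by case: GX => _ [_ []].
have VY : inVbar Y0 by case: GY => _ [_ []].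
have [mzX mUX mqX [mwX mhX mrX]] := inVbar_measurable VX.
have [mzY mUY mqY [mwY mhY mrY]] := inVbar_measurable VY.
have mgX := measurable_gX VX; have mgY := measurable_gX VY.
have a6 : 1 <= 6 * A by move: A1 => X1; lra.
(* [6 * A] bounds all these differences almost everywhere, by [initial_diff_le]: the truncation
   bounds [phi] everywhere and changes it on a null set only. *)
pose cl f x := clamp (6 * A) (f x : R).
have cD (f f' : R -> R) : measurable_fun setT f -> measurable_fun setT f' -> dominator (6 * A) (cl (fun x => f x - f' x)).
  by move=> mf mf'; apply: dominator_clamp => //; exact (measurable_funB mf mf').
have cL (f f' : R -> R) : measurable_fun setT f -> measurable_fun setT f' ->
    (L2norm (fun x => (f x - f' x)%R) <= d%:E)%E -> l2_le (cl (fun x => f x - f' x)) d.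
  by move=> mf mf' H; apply: sqint_clamp => //; exact (measurable_funB mf mf').
have v' : (L2norm (fun xi => (qq X0 xi - qq Y0 xi)%R) <= d%:E)%E.
  by move: v; congr (L2norm _ <= _)%E; apply/funext => x; rewrite /vv; ring.
have dU := cD _ _ mUX mUY; have dq := cD _ _ mqX mqY; have dw := cD _ _ mwX mwY.
have dh := cD _ _ mhX mhY; have dr := cD _ _ mrX mrY; have dg := cD _ _ mgX mgY.
have lU := cL _ _ mUX mUY U; have lq := cL _ _ mqX mqY v'; have lw := cL _ _ mwX mwY w.
have lh := cL _ _ mhX mhY h; have lr := cL _ _ mrX mrY r; have lg := cL _ _ mgX mgY g.
have dphi := dominatorD (dominatorD (dominatorD dU dq) (dominatorD dw dh)) (dominatorD dr dg).
set phi := fun x : R => _ in dphi.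
have d2 : 0 <= 2 * (d + d) by rewrite mulr_ge0// addr_ge0.
have d4 : 0 <= 2 * (2 * (d + d) + 2 * (d + d)) by rewrite mulr_ge0// addr_ge0.
have lphi := l2_leD (dominatorD (dominatorD dU dq) (dominatorD dw dh)).1 (dominatorD dr dg).1 d4 d2
  (l2_leD (dominatorD dU dq).1 (dominatorD dw dh).1 d2 d2 (l2_leD dU.1 dq.1 d0' d0' lU lq)
    (l2_leD dw.1 dh.1 d0' d0' lw lh)) (l2_leD dr.1 dg.1 d0' d0' lr lg).
(* For [U]: [3 * d] from the Sobolev bound, and [A ^+ 2 * d + A * d] from the difference of the two
   [c chi(y)]. *)
pose z0 := (3 + 2 * A ^+ 2) * d; pose del := dK * d.
have A2 : 0 <= A ^+ 2 := sqr_ge0 A.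
have Ad : A * d <= A ^+ 2 * d by rewrite ler_wpM2r// expr2 ler_peMr.
have A2d : 0 <= A ^+ 2 * d by rewrite mulr_ge0.
have dz0 : d <= z0 by rewrite /z0; lra.
have z00 : 0 <= z0 by rewrite (le_trans _ dz0).
have UUz0 : 3 * d + (A ^+ 2 * d + A * d) <= z0 by rewrite /z0; move: Ad; lra.
have ddel : d <= del by rewrite /del /dK; lra.
have zdel : z0 <= del by rewrite /z0 /del /dK; lra.
have del0 : 0 < del by rewrite mulr_gt0.
have lphi' : l2_le phi del.
  apply: l2_le_weaken lphi; first by rewrite mulr_ge0// addr_ge0.
  by rewrite /del /dK; lra.
have [_ _ cX0 _] := initial_norms BX.
have cXA := le_trans cX0 MA.
move/Linfnorm_leP : z => z.
have zU : forall b, `|UU chi X0 b - UU chi Y0 b| <= 3 * d + (A ^+ 2 * d + A * d).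
  have wU := weak_derivB (proj1 (proj2 GX)) (proj1 (proj2 GY)).
  apply: (sup_le_of_l2 d0 wU (measurable_funB mwX mwY) (measurable_funB mUX mUY)).
  - exact/L2norm_leP.
  - exact/L2norm_leP.
  apply: aeS z _ => xi zxi.
  have -> : UU chi X0 xi - UU chi Y0 xi = (Ubar X0 xi - Ubar Y0 xi) +
    (cc X0 * chi (yy X0 xi) - cc Y0 * chi (yy Y0 xi)) by rewrite /UU; ring.
  apply: normrD_le => //.
  have -> : A ^+ 2 * d + A * d = A * (A * d) + d * A by ring.
  apply: normr_mulB cXA (cut0 cut _) c _; apply: le_trans (cutL0 cut _ _) _; rewrite ler_wpM2l//.
  by have -> : yy X0 xi - yy Y0 xi = zeta X0 xi - zeta Y0 xi by rewrite /yy; ring.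
have mrrX := measurable_rr mrX mqX; have mrrY := measurable_rr mrY mqY.
have kae := (kappa_eq0P mrrX mrrY).1 kap0.
have cd : \forall xi \ae mu, close_data chi z0 phi X0 Y0 xi.
  apply: aeS (aeI (aeI z kae) initial_diff_le) _ => xi [[z1 e1] [DU Dq Dw [Dh Dr Dg]]].
  have A26 : 2 * A <= 6 * A by rewrite ler_wpM2r// ler_nat.
  have C f : `|f| <= 2 * A -> clamp (6 * A) f = `|f| by move=> fA; rewrite clamp_id// (le_trans fA).
  have phiE : phi xi = ((`|Ubar X0 xi - Ubar Y0 xi| + `|qq X0 xi - qq Y0 xi|)
    + (`|ww X0 xi - ww Y0 xi| + `|hh X0 xi - hh Y0 xi|))
    + (`|rbar X0 xi - rbar Y0 xi| + `|gX X0 xi - gX Y0 xi|).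
    by rewrite /phi /cl (C _ DU) (C _ Dq) (C _ Dw) (C _ Dh) (C _ Dr) (clamp_id Dg).
  have [sU sq sw [sh sr sg]] := le_sum6 (normr_ge0 (Ubar X0 xi - Ubar Y0 xi)) (normr_ge0 (qq X0 xi - qq Y0 xi))
    (normr_ge0 (ww X0 xi - ww Y0 xi)) (normr_ge0 (hh X0 xi - hh Y0 xi))
    (normr_ge0 (rbar X0 xi - rbar Y0 xi)) (normr_ge0 (gX X0 xi - gX Y0 xi)).
  split; rewrite ?phiE //.
  - exact: le_trans dz0.
  - exact: le_trans (zU xi) UUz0.
have lcore : l2_le (core A) k.
  apply: le_trans (sqint_core A1) _; rewrite lee_fin /k expr2 ler_peMr//.
  by move: A0 => X1; lra.
have [az aU aq [aw ah ar ag]] := solutions_close cut A1 S0 S1 dN cX cY m0 eta0 etam Seta z00 dphi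
  (le_trans c dz0) (le_trans kd dz0) cd n0 k0 lN lcore del0 lphi' zdel Scontr tS.
have VXt := sol_inVbar solX t0; have VYt := sol_inVbar solY t0.
have {}ag := ag (measurable_funB (measurable_gX VXt) (measurable_gX VYt)).
have [_ _ mqXt [_ _ mrXt]] := inVbar_measurable VXt.
have [_ _ mqYt [_ _ mrYt]] := inVbar_measurable VYt.
(* For almost every label [r] is constant in time, hence so is its vanishing. *)
have kt : kappa (X t) (Y t) = 0.
  apply/(kappa_eq0P (measurable_rr mrXt mqXt) (measurable_rr mrYt mqYt)).
  apply: aeS (aeI kae (rr_eq0_const cut A1 S0 cX cY)) _ => xi [e1 /(_ t tS)[-> ->]].
  exact: e1.
have e0 : 0 <= eK * del by rewrite mulr_ge0// ltW.
have b0 : 0 <= gK * (2 * (2 * (del + z0 * n) + 4 * (eK * del))).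
  apply: mulr_ge0 => //; apply: mulr_ge0 => //; apply: addr_ge0; last exact: mulr_ge0.
  by apply: mulr_ge0 => //; apply: addr_ge0; [exact: ltW|exact: mulr_ge0].
have cc' : `|cc (X t) - cc (Y t)| <= d by rewrite (sol_cc solX t0) (sol_cc solY t0).
have kk' : `|kk (X t) - kk (Y t)| <= d by rewrite (sol_kk solX t0) (sol_kk solY t0).
have kl : kappa (X t) (Y t) <= 0 by rewrite kt.
apply: le_trans (dR_le e0 b0 az cc' kk' kl aU aq aw ah ar ag) _.
rewrite lee_fin addr0.
have T1 : gK * (2 * (2 * (del + z0 * n) + 4 * (eK * del))) <= gK * (2 * (2 * (del + del * n) + 4 * (eK * del))).
  by rewrite ler_wpM2l// ler_wpM2l// lerD2r ler_wpM2l// lerD2l ler_wpM2r.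
have -> : near_const * d = 6 * (eK * del) + 2 * del + gK * (2 * (2 * (del + del * n) + 4 * (eK * del))).
  by rewrite /near_const /del; ring.
by apply: lerD => //; rewrite lerD2l ler_wpM2l.
Qed.

(** Meant for data at distance at least 1, where a bound depending on [M] and [A] alone is already
    proportional to the distance. *)
Lemma far_stability t : 0 <= t <= S -> (dR (X t) (Y t) <= far_const%:E)%E.
Proof.
move=> tS; have [t0 _] := andP tS.
have [CN [N [dN bX bY lN]]] := common_dominator.
have cX := initial_controlled GX BX solX bX; have cY := initial_controlled GY BY solY bY.
have cr := crude_diff cut A1 S0 S1 dN cX cY.
have VXt := sol_inVbar solX t0; have VYt := sol_inVbar solY t0.
have [_ mUX mqX [mwX mhX mrX]] := inVbar_measurable VXt.
have [_ mUY mqY [mwY mhY mrY]] := inVbar_measurable VYt.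
have mgX := measurable_gX VXt; have mgY := measurable_gX VYt.
have VX : inVbar X0 by case: GX => _ [_ []].
have VY : inVbar Y0 by case: GY => _ [_ []].
have [_ _ mqX0 _] := inVbar_measurable VX; have [_ _ mqY0 _] := inVbar_measurable VY.
have [_ _ cX0 [/Enorm_le[vX _] _ _ _ kX0]] := initial_norms BX.
have [_ _ cY0 [/Enorm_le[vY _] _ _ _ kY0]] := initial_norms BY.
have M0' := ltW M0.
have mB (f g : R -> R) : measurable_fun setT f -> measurable_fun setT g -> measurable_fun setT (fun x => f x - g x).
  by move=> mf mg; exact (measurable_funB mf mg).
have mc (f : R -> R) c : measurable_fun setT f -> measurable_fun setT (fun x => c * f x).
  by move=> mf; exact: measurable_funM.
have mn (f : R -> R) : measurable_fun setT f -> measurable_fun setT (fun x => `|f x|).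
  by move=> mf; apply: measurableT_comp.
have mv : measurable_fun setT (fun x => `|qq X0 x - qq Y0 x|) by apply: mn; exact: mB.
have lq0 : l2_le (fun x => `|qq X0 x - qq Y0 x|) (2 * (M + M)).
  have mvX : measurable_fun setT (vv X0) by apply: measurable_funB.
  have mvY : measurable_fun setT (fun x => -1 * vv Y0 x) by apply: mc; apply: measurable_funB.
  have lX : l2_le (vv X0) M by apply/L2norm_leP.
  have lY : l2_le (fun x => -1 * vv Y0 x) (-1 * M).
    by apply: l2_leZ; [apply: measurable_funB|apply/L2norm_leP].
  rewrite mulN1r in lY; have {}lY : l2_le (fun x => -1 * vv Y0 x) M by rewrite /l2_le -sqrrN.
  have := l2_leD mvX mvY M0' M0' lX lY; apply: le_trans.
  rewrite le_eqVlt; apply/orP; left; apply/eqP; rewrite /sqint; apply: eq_integral => x _.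
  by rewrite real_normK ?num_real// mulN1r /vv; congr (_ ^+ 2)%:E; ring.
have M20 : 0 <= 2 * (M + M) by rewrite mulr_ge0// addr_ge0.
have n20 : 0 <= 2 * n by rewrite mulr_ge0.
have lN2 := l2_leZ 2 dN.1 lN; have mN2 := mc _ 2 dN.1.
pose p : R -> R := fun x => `|qq X0 x - qq Y0 x| + 2 * N x.
pose P := 2 * (2 * (M + M) + 2 * n).
have P0 : 0 <= P by rewrite mulr_ge0// addr_ge0.
have mp : measurable_fun setT p by exact (measurable_funD mv mN2).
have lp : l2_le p P by exact: l2_leD mv mN2 M20 n20 lq0 lN2.
pose a := 2 * A + P.
have a0 : 0 <= a by rewrite addr_ge0// mulr_ge0.
have lpa : l2_le p a by apply: l2_le_weaken lp => //; rewrite lerDr mulr_ge0.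
have L (f g : R -> R) : measurable_fun setT f -> measurable_fun setT g ->
    (\forall xi \ae mu, `|f xi - g xi| <= p xi) -> l2_le (fun xi => f xi - g xi) a.
  by move=> mf mg H; apply: le_trans lpa; apply: sqint_le => //; exact: mB.
pose b := 2 * (P + 2 * (P + 2 * n)).
have b0 : 0 <= b by rewrite mulr_ge0// addr_ge0// mulr_ge0// addr_ge0.
have lg : l2_le (fun xi => gX (X t) xi - gX (Y t) xi) b.
  have P2 : 0 <= 2 * (P + 2 * n) by rewrite mulr_ge0// addr_ge0.
  have mpN := measurable_funD mp mN2.
  apply: le_trans (l2_leD mp mpN P0 P2 lp (l2_leD mp mN2 P0 n20 lp lN2)).
  apply: sqint_le; [exact: mB|exact (measurable_funD mp mpN)|].
  apply: aeS (aeI cr (aeI bX bY)) _ => xi [/(_ t tS)[qX qY [_ _ dq _ dh _]] [/(_ t tS) pX /(_ t tS) pY]].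
  have -> : gX (X t) xi - gX (Y t) xi = (qq (X t) xi - qq (Y t) xi) + ((hh (X t) xi - hh (Y t) xi)
    + ((gX (X t) xi - (qq (X t) xi + hh (X t) xi)) - (gX (Y t) xi - (qq (Y t) xi + hh (Y t) xi)))) by ring.
  have HX := le_trans (gX_near_g2 qX) (pb_hN pX); have HY := le_trans (gX_near_g2 qY) (pb_hN pY).
  by apply: le_trans (normrD_le dq (normrD_le dh (normrB_le HX HY))) _; rewrite /= /p; lra.
have dc : `|cc (X t) - cc (Y t)| <= 2 * A.
  rewrite (sol_cc solX t0) (sol_cc solY t0); apply: le_trans (normrB_le cX0 cY0) _.
  by move: MA; lra.
have dk : `|kk (X t) - kk (Y t)| <= 2 * A.
  rewrite (sol_kk solX t0) (sol_kk solY t0); apply: le_trans (normrB_le kX0 kY0) _.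
  by move: MA; lra.
have kap1 : kappa (X t) (Y t) <= 1 by case/andP: (kappa01 (X t) (Y t)).
have pd : \forall xi \ae mu, pt_diff (2 * A) (p xi) (X t) (Y t) xi.
  by apply: aeS cr _ => xi /(_ t tS)[].
have za : \forall xi \ae mu, `|zeta (X t) xi - zeta (Y t) xi| <= a.
  by apply: aeS pd _ => xi [/le_trans + _ _ _ _ _]; apply; rewrite lerDl.
apply: le_trans (dR_le a0 b0 za dc dk kap1 _ _ _ _ _ lg) _; last by rewrite lee_fin /far_const /a /b /P.
- by apply: L => //; apply: aeS pd _ => xi [].
- by apply: L => //; apply: aeS pd _ => xi [].
- by apply: L => //; apply: aeS pd _ => xi [].
- by apply: L => //; apply: aeS pd _ => xi [].
- by apply: L => //; apply: aeS pd _ => xi [].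
Qed.

Lemma far_const_ge0 : 0 <= far_const.
Proof. by rewrite /far_const; move: A0 M0 n0 => X1 X2 X3; lra. Qed.

(** A distance below 1 excludes the value 1 of [kappa], so [near_stability] applies; otherwise
    [far_stability] does. Both are used with a [d] slightly above the distance, so that the case of
    distance 0 is covered. *)
Lemma stability t : 0 <= t <= S ->
  (dR (X t) (Y t) <= (near_const + far_const + 1)%:E * dR X0 Y0)%E.
Proof.
move=> tS; set K := near_const + far_const + 1.
have K1 := near_const_ge0; have K2 := far_const_ge0.
have K0 : 0 < K by rewrite /K; lra.
have d0 : (0 <= dR X0 Y0)%E.
  rewrite /dR /Vnorm_diff; do ?apply: adde_ge0; rewrite ?Linfnorm_ge0 ?L2norm_ge0 ?lee_fin//.
  by case/andP: (kappa01 X0 Y0).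
have [dfin|] := boolP (dR X0 Y0 \is a fin_num); last first.
  rewrite ge0_fin_numE// -leNgt leye_eq => /eqP ->.
  by rewrite gt0_muley ?lte_fin// leey.
rewrite -(fineK dfin) -EFinM; set e := fine _.
have e0 : 0 <= e by exact: fine_ge0.
have main d : 0 < d -> (dR X0 Y0 <= d%:E)%E -> (dR (X t) (Y t) <= (K * d)%:E)%E.
  move=> dp Hd; have [d1|d1] := leP 1 d.
    apply: le_trans (far_stability tS) _; rewrite lee_fin.
    have : far_const * 1 <= K * d by apply: ler_pM => //; rewrite /K; lra.
    by rewrite mulr1.
  have kap : kappa X0 Y0 = 0.
    have [_ _ _ _ [_ _ _ _ [_ kd]]] := dR_components Hd.
    move: kd; rewrite /kappa; case: ifP => // _ kd.
    by have := le_lt_trans kd d1; rewrite ltxx.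
  apply: le_trans (near_stability dp Hd kap tS) _; rewrite lee_fin ler_wpM2r ?(ltW dp)//.
  by rewrite /K; lra.
apply/lee_addgt0Pr => x x0.
have xK : 0 < x / K by rewrite divr_gt0.
apply: le_trans (main (e + x / K) _ _) _.
- by rewrite ltr_wpDl.
- by rewrite -(fineK dfin) lee_fin lerDl ltW.
- by rewrite -EFinD lee_fin mulrDr mulrCA divff ?mulr1// gt_eqF.
Qed.

End Stability.

Theorem theorem4p6 (R : realType) (chi : R -> R) (Hchi : admissible_chi chi)
  (M : R) (HM : 0 < M) :
  exists Tb K : R, 0 < Tb /\ Tb <= 1 /\
    forall (X0 Xt0 : state R) (X Xt : R -> state R),
      inG chi X0 -> inB M X0 -> inG chi Xt0 -> inB M Xt0 ->
      is_solution chi X0 X -> is_solution chi Xt0 Xt ->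
      forall t : R, 0 <= t <= Tb ->
        (dR (X t) (Xt t) <= K%:E * dR X0 Xt0)%E.
Proof.
have [A' [_ cut']] := admissible_cutoff_bounds Hchi.
(* One constant serves as the bound of the cutoff and of the solutions, with the room 3 above [M]
   that the bootstrap of [sup_bound] uses. *)
pose A := `|A'| + M + 3.
have AM : M + 3 <= A by rewrite /A -addrA lerDr.
have cut : cutoff_bounds A chi.
  by apply: cutoff_bounds_weaken cut'; rewrite /A; have := ler_norm A'; lra.
exists (lifespan A M), (near_const A M + far_const A M + 1); split.
  exact: (lifespan_gt0 HM AM).
split; first exact: (lifespan_le1 HM AM).
move=> X0 Xt0 X Xt GX BX GXt BXt solX solXt t tT.
exact: (stability cut HM AM GX BX GXt BXt solX solXt tT).
Qed.
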